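(* Let $P\subset\mathbb{R}^d$ be a full-dimensional convex polytope with $f_1(P)$ edges. Then every irreducible component of the algebraic boundary $\partial_a IP$ of the intersection body $IP$ has degree at most $f_1(P)-(d-1)$.
   Context: The intersection body $IP$ has radial function $\rho_{IP}(x)=\frac{1}{\|x\|}\operatorname{Vol}_{d-1}(P\cap x^\perp)$ for $x\ne0$, where $x^\perp=\{y:\langle x,y\rangle=0\}$, and $IP=\{x\ne 0:\rho_{IP}(x)\ge1\}\cup\{0\}$. For a compact set $K\subset\mathbb{R}^d$, its algebraic boundary $\partial_a K$ is the Zariski closure (over $\mathbb{R}$) of its Euclidean boundary $\partial K$; it is a union of irreducible hypersurfaces, its irreducible components. *)

(* Defs.v *)
From HB Require Import structures.
From mathcomp Require Import all_boot all_order all_algebra.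
From mathcomp Require Import all_classical all_reals all_analysis.
From mathcomp Require mpoly.

Set Implicit Arguments.
Unset Strict Implicit.
Unset Printing Implicit Defensive.

Import Order.TTheory GRing.Theory Num.Theory.
Import numFieldNormedType.Exports.

Local Open Scope classical_set_scope.
Local Open Scope ring_scope.

Section IntersectionBody.
Variable R : realType.

Definition dotv d (x y : 'rV[R]_d) : R := \sum_(i < d) x ord0 i * y ord0 i.
Definition enorm d (x : 'rV[R]_d) : R := Num.sqrt (dotv x x).

(** n-dimensional Lebesgue measure, defined by iterated integration
    (Cavalieri / Fubini) from the Lebesgue measure on R. *)
Fixpoint lebn (n : nat) : set 'rV[R]_n -> \bar R :=
  match n with
  | 0 => fun S => if pselect (S !=set0) then 1%E else 0%E
  | n'.+1 => fun S =>
      (\int[@lebesgue_measure R]_t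
          @lebn n' [set u : 'rV[R]_n' | S (row_mx (const_mx t : 'rV[R]_1) u)])%E
  end.

(** (d-1)-dimensional volume of K ∩ x^⊥ : the (d-1)-dimensional Lebesgue
    measure of the preimage of K under a linear isometry A from R^(d-1)
    onto x^⊥ (rows of A orthonormal and orthogonal to x). *)
Definition hyperplane_isometries d (x : 'rV[R]_d) : set 'M[R]_(d.-1, d) :=
  [set A | A *m A^T = 1%:M /\ A *m x^T = 0].

Definition section_vol d (K : set 'rV[R]_d) (x : 'rV[R]_d) : \bar R :=
  let A := xget 0 (hyperplane_isometries x) in
  lebn [set u : 'rV[R]_(d.-1) | K (u *m A)].

Definition rho_I d (K : set 'rV[R]_d) (x : 'rV[R]_d) : R :=
  fine (section_vol K x) / enorm x.

Definition intersection_body d (K : set 'rV[R]_d) : set 'rV[R]_d :=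
  [set x | (x != 0 /\ 1 <= rho_I K x) \/ x = 0].

Definition conv_hull d n (V : 'I_n -> 'rV[R]_d) : set 'rV[R]_d :=
  [set x | exists l : 'I_n -> R, (forall i, 0 <= l i) /\
     \sum_(i < n) l i = 1 /\ x = \sum_(i < n) l i *: V i].

Definition full_dim_polytope d (P : set 'rV[R]_d) : Prop :=
  (exists n (V : 'I_n -> 'rV[R]_d), P = conv_hull V) /\ interior P !=set0.

Definition is_face d (P F : set 'rV[R]_d) : Prop :=
  exists c : 'rV[R]_d,
    F = [set y | P y /\ forall z, P z -> dotv c z <= dotv c y].

Definition segment d (v w : 'rV[R]_d) : set 'rV[R]_d :=
  [set x | exists t, 0 <= t <= 1 /\ x = (1 - t) *: v + t *: w].

Definition is_edge d (P F : set 'rV[R]_d) : Prop :=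
  is_face P F /\ exists v w, v != w /\ F = segment v w.

Definition num_edges d (P : set 'rV[R]_d) (f1 : nat) : Prop :=
  ([set F | is_edge P F] #= `I_f1)%card.

Definition eboundary d (K : set 'rV[R]_d) : set 'rV[R]_d :=
  closure K `\` interior K.

Notation rpoly d := (mpoly.mpoly d R).
Definition peval d (p : rpoly d) (x : 'rV[R]_d) : R :=
  mpoly.meval (fun i => x ord0 i) p.
Definition pdeg d (p : rpoly d) : nat := \max_(m <- mpoly.msupp p) mpoly.mdeg m.

Definition zariski_closed d (Z : set 'rV[R]_d) : Prop :=
  exists Fs : set (rpoly d), Z = [set x | forall p, Fs p -> peval p x = 0].

Definition zariski_closure d (S : set 'rV[R]_d) : set 'rV[R]_d :=
  [set x | forall p : rpoly d, (forall y, S y -> peval p y = 0) -> peval p x = 0].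

Definition algebraic_boundary d (K : set 'rV[R]_d) : set 'rV[R]_d :=
  zariski_closure (eboundary K).

Definition zariski_irreducible d (Z : set 'rV[R]_d) : Prop :=
  zariski_closed Z /\ Z !=set0 /\
  forall Z1 Z2, zariski_closed Z1 -> zariski_closed Z2 ->
    Z = Z1 `|` Z2 -> Z = Z1 \/ Z = Z2.

Definition irreducible_component d (V Z : set 'rV[R]_d) : Prop :=
  zariski_irreducible Z /\ Z `<=` V /\
  forall Z', zariski_irreducible Z' -> Z `<=` Z' -> Z' `<=` V -> Z' = Z.

(* p nonzero <-> its support (set of monomials) is nonempty *)
(** degree of a (hypersurface) component Z: the least total degree of a
    nonzero polynomial vanishing on Z.  "degree Z <= n": *)
Definition degree_le d (Z : set 'rV[R]_d) (n : nat) : Prop :=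
  exists p : rpoly d, mpoly.msupp p <> [::] /\ (forall x, Z x -> peval p x = 0) /\
    (pdeg p <= n)%N.

End IntersectionBody.

(* Main.v *)
(* On the hyperplane orthogonal to x the section of P is the convex hull of the points where
   the hyperplane crosses edges of P (and of 0 if it lies in P). The volume of a convex hull is
   a sum of simplex volumes over a triangulation without new vertices, hence each simplex
   contributes a determinant that is affine in every crossing point. Each crossing point is a
   linear vector divided by one linear form, so after projecting along one of the crossed edges
   the equation rho(x) = 1 becomes a polynomial equation of degree at most the number of crossed
   edges. Only finitely many such equations arise when x avoids finitely many hyperplanes, and
   rho is continuous there, so they cut out the boundary together with those hyperplanes.
   Finally at least d - 1 edges are not crossed: all vertices but one on each side of the
   hyperplane own an edge staying on that side, and there are at least d + 1 vertices. *)
Require Import Defs.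
From HB Require Import structures.
From mathcomp Require Import all_boot all_order all_algebra.
From mathcomp Require Import all_classical all_reals all_analysis.
From mathcomp Require Import perm measurable_realfun zify ring lra.
From mathcomp Require Import (canonicals) mpoly.

Set Implicit Arguments.
Unset Strict Implicit.
Unset Printing Implicit Defensive.

Import Order.TTheory GRing.Theory Num.Theory.
Import numFieldNormedType.Exports.

Local Open Scope classical_set_scope.
Local Open Scope ring_scope.

(** * Iterated Lebesgue measure and linear changes of variables *)

(** The cleared equation bounds a degree only if its polynomial is nonzero, and this comes from
    homogeneity: crossing points do not change under x |-> 2x, so the volume side stays put while
    the linear form coming from the projection doubles; a generic zero x is thus never a zero at 2x.
    The Euclidean norm, which is not polynomial in x, disappears because a projection Pi scales
    volumes in x^perp by |det (x^T | Pi)| / |x|, whose denominator cancels the 1/|x| in rho. The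
    triangulations are regular ones: heights on the points select simplices by strict inequalities,
    so the selection survives small perturbations. Heights may be chosen anew at every x, since the
    polynomial only remembers which simplices were selected and the signs of their determinants. An
    irreducible set covered by finitely many hypersurfaces lies in one of them, so it suffices to
    cover the boundary by zero sets of finitely many nonzero polynomials within the bound. *)

Section IteratedMeasure.
Variable R : realType.
Local Notation mu := (@lebesgue_measure R).

(** The pushforward under t |-> a t + b, scaled by |a|, agrees with Lebesgue measure on half-open
    intervals; uniqueness of Lebesgue measure does the rest. *)
Lemma lebesgue_measure_affine (a b : R) (A : set R) : a != 0 -> measurable A ->
  (`|a|%:E * mu ((fun t : R => (a * t + b)%R) @^-1` A) = mu A)%E.
Proof.
move=> a0 mA.
have mf : measurable_fun setT (fun t : R => (a * t + b) : measurableTypeR R).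
  by apply: measurable_funD => //; apply: measurable_funM.
pose f := fun t : R => (a * t + b) : measurableTypeR R.
have na : 0 <= `|a| by [].
pose nu := mscale (NngNum na) (pushforward mu f).
suff -> : mu A = nu mf A by [].
apply: lebesgue_measure_unique => // _ [[x y]] _ <-.
transitivity (`|a|%:E * lebesgue_measure (f @^-1` `]x, y]%classic))%E; last by [].
have [a_gt0|a_lt0|/eqP] := ltgtP 0 a; last by rewrite eq_sym (negbTE a0).
- rewrite (_ : f @^-1` _ = `]((x - b) / a), ((y - b) / a)]%classic); last first.
    apply/seteqP; split => t /=; rewrite !in_itv /= ltr_pdivrMr // ler_pdivlMr //
      ltrBlDr lerBrDr (mulrC t) => //.
  rewrite !lebesgue_measure_itv /= !lte_fin ltr_pM2r ?invr_gt0 // ltrD2r gtr0_norm //.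
  case: ifP => _; last by rewrite mule0.
  by rewrite -!EFinD -EFinM; congr EFin; field.
- rewrite (_ : f @^-1` _ = `[((y - b) / a), ((x - b) / a)[%classic); last first.
    apply/seteqP; split => t /=; rewrite !in_itv /= ltr_ndivlMr // ler_ndivrMr //
      ltrBlDr lerBrDr (mulrC t) => /andP[-> ->] //.
  rewrite !lebesgue_measure_itv /= !lte_fin ltr_nM2r ?invr_lt0 // ltrD2r ltr0_norm //.
  case: ifP => _; last by rewrite mule0.
  by rewrite -!EFinD -EFinM; congr EFin; field.
Qed.

Lemma ge0_integral_affine (a b : R) (f : R -> \bar R) : a != 0 ->
  measurable_fun setT f -> (forall t, 0 <= f t)%E ->
  (\int[mu]_t f (a * t + b)%R = `|a|^-1%:E * \int[mu]_t f t)%E.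
Proof.
move=> a0 mf f0.
have mg : measurable_fun setT (fun t : R => (a * t + b) : measurableTypeR R).
  by apply: measurable_funD => //; apply: measurable_funM.
pose g := fun t : R => (a * t + b) : measurableTypeR R.
have na : 0 <= `|a| by [].
pose nu := mscale (NngNum na) (pushforward mu g).
rewrite -[in RHS](_ : (\int[nu mg]_t f t = \int[mu]_t f t)%E); last first.
  by apply: eq_measure_integral => A mA _; apply: lebesgue_measure_affine.
rewrite ge0_integral_mscale // ge0_integral_pushforward //= muleA -EFinM mulVf ?normr_eq0 //.
by rewrite mul1e.
Qed.

(** [lebn] accepts arbitrary sets, but additivity and change of variables need measurability at
    every level of the iteration. Boolean combinations of half-spaces are stable under affine
    preimages, hence under coordinate sections, and include simplices and convex hulls. *)
Inductive semilin n : set 'rV[R]_n -> Prop :=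
| semilin_half (c : 'cV[R]_n) (b : R) : semilin [set u | 0 <= b + (u *m c) 0 0]
| semilinC S : semilin S -> semilin (~` S)
| semilinU S T : semilin S -> semilin T -> semilin (S `|` T).

Lemma semilinI n (S T : set 'rV[R]_n) : semilin S -> semilin T -> semilin (S `&` T).
Proof.
by move=> sS sT; rewrite -[S `&` T]setCK setCI; apply: semilinC; apply: semilinU; apply: semilinC.
Qed.

Lemma semilinT n : semilin [set: 'rV[R]_n].
Proof.
pose H := [set u : 'rV[R]_n | 0 <= 0 + (u *m (0 : 'cV_n)) 0 0].
have -> : [set: 'rV[R]_n] = H `|` ~` H by rewrite setUv.
by apply: semilinU; [|apply: semilinC]; apply: semilin_half.
Qed.

Lemma semilin0 n : semilin (@set0 'rV[R]_n).
Proof. by rewrite -setCT; apply/semilinC/semilinT. Qed.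

Lemma semilin_bigcup n (I : finType) (p : pred I) (F : I -> set 'rV[R]_n) :
  (forall i, p i -> semilin (F i)) -> semilin [set u | exists2 i, p i & F i u].
Proof.
move=> sF.
have -> : [set u | exists2 i, p i & F i u] = \big[setU/set0]_(i | p i) F i.
  apply/seteqP; split => [u [i pi Fu]|u] /=.
    by rewrite (bigD1 i) //=; left.
  by elim/big_ind: _ => // [A B IHA IHB [/IHA|/IHB] //|i pi Fu]; exists i.
by elim/big_ind: _ => //; [exact: semilin0|move=> *; exact: semilinU].
Qed.

Lemma semilin_bigcap n (I : finType) (p : pred I) (F : I -> set 'rV[R]_n) :
  (forall i, p i -> semilin (F i)) -> semilin [set u | forall i, p i -> F i u].
Proof.
move=> sF.
have -> : [set u | forall i, p i -> F i u] = ~` [set u | exists2 i, p i & (~` F i) u].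
  apply/seteqP; split => u /=.
    by move=> H [i pi]; apply; apply: H.
  by move=> H i pi; apply: contrapT => nF; apply: H; exists i.
by apply/semilinC/semilin_bigcup => i pi; apply/semilinC/sF.
Qed.

Lemma semilin_affine m n (M : 'M[R]_(m, n)) (v : 'rV[R]_n) (S : set 'rV[R]_n) :
  semilin S -> semilin [set u : 'rV[R]_m | S (u *m M + v)].
Proof.
elim=> [c b|T _ IH|T T' _ IH _ IH'].
- rewrite (_ : [set u | _] = [set u | 0 <= (b + (v *m c) 0 0) + (u *m (M *m c)) 0 0]).
    exact: semilin_half.
  by apply/funext => u /=; rewrite mulmxDl mxE mulmxA addrA addrAC -addrA (addrC ((v *m c) 0 0)) addrA.
- exact: (semilinC IH).
- exact: (semilinU IH IH').
Qed.

Lemma semilin_section n (S : set 'rV[R]_n.+1) (t : R) : semilin S ->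
  semilin [set u : 'rV[R]_n | S (row_mx (const_mx t : 'rV_1) u)].
Proof.
move=> /(@semilin_affine n (1 + n) (row_mx 0 1%:M) (row_mx (const_mx t) 0)).
rewrite (_ : mkset _ = [set u : 'rV[R]_n | S (row_mx (const_mx t : 'rV_1) u)]) //.
apply/funext => u /=; congr S.
by rewrite mul_mx_row mulmx0 mulmx1 add_row_mx add0r addr0.
Qed.

Lemma sigma_finite_prod (d1 d2 : measure_display) (T1 : measurableType d1) (T2 : measurableType d2)
    (m1 : {sigma_finite_measure set T1 -> \bar R}) (m2 : {sigma_finite_measure set T2 -> \bar R}) :
  exists m : {sigma_finite_measure set (T1 * T2)%type -> \bar R},
    forall S, m S = (m1 \x m2)%E S.
Proof.
suff sf : sigma_finite setT (m1 \x m2)%E.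
  by exists (HB.pack_for {sigma_finite_measure set (T1 * T2)%type -> \bar R} (m1 \x m2)%E
    (Measure_isSigmaFinite.Build _ _ _ (m1 \x m2)%E sf)).
have /sigma_finiteP[F [TF ndF Foo]] := sigma_finiteT m1.
have /sigma_finiteP[G [TG ndG Goo]] := sigma_finiteT m2.
exists (fun n => F n `*` G n).
  rewrite -setXTT TF TG; apply/seteqP; split=> [[x y] [[i _ Fi] [j _ Gj]]|[x y] [i _ [/= Fi Gi]]].
    exists (maxn i j) => //; split => /=.
      by move: Fi; apply/subsetPset/ndF/leq_maxl.
    by move: Gj; apply/subsetPset/ndG/leq_maxr.
  by split; exists i.
move=> k; have [? ?] := Foo k; have [? ?] := Goo k.
split; first exact: measurableX.
by rewrite product_measure1E // lte_mul_pinfty // ge0_fin_numE.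
Qed.

Definition rcons0 n (t : R) (u : 'rV[R]_n) : 'rV[R]_n.+1 := row_mx (const_mx t : 'rV_1) u.

Lemma rcons0E n t (u : 'rV[R]_n) i :
  rcons0 t u 0 i = if unlift ord0 i is Some j then u 0 j else t.
Proof.
case: unliftP => [j ->|->].
  rewrite (_ : lift ord0 j = rshift 1 j); last exact: val_inj.
  by rewrite [LHS]row_mxEr.
rewrite (_ : ord0 = lshift n (0 : 'I_1)); last exact: val_inj.
by rewrite [LHS]row_mxEl mxE.
Qed.

Lemma measurable_rcons0 (dd : measure_display) (T : measurableType dd) n
    (f : T -> R) (phi : T -> 'rV[R]_n) : measurable_fun setT f ->
  (forall i, measurable_fun setT (fun t => phi t 0 i)) ->
  forall i, measurable_fun setT (fun p => rcons0 (f p) (phi p) 0 i).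
Proof.
move=> mf mphi i; under [X in measurable_fun _ X]eq_fun do rewrite rcons0E.
by case: (unlift ord0 i) => [j|]; [exact: mphi|].
Qed.

(** Realizes [lebn] as a genuine measure on an iterated product of lines, read through the
    coordinatewise measurable [phi]. Sigma-finiteness is carried along because section measures must
    be measurable at the next product. *)
Lemma lebn_model n : exists (dd : measure_display) (T : measurableType dd)
    (m : {sigma_finite_measure set T -> \bar R}) (phi : T -> 'rV[R]_n),
  (forall i, measurable_fun setT (fun t => phi t 0 i)) /\
  forall S : set 'rV[R]_n, lebn S = m (phi @^-1` S).
Proof.
elim: n => [|n [dd [T [m [phi [mphi lebE]]]]]].
  exists _, unit, (dirac tt), (fun=> 0); split=> [[]//|S].
  rewrite /= /dirac /= indicE.
  case: pselect => [[u Su]|nS].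
    by rewrite mem_set //= (_ : 0 = u) //; apply/rowP => -[].
  by rewrite memNset //= => S0; apply: nS; exists 0.
have [m' m'E] := sigma_finite_prod (@lebesgue_measure R) m.
exists _, (measurableTypeR R * T)%type, m',
  (fun p => row_mx (const_mx p.1 : 'rV_1) (phi p.2)); split.
  move=> i; apply: measurable_rcons0 => [|j]; first exact: measurable_fst.
  exact: measurableT_comp (mphi j) measurable_snd.
move=> S /=; rewrite m'E /product_measure1; apply: eq_integral => t _ /=.
rewrite lebE /=; congr (m _).
by apply/seteqP; split => y /=; rewrite /xsection /= ?inE.
Qed.

Section Model.
Variables (n : nat) (dd : measure_display) (T : measurableType dd).
Variables (phi : T -> 'rV[R]_n) (mphi : forall i, measurable_fun setT (fun t => phi t 0 i)).

Lemma semilin_measurable S : semilin S -> measurable (phi @^-1` S).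
Proof.
elim=> [c b|U _ IH|U V _ IH _ IH'].
- rewrite (_ : _ @^-1` _ = (fun t => b + (phi t *m c) 0 0) @^-1` `[0, +oo[); last first.
    by apply/seteqP; split => t /=; rewrite in_itv /= andbT.
  rewrite -[X in measurable X]setTI.
  suff : measurable_fun setT (fun t => b + (phi t *m c) 0 0) by apply.
  apply: measurable_funD => //.
  under [X in measurable_fun _ X]eq_fun do rewrite mxE.
  by apply: measurable_sum => i; apply: measurable_funM.
- by rewrite preimage_setC; apply: measurableC.
- by rewrite preimage_setU; apply: measurableU.
Qed.
End Model.

Lemma lebn_ge0 n (S : set 'rV[R]_n) : (0 <= lebn S)%E.
Proof. by have [dd [T [m [phi [_ ->]]]]] := lebn_model n; exact: measure_ge0. Qed.

(** Measurability of row vectors is expressed coordinatewise along a parametrization, so the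
    condition on [h] quantifies over all measurable [f] and [phi]. *)
Lemma measurable_fun_lebn (dd : measure_display) (T' : measurableType dd) n N
    (h : T' -> 'rV[R]_n -> 'rV[R]_N) (S : set 'rV[R]_N) : semilin S ->
  (forall (d1 : measure_display) (T : measurableType d1) (f : T -> T') (phi : T -> 'rV[R]_n),
    measurable_fun setT f -> (forall i, measurable_fun setT (fun t => phi t 0 i)) ->
    forall i, measurable_fun setT (fun t => h (f t) (phi t) 0 i)) ->
  measurable_fun setT (fun t => lebn [set u | S (h t u)]).
Proof.
move=> sS mh; have [d1 [T [m [phi [mphi lebE]]]]] := lebn_model n.
have mpsi := mh _ _ fst (fun p : T' * T => phi p.2) measurable_fst
  (fun j => measurableT_comp (mphi j) measurable_snd).
have := measurable_fun_xsection m (semilin_measurable mpsi sS).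
congr (measurable_fun _ _); apply/funext => t /=; rewrite lebE; congr (m _).
by apply/seteqP; split => y /=; rewrite /xsection /= ?inE.
Qed.

Lemma measurable_lebn_section n (S : set 'rV[R]_n.+1) : semilin S ->
  measurable_fun setT (fun t : measurableTypeR R => lebn [set u : 'rV[R]_n | S (rcons0 t u)]).
Proof. by move=> sS; apply: measurable_fun_lebn => // *; apply: measurable_rcons0. Qed.

Lemma lebn_translate n (v : 'rV[R]_n) (S : set 'rV[R]_n) : semilin S ->
  lebn [set u | S (u + v)] = lebn S.
Proof.
elim: n v S => [|n IH] v S sS.
  by rewrite (thinmx0 v); congr lebn; apply/seteqP; split => u /=; rewrite addr0.
pose v1 : 'rV_1 := @lsubmx _ 1 1 n v; pose v2 : 'rV_n := @rsubmx _ 1 1 n v.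
rewrite /=.
under eq_integral => t _.
  rewrite (_ : mkset _ = [set u : 'rV[R]_n | [set w | S (row_mx (const_mx (1 * t + v1 0 0) : 'rV_1) w)] (u + v2)]); last first.
    apply/funext => u /=; congr S.
    rewrite -[v in LHS](@hsubmxK _ 1 1 n) [LHS](@add_row_mx _ 1 1 n).
    by congr (@row_mx _ 1 1 n _ _); apply/rowP => j; rewrite !mxE !ord1 mul1r.
  rewrite IH; last exact: semilin_section.
  over.
have := @ge0_integral_affine 1 (v1 0 0) _ (oner_neq0 _) (measurable_lebn_section sS)
  (fun t => lebn_ge0 _).
by rewrite normr1 invr1 mul1e => <-.
Qed.

Lemma xcol_rcons0 n s t (u : 'rV[R]_n) :
  xcol 0 1 (rcons0 s (rcons0 t u)) = rcons0 t (rcons0 s u).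
Proof.
apply/rowP => i; rewrite mxE !rcons0E.
case: (unliftP ord0 i) => [j ->|->]; last by rewrite tpermL (_ : 1 = lift ord0 ord0) ?liftK ?rcons0E ?unlift_none //; exact: val_inj.
rewrite rcons0E; case: (unliftP ord0 j) => [k ->|->].
  by rewrite tpermD ?liftK ?rcons0E ?liftK //.
rewrite (_ : lift ord0 ord0 = 1) ?tpermR ?unlift_none //; exact: val_inj.
Qed.

Lemma lebn_swap n (S : set 'rV[R]_n.+2) : semilin S ->
  lebn S = lebn [set u : 'rV[R]_n.+2 | S (u *m tperm_mx 0 1)].
Proof.
move=> sS.
pose g (p : measurableTypeR R * measurableTypeR R) : \bar R :=
  lebn [set u : 'rV[R]_n | S (rcons0 p.1 (rcons0 p.2 u))].
have mg : measurable_fun setT g.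
  apply: (measurable_fun_lebn (h := fun p u => rcons0 p.1 (rcons0 p.2 u))) => //.
  move=> d1 T f phi mf mphi; apply: measurable_rcons0.
    exact: measurableT_comp measurable_fst mf.
  by apply: measurable_rcons0 => //; exact: measurableT_comp measurable_snd mf.
have := @fubini_tonelli _ _ _ _ R mu mu g mg (fun p => lebn_ge0 _).
rewrite /fubini_F /fubini_G => E; rewrite [LHS]E /=.
apply: eq_integral => t _; apply: eq_integral => s _; congr lebn.
apply/funext => u /=; congr S; rewrite -xcolE; exact/esym/xcol_rcons0.
Qed.

(* The functional lebn scales by |det M| under u |-> u M, stated on preimages. *)
Definition lebn_scales n (M : 'M[R]_n) := forall S : set 'rV[R]_n, semilin S ->
  (`|\det M|%:E * lebn [set u | S (u *m M)] = lebn S)%E.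

Lemma lebn_scalesM n (M N : 'M[R]_n) : lebn_scales M -> lebn_scales N -> lebn_scales (M *m N).
Proof.
move=> sM sN S sS; rewrite det_mulmx normrM EFinM.
rewrite -(sN S sS) -(sM [set u | S (u *m N)]); last first.
  by have := semilin_affine N 0 sS; congr semilin; apply/funext => u /=; rewrite addr0.
rewrite muleCA -muleA; congr (_ * (_ * lebn _))%E.
by apply/funext => u /=; rewrite mulmxA.
Qed.

Lemma lebn_scales_swap n : lebn_scales (tperm_mx 0 1 : 'M[R]_n.+2).
Proof. by move=> S sS; rewrite det_perm odd_tperm normr_sign mul1e; apply/esym/lebn_swap. Qed.

(** For a fixed first coordinate t the others are mapped by M and shifted by t b. Translation
    invariance removes the shift, and the substitution t |-> a t contributes |a|. *)
Lemma lebn_scales_block n (a : 'M[R]_1) (b : 'M[R]_(1, n)) (M : 'M[R]_n) :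
  a 0 0 != 0 -> \det M != 0 -> lebn_scales M -> lebn_scales (block_mx a b 0 M : 'M[R]_(1 + n)).
Proof.
move=> a0 M0 sM S sS; rewrite (det_ublock a b M) det_mx11 normrM EFinM.
have M0' : `|\det M| != 0 by rewrite normr_eq0.
pose f t := lebn [set u : 'rV[R]_n | S (rcons0 t u)].
have -> : lebn [set u : 'rV[R]_n.+1 | S (u *m (block_mx a b 0 M : 'M[R]_(1 + n)))] =
   (\int[mu]_t ((`|\det M|^-1)%:E * f (a 0 0 * t + 0)%R))%E.
  apply: eq_integral => t _.
  rewrite addr0; have sf := semilin_section (a 0 0 * t) sS.
  rewrite -[f _](lebn_translate (t *: b)) // -sM; last by have := semilin_affine 1%:M (t *: b) sf; congr semilin; apply/funext => u /=; rewrite mulmx1.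
  rewrite muleA -EFinM mulVf // mul1e; congr lebn; apply/funext => u /=; congr S.
  rewrite [LHS](mul_row_block (const_mx t : 'rV_1) u a b 0 M) mulmx0 addr0.
  congr (@row_mx _ 1 1 n _ _); last by rewrite addrC; congr (_ + _); apply/rowP => j; rewrite !mxE big_ord1 !mxE !ord1.
  by apply/rowP => j; rewrite !mxE big_ord1 !mxE !ord1 mulrC.
have mf : measurable_fun setT f := measurable_lebn_section sS.
have f0 t : (0 <= f t)%E := lebn_ge0 _.
have maf : measurable_fun setT (fun t : R => f (a 0 0 * t + 0)).
  apply: (measurableT_comp mf).
  by apply: measurable_funD => //; apply: measurable_funM.
have -> : (\int[mu]_t ((`|\det M|^-1)%:E * f (a 0 0 * t + 0)%R) =
    (`|\det M|^-1)%:E * \int[mu]_t f (a 0 0 * t + 0)%R)%E.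
  by apply: ge0_integralZl => //; rewrite lee_fin invr_ge0.
rewrite ge0_integral_affine // !muleA -!EFinM mulfK // mulfV ?normr_eq0 //.
by rewrite mul1e.
Qed.

Lemma exists_unitmx_col n (c : 'cV[R]_n.+1) : c != 0 ->
  exists2 N : 'M[R]_n.+1, N \in unitmx & N *m c = delta_mx 0 0.
Proof.
move=> c0; have rk1 : \rank c = 1%N.
  by apply/eqP; rewrite eqn_leq rank_leq_col lt0n mxrank_eq0.
have := mulmx_ebase c; rewrite rk1 => cE.
have r0 : row_ebase c 0 0 != 0.
  by have := row_ebase_unit c; rewrite unitmxE det_mx11 unitfE.
exists ((row_ebase c 0 0)^-1 *: invmx (col_ebase c)).
  by rewrite unitmxZ ?unitmx_inv ?col_ebase_unit // unitfE invr_eq0.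
rewrite -{3}cE -!scalemxAl !mulmxA mulVmx ?col_ebase_unit // mul1mx.
apply/matrixP => i j; rewrite !mxE big_ord1 !mxE !ord1 /= andbT ltnS leqn0.
rewrite -val_eqE /=; case: eqP => _; last by rewrite mul0r mulr0.
by rewrite mul1r mulVf.
Qed.

(** Block triangular matrices reduce to a smaller size and the swap is Tonelli, so it suffices to
    factor M into such matrices. *)
Lemma lebn_scales_unitmx n (M : 'M[R]_n) : M \in unitmx -> lebn_scales M.
Proof.
elim: n M => [|n IH] M uM.
  move=> S _; rewrite det_mx00 normr1 mul1e; congr lebn; apply/funext => u /=.
  by congr S; apply/rowP => -[].
have block (B : 'M[R]_(1 + n)) : B \in unitmx -> dlsubmx B = 0 -> lebn_scales B.
  rewrite -[B]submxK => + B0; rewrite block_mxKdl in B0 *; rewrite B0.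
  rewrite unitmxE det_ublock unitfE mulf_eq0 negb_or det_mx11 => /andP[? ?].
  by apply: lebn_scales_block => //; apply: IH; rewrite unitmxE unitfE.
case: n => [|n] in IH M uM block *; first by apply: block => //; apply/matrixP => -[].
pose a : 'M[R]_1 := ulsubmx (M : 'M[R]_(1 + n.+1)).
pose c : 'cV[R]_n.+1 := dlsubmx (M : 'M[R]_(1 + n.+1)).
have [c0|c0] := eqVneq c 0; first exact: block.
have [N uN Nc] := exists_unitmx_col c0.
pose e : 'rV[R]_n.+1 := delta_mx 0 0.
pose S : 'M[R]_(1 + n.+1) := tperm_mx 0 1.
(* [A1] turns the column c below the corner into the first basis vector, [A2] uses its entry 1 to
   clear the corner a, and [S] moves that 1 into the corner; the result [B] is block triangular.
   Primes denote inverses. *)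
pose A1 : 'M[R]_(1 + n.+1) := block_mx 1%:M 0 0 N.
pose A1' : 'M[R]_(1 + n.+1) := block_mx 1%:M 0 0 (invmx N).
pose A2 : 'M[R]_(1 + n.+1) := block_mx 1%:M (- (a *m e)) 0 1%:M.
pose A2' : 'M[R]_(1 + n.+1) := block_mx 1%:M (a *m e) 0 1%:M.
pose B : 'M[R]_(1 + n.+1) := S *m (A2 *m (A1 *m M)).
have SS : S *m S = 1%:M by rewrite -perm_mxM tperm2 perm_mx1.
have A1A1 : A1' *m A1 = 1%:M.
  by rewrite mulmx_block !mulmx0 !mul0mx !mulmx1 mulVmx // !addr0 add0r -scalar_mx_block.
have A2A2 : A2' *m A2 = 1%:M.
  by rewrite mulmx_block !mulmx0 !mul0mx !mulmx1 !mul1mx !addr0 addNr add0r -scalar_mx_block.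
have ME : M = A1' *m (A2' *m (S *m B)).
  by rewrite /B (mulmxA S S) SS mul1mx (mulmxA A2' A2) A2A2 mul1mx (mulmxA A1' A1) A1A1 mul1mx.
have uB : B \in unitmx.
  rewrite !unitmx_mul uM unitmx_perm /= andbT.
  by rewrite (proj2 (mulmx1_unit A2A2)) (proj2 (mulmx1_unit A1A1)).
have B0 : dlsubmx B = 0.
  have ->: dlsubmx B = dsubmx (S *m (A2 *m (A1 *m lsubmx (M : 'M[R]_(1 + n.+1))))).
    by rewrite !mulmx_lsub; apply/matrixP => i j; rewrite !mxE.
  have -> : lsubmx (M : 'M[R]_(1 + n.+1)) = col_mx a c.
    by rewrite -[LHS]vsubmxK; congr col_mx; apply/matrixP => i j; rewrite !mxE.
  rewrite !mul_block_col !mul1mx !mul0mx addr0 add0r Nc mulNmx -mulmxA mul_delta_mx.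
  rewrite (_ : delta_mx 0 0 = 1%:M :> 'M[R]_1); last by apply/matrixP => i j; rewrite !mxE !ord1.
  rewrite mulmx1 subrr add0r /S -xrowE; apply/matrixP => i j; rewrite !mxE !ord1.
  case: (unliftP ord0 i) => [k ->|->].
    rewrite tpermD //; case: splitP => k' /=; rewrite !mxE ?ord1 //.
    move=> Ek; have -> : k' = lift ord0 k by apply: val_inj; exact/esym/(@addnI 1)/Ek.
    by [].
  rewrite (_ : rshift 1 ord0 = 1) ?tpermR; last exact: val_inj.
  by case: splitP => k' /=; rewrite !mxE.
rewrite ME; apply: lebn_scalesM; last apply: lebn_scalesM; last apply: lebn_scalesM.
- apply: block; last by rewrite block_mxKdl.
  exact: (proj1 (mulmx1_unit A1A1)).
- apply: block; last by rewrite block_mxKdl.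
  exact: (proj1 (mulmx1_unit A2A2)).
- exact: lebn_scales_swap.
- exact: block.
Qed.

(** The case c = 0, b <> 0 (an empty set) is included because fixing the first coordinate can make
    the remaining linear part vanish. *)
Lemma lebn_hyperplane0 n (c : 'cV[R]_n) (b : R) : (b != 0) || (c != 0) ->
  lebn [set u : 'rV[R]_n | b + (u *m c) 0 0 = 0] = 0%E.
Proof.
elim: n c b => [|n IH] c b.
  rewrite (flatmx0 c) eqxx orbF => b0 /=; case: pselect => // -[u].
  by rewrite /= mulmx0 mxE addr0 => /eqP; rewrite (negbTE b0).
rewrite -(@vsubmxK _ 1 n 1 c); set c1 := usubmx _; set c2 := dsubmx _ => bc /=.
have E t : [set u : 'rV[R]_n | b + (row_mx (const_mx t : 'rV_1) u *m col_mx c1 c2) 0 0 = 0] =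
    [set u | (b + t * c1 0 0) + (u *m c2) 0 0 = 0].
  by apply/funext => u /=; rewrite mul_row_col !mxE big_ord1 !mxE addrA.
have [c20|c20] := eqVneq c2 0; last first.
  rewrite integral0_eq // => t _; rewrite E; apply: IH.
  by rewrite c20 orbT.
have [c10|c10] := eqVneq (c1 0 0) 0.
  rewrite integral0_eq // => t _; rewrite E; apply: IH.
  rewrite c10 mulr0 addr0; case/orP: bc => [->//|].
  rewrite c20 (_ : c1 = 0) ?col_mx0 ?eqxx //.
  by apply/matrixP => i j; rewrite !ord1 c10 mxE.
(* Here each fibre is empty or everything, and it is everything only over [t0], a single point. *)
pose t0 := - b / c1 0 0.
pose K := lebn [set u : 'rV[R]_n | (b + t0 * c1 0 0) + (u *m c2) 0 0 = 0].
transitivity (\int[mu]_(t in [set t0]) K)%E; last exact: integral_set1.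
rewrite [RHS]integral_mkcond; apply: eq_integral => t _; rewrite E patchE.
have [->|tt0] := eqVneq t t0; first by rewrite mem_set.
rewrite memNset /=; last exact/eqP.
apply: IH; rewrite (_ : b + t * c1 0 0 != 0) //.
apply: contra_neq tt0 => bt; rewrite /t0 (_ : - b = t * c1 0 0) ?mulfK //.
by apply/eqP; rewrite eqr_oppLR -addr_eq0 bt.
Qed.

Lemma lebn_le n (S T : set 'rV[R]_n) : semilin S -> semilin T -> S `<=` T ->
  (lebn S <= lebn T)%E.
Proof.
have [dd [U [m [phi [mphi lebE]]]]] := lebn_model n; rewrite !lebE => sS sT ST.
apply: le_measure; rewrite ?inE; last exact: preimage_subset.
- exact: semilin_measurable.
- exact: semilin_measurable.
Qed.

Lemma lebn0 n : lebn (@set0 'rV[R]_n) = 0%E.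
Proof.
by have [dd [U [m [phi [mphi ->]]]]] := lebn_model n; rewrite preimage_set0 measure0.
Qed.

Definition unit_cube n := [set u : 'rV[R]_n | forall i, 0 <= u 0 i <= 1].

Lemma semilin_unit_cube n : semilin (@unit_cube n).
Proof.
rewrite (_ : @unit_cube n = [set u | forall i : 'I_n, xpredT i ->
  ([set u | 0 <= 0 + (u *m (delta_mx i 0 : 'cV_n)) 0 0] `&`
   [set u | 0 <= 1 + (u *m (- delta_mx i 0 : 'cV_n)) 0 0]) u]).
  by apply: semilin_bigcap => i _; apply: semilinI; apply: semilin_half.
have E (u : 'rV[R]_n) i : (u *m (delta_mx i 0 : 'cV_n)) 0 0 = u 0 i.
  by rewrite -colE mxE.
have E' (u : 'rV[R]_n) i : (u *m (- delta_mx i 0 : 'cV_n)) 0 0 = - u 0 i.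
  by rewrite mulmxN mxE E.
apply/seteqP; split => u /= H i.
  by move=> _; move: (H i); rewrite E E' add0r subr_ge0 => /andP[].
by move: (H i isT) => []; rewrite E E' add0r subr_ge0 => -> ->.
Qed.

Lemma lebn_unit_cube n : lebn (@unit_cube n) = 1%E.
Proof.
elim: n => [|n IH].
  by rewrite /=; case: pselect => // -[]; exists 0 => -[].
transitivity (\int[mu]_t (\1_(`[0, 1]%classic : set R) t)%:E)%E; last first.
  have mu01 : mu (`[0, 1]%classic : set R) = 1%E.
    by rewrite lebesgue_measure_itv /= lte_fin ltr01 oppr0 adde0.
  by rewrite -mu01 integral_indic // setIT.
apply: eq_integral => t _; rewrite indicE.
have cubeE (u : 'rV[R]_n) : unit_cube (rcons0 t u) <-> 0 <= t <= 1 /\ unit_cube u.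
  split=> [H|[t01 H] i]; last by rewrite rcons0E; case: (unlift ord0 i).
  split; first by have := H ord0; rewrite rcons0E unlift_none.
  by move=> i; have := H (lift ord0 i); rewrite rcons0E liftK.
case: (boolP (0 <= t <= 1)) => t01.
  rewrite mem_set /= ?in_itv //=; transitivity (lebn (@unit_cube n)); last exact: IH.
  congr (lebn _).
  by apply/seteqP; split => u /= H; [have [] := (cubeE u).1 H|apply/(cubeE u).2].
rewrite memNset /= ?in_itv /=; last exact/negP.
transitivity (lebn (@set0 'rV[R]_n)); last exact: lebn0.
congr (lebn _).
by apply/seteqP; split => u //= /(cubeE u).1 [] /(negP t01).
Qed.

(** Additivity modulo a null set: inside [N] the pieces may overlap or fail to cover. Triangulations
    have exactly this defect along lower-dimensional faces. *)
Lemma lebn_partition n (J : finType) (p : pred J) (S N : set 'rV[R]_n) (B : J -> set 'rV[R]_n) :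
  semilin S -> semilin N -> (forall j, p j -> semilin (B j)) ->
  lebn N = 0%E -> (forall j, p j -> B j `<=` S) ->
  (forall u, S u -> ~ N u -> exists2 j, p j & B j u) ->
  (forall u i j, ~ N u -> p i -> p j -> B i u -> B j u -> i = j) ->
  lebn S = (\sum_(j | p j) lebn (B j))%E.
Proof.
have [dd [U [m [phi [mphi lebE]]]]] := lebn_model n.
move=> sS sN sB; rewrite !lebE => N0 BS cov uni.
have mS := semilin_measurable mphi sS; have mN := semilin_measurable mphi sN.
have mB j : p j -> measurable (phi @^-1` B j) by move=> /sB; exact: semilin_measurable.
have dropN A : measurable A -> m A = m (A `\` (phi @^-1` N)).
  move=> mA; transitivity (m (A `\` phi @^-1` N) + m (A `&` phi @^-1` N))%E.
    exact: measureDI.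
  suff -> : m (A `&` phi @^-1` N) = 0%E by rewrite adde0.
  by apply: (@subset_measure0 _ _ _ m _ (phi @^-1` N)) => //; try exact: measurableI; move=> u [].
rewrite (eq_bigr (fun j => m ((phi @^-1` B j) `\` (phi @^-1` N)))); last first.
  by move=> j pj; rewrite lebE dropN //; apply: mB.
rewrite dropN // (_ : _ `\` _ = \big[setU/set0]_(j | p j) ((phi @^-1` B j) `\` (phi @^-1` N))); last first.
  apply/seteqP; split => [u [Su Nu]|u].
    by have [j pj Bj] := cov _ Su Nu; rewrite (bigD1 j) //=; left.
  elim/big_ind: _ => // [A A' IHA IHA' [/IHA|/IHA'] //|j pj [Bj Nj]].
  by split => //; apply: (BS j).
suff : forall s : seq J, uniq s -> (forall j, j \in s -> p j) ->
   measurable (\big[setU/set0]_(j <- s) ((phi @^-1` B j) `\` (phi @^-1` N))) /\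
   m (\big[setU/set0]_(j <- s) ((phi @^-1` B j) `\` (phi @^-1` N))) =
   (\sum_(j <- s) m ((phi @^-1` B j) `\` (phi @^-1` N)))%E.
  move=> /(_ [seq j <- index_enum J | p j]) []; first exact/filter_uniq/index_enum_uniq.
    by move=> j; rewrite mem_filter => /andP[].
  by rewrite !big_filter.
elim=> [|j s IH] /=; first by rewrite !big_nil measure0.
move=> /andP[js us] ps; have [|ms msE] := IH us.
  by move=> i si; apply: ps; rewrite inE si orbT.
have pj : p j by apply: ps; rewrite mem_head.
have mBj : measurable ((phi @^-1` B j) `\` (phi @^-1` N)) by apply: measurableD => //; apply: mB.
rewrite !big_cons; split; first exact: measurableU.
rewrite measureU //; first exact: (congr1 (adde _) msE).
apply/seteqP; split => // u [[Bju Nu]].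
rewrite -bigcup_seq => -[i /= si [Biu _]].
by move: js; rewrite (uni _ j i Nu pj (ps _ _) Bju Biu) ?si // inE si orbT.
Qed.

End IteratedMeasure.

(** * Convex hulls and exposed vertices *)

Section Polytopes.
Variable R : realType.

Lemma dotvE d (x y : 'rV[R]_d) : dotv x y = (x *m y^T) 0 0.
Proof. by rewrite mxE; apply: eq_bigr => i _; rewrite mxE. Qed.

Lemma dotvC d (x y : 'rV[R]_d) : dotv x y = dotv y x.
Proof. by apply: eq_bigr => i _; rewrite mulrC. Qed.

Lemma dotvDr d (x y z : 'rV[R]_d) : dotv x (y + z) = dotv x y + dotv x z.
Proof. by rewrite -big_split; apply: eq_bigr => i _; rewrite mxE mulrDr. Qed.

Lemma dotvZr d (x y : 'rV[R]_d) a : dotv x (a *: y) = a * dotv x y.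
Proof. by rewrite mulr_sumr; apply: eq_bigr => i _; rewrite mxE mulrCA. Qed.

Lemma dotvDl d (x y z : 'rV[R]_d) : dotv (x + y) z = dotv x z + dotv y z.
Proof. by rewrite !(dotvC _ z) dotvDr. Qed.

Lemma dotvZl d (x y : 'rV[R]_d) a : dotv (a *: x) y = a * dotv x y.
Proof. by rewrite !(dotvC _ y) dotvZr. Qed.

Lemma dotv0r d (x : 'rV[R]_d) : dotv x 0 = 0.
Proof. by rewrite -[0](scale0r 0) dotvZr mul0r. Qed.

Lemma dotv0l d (x : 'rV[R]_d) : dotv 0 x = 0.
Proof. by rewrite dotvC dotv0r. Qed.

Lemma dotvNr d (x y : 'rV[R]_d) : dotv x (- y) = - dotv x y.
Proof. by rewrite -scaleN1r dotvZr mulN1r. Qed.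

Lemma dotvNl d (x y : 'rV[R]_d) : dotv (- x) y = - dotv x y.
Proof. by rewrite dotvC dotvNr dotvC. Qed.

Lemma dotvBr d (x y z : 'rV[R]_d) : dotv x (y - z) = dotv x y - dotv x z.
Proof. by rewrite dotvDr dotvNr. Qed.

Lemma dotvBl d (x y z : 'rV[R]_d) : dotv (x - y) z = dotv x z - dotv y z.
Proof. by rewrite dotvDl dotvNl. Qed.

Lemma dotv_sumr d (I : finType) (p : pred I) (x : 'rV[R]_d) (F : I -> 'rV[R]_d) :
  dotv x (\sum_(i | p i) F i) = \sum_(i | p i) dotv x (F i).
Proof. by elim/big_rec2: _ => [|i y1 y2 _ <-]; rewrite ?dotv0r ?dotvDr. Qed.

Definition dotvr := (dotvDr, dotvBr, dotvNr, dotvZr, dotv0r).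
Definition dotvl := (dotvDl, dotvBl, dotvNl, dotvZl, dotv0l).

Lemma dotv_rcons0 n s t (u v : 'rV[R]_n) :
  dotv (rcons0 s u) (rcons0 t v) = s * t + dotv u v.
Proof.
rewrite /dotv big_ord_recl !rcons0E unlift_none; congr (_ + _).
by apply: eq_bigr => i _; rewrite !rcons0E liftK.
Qed.

Lemma rcons0D n s t (u v : 'rV[R]_n) : rcons0 s u + rcons0 t v = rcons0 (s + t) (u + v).
Proof.
by apply/rowP => i; rewrite mxE !rcons0E; case: (unlift ord0 i) => [j|]; rewrite ?mxE.
Qed.

Lemma rcons0Z n a t (u : 'rV[R]_n) : a *: rcons0 t u = rcons0 (a * t) (a *: u).
Proof.
by apply/rowP => i; rewrite mxE !rcons0E; case: (unlift ord0 i) => [j|]; rewrite ?mxE.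
Qed.

Lemma rcons0_sum n (I : finType) (p : pred I) (s : I -> R) (u : I -> 'rV[R]_n) :
  \sum_(i | p i) rcons0 (s i) (u i) = rcons0 (\sum_(i | p i) s i) (\sum_(i | p i) u i).
Proof.
elim/big_rec3: _ => [|i y1 y2 y3 _ ->]; last by rewrite rcons0D.
by apply/rowP => i; rewrite rcons0E; case: (unlift ord0 i) => [j|]; rewrite ?mxE.
Qed.

Lemma rcons0_inj n s t (u v : 'rV[R]_n) : rcons0 s u = rcons0 t v -> s = t /\ u = v.
Proof.
move=> E; split.
  by have := congr1 (fun w : 'rV_n.+1 => w 0 ord0) E; rewrite !rcons0E unlift_none.
apply/rowP => i; have := congr1 (fun w : 'rV_n.+1 => w 0 (lift ord0 i)) E.
by rewrite !rcons0E liftK.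
Qed.

Lemma rcons0_ex n (w : 'rV[R]_n.+1) : exists s u, w = rcons0 s u.
Proof.
exists (w 0 ord0), (\row_j w 0 (lift ord0 j)).
apply/rowP => i; rewrite rcons0E; case: unliftP => [j ->|-> //].
by rewrite mxE.
Qed.

(* Induction on the number of generators (Bartl): if the last generator is positive on
   the witness obtained for the others, project everything along that witness. *)
Lemma farkas d m (A : 'I_m -> 'rV[R]_d) (c : 'rV[R]_d) :
  (exists l : 'I_m -> R, (forall i, 0 <= l i) /\ c = \sum_i l i *: A i) \/
  (exists x, (forall i, dotv (A i) x <= 0) /\ 0 < dotv c x).
Proof.
elim: m => [|m IH] in A c *.
  have [->|c0] := eqVneq c 0.
    by left; exists (fun=> 0); split=> //; rewrite big_ord0.
  right; exists c; split=> [[]//|].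
  rewrite lt0r sumr_ge0 ?andbT => [|i _]; last by rewrite -expr2 sqr_ge0.
  apply: contra c0 => /eqP c20; apply/eqP/rowP => i; rewrite mxE.
  have /psumr_eq0P : forall j, true -> 0 <= c ord0 j * c ord0 j by move=> j _; rewrite -expr2 sqr_ge0.
  by move=> /(_ c20 i isT) /eqP; rewrite mulf_eq0 orbb => /eqP.
pose a := A ord0; pose B i := A (lift ord0 i).
have [[l [l0 cE]]|[x [xB xc]]] := IH B c.
  left; exists (fun i => if unlift ord0 i is Some j then l j else 0); split.
    by move=> i; case: (unlift ord0 i).
  rewrite big_ord_recl unlift_none scale0r add0r cE.
  by apply: eq_bigr => i _; rewrite liftK.
have [ax|ax] := leP (dotv a x) 0.
  right; exists x; split=> // i; case: (unliftP ord0 i) => [j ->|->//]; exact: xB.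
pose k v := dotv v x / dotv a x.
have [[l [l0 cE]]|[y [yB yc]]] := IH (fun i => B i - k (B i) *: a) (c - k c *: a).
  left; pose t := k c - \sum_i l i * k (B i).
  exists (fun i => if unlift ord0 i is Some j then l j else t); split.
    move=> i; case: (unlift ord0 i) => // ; rewrite /t subr_ge0 (@le_trans _ _ 0) //.
      by apply: sumr_le0 => j _; rewrite mulr_ge0_le0 // /k mulr_le0_ge0 ?invr_ge0 // ltW.
    by rewrite /k divr_ge0 // ltW.
  rewrite big_ord_recl unlift_none; under eq_bigr do rewrite liftK.
  move/eqP: cE; rewrite subr_eq => /eqP cE; rewrite /t scalerBl; move: (k c) cE => kc ->.
  rewrite (_ : \sum_i l i *: (B i - k (B i) *: a) =
    \sum_i l i *: B i - (\sum_i l i * k (B i)) *: a).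
    by rewrite addrAC [RHS]addrC addrA.
  rewrite scaler_suml -sumrB; apply: eq_bigr => i _.
  by rewrite scalerBr scalerA.
right; exists (y - (dotv a y / dotv a x) *: x).
have E v : dotv v (y - (dotv a y / dotv a x) *: x) = dotv (v - k v *: a) y.
  by rewrite dotvBr dotvZr dotvBl dotvZl /k; congr (_ - _); rewrite mulrAC [RHS]mulrAC (mulrC (dotv a y)).
split=> [i|]; last by rewrite E.
rewrite E; case: (unliftP ord0 i) => [j ->|->]; first exact: yB.
by rewrite /k -/a mulfV ?gt_eqF // scale1r subrr dotv0l.
Qed.

(** Farkas for the points lifted to height 1: the height coordinate forces the coefficients of a
    cone combination to sum to 1. *)
Lemma conv_hull_separation d n (V : 'I_n -> 'rV[R]_d) y : ~ conv_hull V y ->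
  exists g, forall i, dotv g (V i) < dotv g y.
Proof.
move=> nVy; have [[l [l0]]|[x []]] := farkas (fun i => rcons0 1 (V i)) (rcons0 1 y).
  under eq_bigr do rewrite rcons0Z mulr1.
  rewrite rcons0_sum => /rcons0_inj [l1 yE].
  by case: nVy; exists l.
have [s [g ->]] := rcons0_ex x => gV; rewrite dotv_rcons0 mul1r => gy; exists g => i.
have := gV i; rewrite dotv_rcons0 mul1r !(dotvC g); lra.
Qed.

Lemma conv_hull_gen d n (V : 'I_n -> 'rV[R]_d) i : conv_hull V (V i).
Proof.
exists (fun j => (j == i)%:R); split; first by move=> j; rewrite ler0n.
split; rewrite (bigD1 i) //= eqxx ?scale1r big1 ?addr0 // => j /negbTE -> //.
by rewrite scale0r.
Qed.

Lemma conv_hull_le d n (V : 'I_n -> 'rV[R]_d) g M y : conv_hull V y ->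
  (forall i, dotv g (V i) <= M) -> dotv g y <= M.
Proof.
move=> [l [l0 [l1 ->]]] gV; rewrite dotv_sumr -[M]mul1r -l1 mulr_suml.
by apply: ler_sum => i _; rewrite dotvZr ler_wpM2l.
Qed.

Lemma conv_hull_sub d n m (V : 'I_n -> 'rV[R]_d) (W : 'I_m -> 'rV[R]_d) :
  (forall i, conv_hull W (V i)) -> conv_hull V `<=` conv_hull W.
Proof.
move=> VW y Vy; apply: contrapT => /conv_hull_separation [g gW].
have [M gV My] : exists2 M, (forall i, dotv g (W i) <= M) & M < dotv g y.
  exists (\big[Num.max/(dotv g y - 1)]_i dotv g (W i)).
    by move=> i; rewrite (bigD1 i) //= le_max lexx.
  elim/big_ind: _ => //; first by rewrite ltrBlDr ltrDl.
  by move=> a b; rewrite gt_max => -> ->.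
suff : dotv g y <= M by rewrite leNgt My.
by apply: conv_hull_le Vy _ => i; apply: conv_hull_le (VW i) _.
Qed.

Definition exposes d n (V : 'I_n -> 'rV[R]_d) g i :=
  forall j, j != i -> dotv g (V j) < dotv g (V i).

(** Discard generators lying in the hull of the others; once none is left, separation exposes each
    remaining one. *)
Lemma conv_hull_irredundant d n (V : 'I_n -> 'rV[R]_d) :
  exists m (W : 'I_m -> 'rV[R]_d), conv_hull V = conv_hull W /\
    forall i, exists g, exposes W g i.
Proof.
elim: n V => [|n IH] V; first by exists 0%N, V; split=> // -[].
have [H|] := pselect (forall i, ~ conv_hull (V \o lift i) (V i)).
  exists n.+1, V; split=> // i; have [g gV] := conv_hull_separation (H i).
  by exists g => j ji; case: (unliftP i j) ji => [k -> _|->]; [exact: gV|rewrite eqxx].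
move=> /existsNP [i /contrapT Vi]; have [m [W [VW We]]] := IH (V \o lift i).
exists m, W; split=> //; rewrite -VW; apply/seteqP; split; apply: conv_hull_sub.
  move=> j; case: (unliftP i j) => [k ->|->] //.
  exact: (conv_hull_gen (V \o lift i)).
by move=> j; apply: conv_hull_gen.
Qed.

(** A functional exposing a vertex is strictly smaller at every other point of the hull, so a
    generating family missing that vertex could not produce it as a convex combination. *)
Lemma exposed_conv_hull_gen d n m (V : 'I_n -> 'rV[R]_d) (W : 'I_m -> 'rV[R]_d) g i :
  conv_hull V = conv_hull W -> exposes W g i ->
  (exists j, V j = W i) /\ forall y, conv_hull V y -> y != W i -> dotv g y < dotv g (W i).
Proof.
move=> VW ge.
have strict y : conv_hull V y -> y != W i -> dotv g y < dotv g (W i).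
  rewrite VW => -[l [l0 [l1 yE]]] yi.
  have [lE|/existsNP [j /not_implyP [ji /eqP lj]]] := pselect (forall j, j != i -> l j = 0).
    case/eqP: yi; rewrite yE (bigD1 i) //= big1 => [|j ji]; last by rewrite lE ?scale0r.
    move: l1; rewrite (bigD1 i) //= big1 ?addr0 => [->|j ji]; last by rewrite lE.
    by rewrite scale1r.
  rewrite yE dotv_sumr -[dotv g (W i)]mul1r -l1 mulr_suml (bigD1 j) //= [ltRHS](bigD1 j) //=.
  apply: ltr_leD; first by rewrite dotvZr ltr_pM2l ?ge // lt0r lj l0.
  apply: ler_sum => k _; rewrite dotvZr ler_wpM2l //.
  by have [->|ki] := eqVneq k i => //; apply/ltW/ge.
split=> //; apply: contrapT => nV.
suff : dotv g (W i) < dotv g (W i) by rewrite ltxx.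
have [l [l0 [l1 E]]] : conv_hull V (W i) by rewrite VW; apply: conv_hull_gen.
rewrite {1}E dotv_sumr -[ltRHS]mul1r -l1 mulr_suml.
have [j lj] : exists j, 0 < l j.
  apply: contrapT => nl; suff : \sum_(j < n) l j = 0 by rewrite l1 => /eqP; rewrite oner_eq0.
  apply: big1 => j _; apply/eqP; rewrite eq_le l0 andbT leNgt; apply/negP => lj.
  by apply: nl; exists j.
have gV k : dotv g (V k) < dotv g (W i).
  by apply: strict; [exact: conv_hull_gen|apply/eqP => Vk; apply: nV; exists k].
rewrite (bigD1 j) //= [ltRHS](bigD1 j) //=; apply: ltr_leD.
  by rewrite dotvZr ltr_pM2l.
by apply: ler_sum => k _; rewrite dotvZr ler_wpM2l // ltW.
Qed.

(** Meant for vertex figures, whose points may repeat or be redundant; hence exposure is stated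
    against points different from [V j], not against indices different from j. *)
Lemma exposed_maximizer d n (V : 'I_n -> 'rV[R]_d) (G : 'rV[R]_d) (i0 : 'I_n) :
  exists j g, (forall l, dotv G (V l) <= dotv G (V j)) /\
    forall l, V l != V j -> dotv g (V l) < dotv g (V j).
Proof.
have [m [W [VW We]]] := conv_hull_irredundant V.
have [k0 _] : exists k : 'I_m, true.
  have : conv_hull W (V i0) by rewrite -VW; apply: conv_hull_gen.
  case: m W {We VW} => [|m] W; last by exists ord0.
  by move=> [l [_ [/eqP]]]; rewrite big_ord0 eq_sym oner_eq0.
pose k := [arg max_(k > k0) dotv G (W k)]%O.
have kmax l : dotv G (W l) <= dotv G (W k) by rewrite /k; case: arg_maxP => // i _; apply.
have [g gW] := We k; have [[j Vj] gV] := exposed_conv_hull_gen VW gW.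
exists j, g; rewrite Vj; split=> l; last by apply: gV; apply: conv_hull_gen.
by apply: conv_hull_le kmax; rewrite -VW; apply: conv_hull_gen.
Qed.

End Polytopes.

(** * Edges of polytopes *)

Section Edges.
Variable R : realType.

Lemma segment_conv_hull d n (V : 'I_n -> 'rV[R]_d) p q :
  conv_hull V p -> conv_hull V q -> segment p q `<=` conv_hull V.
Proof.
move=> [l [l0 [l1 ->]]] [k [k0 [k1 ->]]] y [t [/andP[t0 t1] ->]].
exists (fun i => (1 - t) * l i + t * k i); split=> [i|].
  by rewrite addr_ge0 // mulr_ge0 // subr_ge0.
rewrite big_split /= -!mulr_sumr l1 k1 !mulr1 subrK; split=> //.
rewrite !scaler_sumr -big_split /=; apply: eq_bigr => i _.
by rewrite !scalerA -scalerDl.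
Qed.

Lemma dotv_segment d (g p q : 'rV[R]_d) t :
  dotv g ((1 - t) *: p + t *: q) = dotv g p + t * (dotv g q - dotv g p).
Proof. by rewrite !dotvr; ring. Qed.

Section Irredundant.
Variables (d n : nat) (V : 'I_n -> 'rV[R]_d).
Hypothesis Ve : forall i, exists g, exposes V g i.
Let P := conv_hull V.

(* The edge is read off an exposed vertex of the vertex figure
   {(V l - V i) / <c, V i - V l>} at V i, where c exposes V i. *)
Lemma increasing_edge (i : 'I_n) (G : 'rV[R]_d) (j0 : 'I_n) :
  dotv G (V i) < dotv G (V j0) ->
  exists2 j, dotv G (V i) < dotv G (V j) & is_edge P (segment (V i) (V j)).
Proof.
move=> Gj0; have [c ce] := Ve i.
pose D l := dotv c (V i) - dotv c (V l).
have D0 l : l != i -> 0 < D l by move=> /ce; rewrite /D; lra.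
pose z l := (D l)^-1 *: (V l - V i).
(* At an exposed point maximizing G on the figure, G is at least its value at [z j0], which is
   positive, so the corresponding edge increases G. *)
have [j [g [Gmax gz]]] := exposed_maximizer z G j0.
have j0i : j0 != i by apply: contraTneq Gj0 => ->; rewrite ltxx.
have zE l : V l - V i = D l *: z l.
  have [->|li] := eqVneq l i; first by rewrite /D /z !subrr scale0r.
  by rewrite scalerA mulfV ?gt_eqF ?D0 // scale1r.
have Gzj : 0 < dotv G (z j).
  apply: lt_le_trans (Gmax j0).
  by rewrite /z dotvZr dotvBr mulr_gt0 ?invr_gt0 ?D0 // subr_gt0.
have ji : j != i.
  by apply: contraTneq Gzj => ->; rewrite /z subrr scaler0 dotv0r ltxx.
have czE l : l != i -> dotv c (z l) = -1.
  move=> li; rewrite /z dotvZr dotvBr -opprB -/(D l) mulrN mulVf //.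
  by rewrite gt_eqF ?D0.
have GVj : dotv G (V i) < dotv G (V j).
  by rewrite -subr_gt0 -dotvBr zE dotvZr mulr_gt0 ?D0.
exists j => //.
(* two generators on one ray from V i would be collinear *)
have zinj l : l != i -> z l = z j -> l = j.
  move=> li zlj; apply/eqP; apply: contrapT => /negP lj.
  have [gl gle] := Ve l; have [gj gje] := Ve j.
  have jl : j != l by rewrite eq_sym.
  have il : i != l by rewrite eq_sym.
  have ij : i != j by rewrite eq_sym.
  have := gle i il; have := gle j jl; have := gje i ij; have := gje l lj.
  have E h : dotv h (V l) = dotv h (V i) + D l * dotv h (z j).
    by rewrite -zlj -dotvZr -zE dotvBr addrC subrK.
  have E' h : dotv h (V j) = dotv h (V i) + D j * dotv h (z j).
    by rewrite -dotvZr -zE dotvBr addrC subrK.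
  rewrite !E !E'; have := D0 _ li; have := D0 _ ji.
  move: (dotv gl (z j)) (dotv gj (z j)) => a b Dj Dl h1 h2 h3 h4.
  have b0 : 0 < b by rewrite -(pmulr_rgt0 _ Dj); lra.
  have a0 : 0 < a by rewrite -(pmulr_rgt0 _ Dl); lra.
  have : D l < D j by rewrite -(ltr_pM2r b0); lra.
  have : D j < D l by rewrite -(ltr_pM2r a0); lra.
  lra.
(* On the figure c is constantly -1, so this multiple of c makes h vanish at [z j] and negative at
   its other points: h is constant on the segment and smaller at all other vertices. *)
pose h := g + dotv g (z j) *: c.
have hz l : l != i -> dotv h (z l) = dotv g (z l) - dotv g (z j).
  by move=> li; rewrite /h dotvDl dotvZl czE // mulrN1.
have hV l : dotv h (V l) = dotv h (V i) + D l * dotv h (z l).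
  by rewrite -dotvZr -zE dotvBr addrC subrK.
have hVj : dotv h (V j) = dotv h (V i) by rewrite hV hz // subrr mulr0 addr0.
have hlt l : l != i -> l != j -> dotv h (V l) < dotv h (V i).
  move=> li lj; rewrite hV hz // gtrDl pmulr_rlt0 ?D0 // subr_lt0.
  by apply: gz; apply: contra lj => /eqP /(zinj _ li) ->.
have hle l : dotv h (V l) <= dotv h (V i).
  have [->|li] := eqVneq l i => //; have [->|lj] := eqVneq l j; first by rewrite hVj.
  exact/ltW/hlt.
split; last first.
  exists (V i), (V j); split=> //; apply: contraTneq GVj => ->; by rewrite ltxx.
exists h; apply/seteqP; split=> [y yS|y [Py ymax]].
  split; first by apply: segment_conv_hull yS; apply: conv_hull_gen.
  move=> w Pw; have [t [_ ->]] := yS; rewrite dotv_segment hVj subrr mulr0 addr0.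
  exact: conv_hull_le Pw hle.
have [l [l0 [l1 yE]]] := Py.
have lE k : k != i -> k != j -> l k = 0.
  move=> ki kj; apply/eqP; apply: contrapT => /negP lk.
  suff : dotv h y < dotv h (V i) by rewrite ltNge ymax //; apply: conv_hull_gen.
  rewrite yE dotv_sumr -[ltRHS]mul1r -l1 mulr_suml (bigD1 k) //= [ltRHS](bigD1 k) //=.
  apply: ltr_leD; first by rewrite dotvZr ltr_pM2l ?hlt // lt0r lk l0.
  by apply: ler_sum => m _; rewrite dotvZr ler_wpM2l.
have two (W : lmodType R) (F : 'I_n -> W) : (forall k, l k = 0 -> F k = 0) ->
    \sum_k F k = F i + F j.
  move=> F0; rewrite (bigD1 i) //= (bigD1 j) //= big1 ?addr0 // => k /andP[ki kj].
  by apply/F0/lE.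
have lij : l i + l j = 1 by rewrite -l1 (two R^o l).
exists (l j); split; first by rewrite l0 -lij lerDr l0.
by rewrite yE two => [|k ->]; rewrite ?scale0r // -lij addrK.
Qed.

(** The G-lowest endpoint is determined by the segment as a set. This makes increasing edges chosen
    at distinct vertices distinct. *)
Lemma segment_min_inj (G : 'rV[R]_d) p q p' q' : dotv G p < dotv G q -> dotv G p' < dotv G q' ->
  segment p q = segment p' q' -> p = p'.
Proof.
move=> Gpq Gpq' E.
have : segment p' q' p by rewrite -E; exists 0; rewrite lexx ler01 subr0 scale1r scale0r addr0.
have : segment p q p' by rewrite E; exists 0; rewrite lexx ler01 subr0 scale1r scale0r addr0.
move=> [t [/andP[t0 _] E1]] [s [/andP[s0 _] E2]].
have /eqP := congr1 (dotv G) E1; rewrite dotv_segment => /eqP G1.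
have /eqP := congr1 (dotv G) E2; rewrite dotv_segment => /eqP G2.
have : t * (dotv G q - dotv G p) = 0.
  have : 0 <= t * (dotv G q - dotv G p) by rewrite mulr_ge0 // subr_ge0 ltW.
  have : 0 <= s * (dotv G q' - dotv G p') by rewrite mulr_ge0 // subr_ge0 ltW.
  lra.
move=> /eqP; rewrite mulf_eq0 subr_eq0 (gt_eqF Gpq) orbF => /eqP t00.
by rewrite E1 t00 subr0 scale1r scale0r addr0.
Qed.

(** With s the sum of |b i| / a i, the choice e = 1 / (1 + s) gives e |b i| <= a i * s / (1 + s) < a
    i. *)
Lemma small_eps (I : finType) (p : pred I) (a b : I -> R) : (forall i, p i -> 0 < a i) ->
  exists2 e, 0 < e & forall i, p i -> 0 < a i + e * b i.
Proof.
move=> a0; pose s := \sum_(i | p i) `|b i| / a i.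
have s0 : 0 <= s by apply: sumr_ge0 => i /a0 ai; rewrite divr_ge0 // ltW.
exists (1 + s)^-1; first by rewrite invr_gt0; lra.
move=> i pi; have ai := a0 i pi.
have : `|b i| / a i <= s.
  by rewrite /s (bigD1 i) //= lerDl sumr_ge0 // => j /andP[/a0 aj _]; rewrite divr_ge0 // ltW.
rewrite ler_pdivrMr // => bs; have : `|b i| < (1 + s) * a i by lra.
rewrite mulrC -ltr_pdivrMr; last lra.
move=> H; rewrite mulrC; have : - `|b i| <= b i by rewrite lerNl -normrN ler_norm.
move=> /(ler_wpM2r (_ : 0 <= (1 + s)^-1)) => /(_ _); rewrite mulNr => H2.
have := H2 _; rewrite invr_ge0; move=> /(_ _); lra.
Qed.

(* All but one vertex of an upper set S of G own an edge inside S: the one along which a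
   perturbation of G with a unique maximum on S increases. *)
Lemma upper_set_edges (S : pred 'I_n) (G : 'rV[R]_d) (i0 : 'I_n) : S i0 ->
  (forall i j, S i -> ~~ S j -> dotv G (V j) < dotv G (V i)) ->
  exists r, S r /\ exists f : 'I_n -> 'I_n,
    (forall i, S i -> i != r -> S (f i) /\ is_edge P (segment (V i) (V (f i)))) /\
    (forall i j, S i -> i != r -> S j -> j != r ->
       segment (V i) (V (f i)) = segment (V j) (V (f j)) -> i = j).
Proof.
move=> Si0 up; pose r := [arg max_(k > i0 | S k) dotv G (V k)]%O.
have [Sr rmax] : S r /\ forall k, S k -> dotv G (V k) <= dotv G (V r).
  by rewrite /r; case: arg_maxP => // k Sk km; split.
exists r; split=> //; have [c ce] := Ve r.
have [e e0 eH] : exists2 e, 0 < e & forall p : 'I_n * 'I_n, S p.1 && ~~ S p.2 ->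
    0 < (dotv G (V p.1) - dotv G (V p.2)) + e * (dotv c (V p.1) - dotv c (V p.2)).
  by apply: small_eps => p /andP[S1 S2]; rewrite subr_gt0 up.
pose H := G + e *: c.
have HV k : dotv H (V k) = dotv G (V k) + e * dotv c (V k) by rewrite dotvDl dotvZl.
have Hup i j : S i -> ~~ S j -> dotv H (V j) < dotv H (V i).
  by move=> Si Sj; have := eH (i, j); rewrite /= Si Sj !HV => /(_ isT); lra.
have Hr i : S i -> i != r -> dotv H (V i) < dotv H (V r).
  move=> Si ir; rewrite !HV; apply: ler_ltD; first exact: rmax.
  by rewrite ltr_pM2l // ce.
have step i : exists j, S i -> i != r ->
    dotv H (V i) < dotv H (V j) /\ is_edge P (segment (V i) (V j)).
  have [Si|] := boolP (S i); last by exists i.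
  have [ir|ir] := eqVneq i r; first by exists i.
  by have [j Hj ej] := increasing_edge (Hr i Si ir); exists j.
pose f i := projT1 (cid (step i)).
have fP i : S i -> i != r ->
    dotv H (V i) < dotv H (V (f i)) /\ is_edge P (segment (V i) (V (f i))).
  exact: projT2 (cid (step i)).
exists f; split=> [i Si ir|i j Si ir Sj jr E].
  have [Hf ef] := fP i Si ir; split=> //; apply: contraLR Hf => Sf.
  by rewrite -leNgt ltW // Hup.
have [Hfi _] := fP i Si ir; have [Hfj _] := fP j Sj jr.
have /eqP := segment_min_inj Hfi Hfj E; have [g ge] := Ve i.
apply: contraTeq => ij; apply/eqP => Vij.
by have := ge j; rewrite eq_sym Vij ltxx => /(_ ij).
Qed.

End Irredundant.
End Edges.

(** * Edges crossed by a hyperplane *)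

Section Crossings.
Variable R : realType.

Definition cross d (x a b : 'rV[R]_d) : 'rV[R]_d :=
  (dotv x b - dotv x a)^-1 *: (dotv x b *: a - dotv x a *: b).

Definition crossed d (x a b : 'rV[R]_d) := dotv x a * dotv x b < 0.

Lemma crossed_neq d (x a b : 'rV[R]_d) : crossed x a b -> dotv x b - dotv x a != 0.
Proof.
rewrite /crossed; apply: contraTneq => /eqP; rewrite subr_eq0 => /eqP ->.
by rewrite -leNgt -expr2 sqr_ge0.
Qed.

Lemma crossE d (x a b : 'rV[R]_d) : dotv x b - dotv x a != 0 ->
  cross x a b = (1 - - dotv x a / (dotv x b - dotv x a)) *: a +
                (- dotv x a / (dotv x b - dotv x a)) *: b.
Proof.
move=> D0; apply/rowP => i; rewrite !mxE; field.
by move: D0; rewrite subr_eq0.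
Qed.

Lemma dotv_cross d (x a b : 'rV[R]_d) : dotv x (cross x a b) = 0.
Proof. by rewrite !dotvr; ring. Qed.

Lemma segment_l d (p q : 'rV[R]_d) : segment p q p.
Proof. by exists 0; rewrite lexx ler01 subr0 scale1r scale0r addr0. Qed.

Lemma segment_r d (p q : 'rV[R]_d) : segment p q q.
Proof. by exists 1; rewrite lexx ler01 subrr scale1r scale0r add0r. Qed.

Lemma cross_segment d (x a b : 'rV[R]_d) : crossed x a b -> segment a b (cross x a b).
Proof.
move=> ab; have D0 := crossed_neq ab; rewrite crossE //; eexists; split; last by [].
move: ab D0; rewrite /crossed; move: (dotv x a) (dotv x b) => s t st D0.
have [D|D] := ltP 0 (t - s).
  by rewrite ler_pdivrMr // ler_pdivlMr // mul0r mul1r; nra.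
have {}D : t - s < 0 by rewrite lt_neqAle D0.
by rewrite ler_ndivrMr // ler_ndivlMr // mul0r mul1r; nra.
Qed.

Lemma segment_ge0 d (h p q y : 'rV[R]_d) : segment p q y -> 0 <= dotv h p -> 0 <= dotv h q ->
  0 <= dotv h y.
Proof. by move=> [t [/andP[t0 t1] ->]]; rewrite dotv_segment; nra. Qed.

Lemma segment_lt0 d (h p q y : 'rV[R]_d) : segment p q y -> dotv h p < 0 -> dotv h q < 0 ->
  dotv h y < 0.
Proof. by move=> [t [/andP[t0 t1] ->]]; rewrite dotv_segment; nra. Qed.

(* The zero of x on a segment does not depend on which two of its points bracket it. *)
Lemma cross_subsegment d (x a b p q : 'rV[R]_d) : segment a b p -> segment a b q ->
  0 < dotv x p -> dotv x q < 0 -> crossed x a b /\ cross x a b = cross x p q.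
Proof.
move=> ap aq xp xq; have cab : crossed x a b.
  rewrite /crossed; have [a0|a0] := leP 0 (dotv x a); have [b0|b0] := leP 0 (dotv x b).
  - by have := segment_ge0 aq a0 b0; rewrite leNgt xq.
  - rewrite nmulr_llt0 // lt0r a0 andbT; apply/eqP => a00.
    by have := segment_ge0 (h := - x) ap; rewrite !dotvNl; lra.
  - rewrite pmulr_llt0 // lt0r b0 andbT; apply/eqP => b00.
    by have := segment_ge0 (h := - x) ap; rewrite !dotvNl; lra.
  - by have := segment_lt0 ap a0 b0; lra.
split=> //; have D0 := crossed_neq cab.
move: ap aq xp xq => [s [_ ->]] [t [_ ->]]; rewrite /cross !dotv_segment.
move: (dotv x a) (dotv x b) D0 => u v D0 xp xq.
have st : t - s != 0 by apply/eqP => /eqP; rewrite subr_eq0 => /eqP ts; move: xq; rewrite ts; lra.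
have H : u + t * (v - u) - (u + s * (v - u)) = (t - s) * (v - u) by ring.
apply/rowP => i; rewrite !mxE H; field.
by rewrite D0 st.
Qed.

Section Polytope.
Variables (d n : nat) (V : 'I_n -> 'rV[R]_d).
Hypothesis Ve : forall i, exists g, exposes V g i.
Let P := conv_hull V.
Variables (f1 : nat) (a b : 'I_f1 -> 'rV[R]_d).
Hypothesis edge_ab : forall l, is_edge P (segment (a l) (b l)).
Hypothesis edge_cover : forall F, is_edge P F -> exists l, F = segment (a l) (b l).

Lemma upper_set_labels (S : pred 'I_n) (G : 'rV[R]_d) (i0 : 'I_n) : S i0 ->
  (forall i j, S i -> ~~ S j -> dotv G (V j) < dotv G (V i)) ->
  exists E : {set 'I_f1}, (#|S| <= #|E|.+1)%N /\
    forall l, l \in E -> exists i j, [/\ S i, S j & segment (a l) (b l) = segment (V i) (V j)].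
Proof.
move=> Si0 up; have [r [Sr [f [fS finj]]]] := upper_set_edges Ve Si0 up.
have [[i1 /andP[Si1 i1r]]|nS] := pselect (exists i, S i && (i != r)); last first.
  exists finset.set0; split=> [|l]; last by rewrite inE.
  rewrite cards0 -(card1 r) subset_leq_card //; apply/fintype.subsetP => i Si.
  by apply: contrapT => /negP ir; apply: nS; exists i; apply/andP; split.
(* [l1] is a default label that makes [lab] total. *)
have [l1 _] := edge_cover (fS i1 Si1 i1r).2.
have step i : exists l, S i -> i != r -> segment (V i) (V (f i)) = segment (a l) (b l).
  have [/andP[Si ir]|nH] := boolP (S i && (i != r)).
    by have [_ /edge_cover [l El]] := fS i Si ir; exists l.
  by exists l1 => Si ir; move: nH; rewrite Si ir.
pose lab i := projT1 (cid (step i)).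
have labP i : S i -> i != r -> segment (V i) (V (f i)) = segment (a (lab i)) (b (lab i)).
  exact: projT2 (cid (step i)).
exists (lab @: [set i | S i & i != r]%SET); split=> [|l /imsetP [i]]; last first.
  rewrite inE => /andP[Si ir] ->; have [Sf _] := fS i Si ir.
  by exists i, (f i); split=> //; rewrite labP.
rewrite card_in_imset => [|i j]; last first.
  rewrite !inE => /andP[Si ir] /andP[Sj jr] E; apply: finj => //.
  by rewrite !labP // E.
have rS : r \in S := Sr.
rewrite (cardD1 r S) rS add1n ltnS subset_leq_card //.
by apply/fintype.subsetP => i; rewrite !inE andbC.
Qed.

(** The crossed edge [l0] forces vertices on both sides. The uncrossed edges [E1] and [E2] found on
    the two sides are disjoint from each other and from the crossed ones, and number at least n - 2
    together, one vertex being lost per side. *)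
Lemma crossed_count (x : 'rV[R]_d) l0 : crossed x (a l0) (b l0) ->
  (#|[set l | crossed x (a l) (b l)]%SET| + n <= f1.+2)%N.
Proof.
move=> cl0; pose S i := 0 <= dotv x (V i).
have inP l y : segment (a l) (b l) y -> P y by have [[c ->] _] := edge_ab l => -[].
have aP l : P (a l) by apply: inP; apply: segment_l.
have bP l : P (b l) by apply: inP; apply: segment_r.
have [i0 Si0] : exists i, S i.
  apply: contrapT => nS.
  have neg i : dotv x (V i) < 0 by rewrite ltNge; apply/negP => Si; apply: nS; exists i.
  have [M VM M0] : exists2 M, (forall i, dotv x (V i) <= M) & M < 0.
    exists (\big[Num.max/-1]_i dotv x (V i)).
      by move=> i; rewrite (bigD1 i) //= le_max lexx.
    elim/big_ind: _ => //.
    by move=> u v; rewrite gt_max => -> ->.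
  have := conv_hull_le (aP l0) VM; have := conv_hull_le (bP l0) VM.
  by move: cl0; rewrite /crossed; nra.
have [j0 Sj0] : exists i, ~~ S i.
  apply: contrapT => nS.
  have pos y : P y -> 0 <= dotv x y.
    move=> Py; have := conv_hull_le (g := - x) (M := 0) Py; rewrite dotvNl oppr_le0; apply.
    move=> i; rewrite dotvNl oppr_le0; apply: contrapT => /negP Si; apply: nS.
    by exists i.
  by have := pos _ (aP l0); have := pos _ (bP l0); move: cl0; rewrite /crossed; nra.
have [|E1 [E1c E1P]] := upper_set_labels (G := x) Si0.
  by move=> i j Si; rewrite /S -ltNge => /lt_le_trans; apply.
have [|E2 [E2c E2P]] := upper_set_labels (S := predC S) (G := - x) Sj0.
  move=> i j /=; rewrite negbK /S -ltNge => xi xj.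
  by rewrite !dotvNl ltrN2 (lt_le_trans xi).
have [E1ge E2lt] : (forall l, l \in E1 -> 0 <= dotv x (a l) /\ 0 <= dotv x (b l)) /\
    (forall l, l \in E2 -> dotv x (a l) < 0 /\ dotv x (b l) < 0).
  split=> l.
    move=> /E1P [i [j [Si Sj E]]].
    by split; apply: (segment_ge0 (p := V i) (q := V j)) => //; rewrite -E;
      [exact: segment_l|exact: segment_r].
  move=> /E2P [i [j []]] /=; rewrite /S -!ltNge => Si Sj E.
  by split; apply: (segment_lt0 (p := V i) (q := V j)) => //; rewrite -E;
    [exact: segment_l|exact: segment_r].
pose C := [set l | crossed x (a l) (b l)]%SET.
have E12 : E1 :&: E2 = finset.set0.
  apply/setP => l; rewrite !inE; apply/negP => /andP[/E1ge [+ _] /E2lt [+ _]].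
  by move=> ?; rewrite ltNge => /negP.
have CE : C :&: (E1 :|: E2) = finset.set0.
  apply/setP => l; rewrite !inE; apply/negP => /andP[]; rewrite /crossed => c /orP[/E1ge|/E2lt] [].
    by nra.
  by nra.
have : (#|C :|: (E1 :|: E2)| <= f1)%N by have := max_card (mem (C :|: (E1 :|: E2))); rewrite card_ord.
rewrite cardsU CE cards0 subn0 cardsU E12 cards0 subn0.
have := leq_add E1c E2c; rewrite cardC card_ord -/C.
by move: #|C| #|E1| #|E2| => u v w; lia.
Qed.

(** The set of all vertices is an upper set of the zero functional, so all vertices but one own an
    edge. *)
Lemma edge_count : (n <= f1.+1)%N.
Proof.
case: (posnP n) => [->//|n0].
have [|E [Ec _]] := @upper_set_labels predT 0 (Ordinal n0) isT; first by [].
by move: Ec; rewrite cardT size_enum_ord => /leq_trans; apply; rewrite ltnS; have := max_card (mem E); rewrite card_ord.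
Qed.

(** Dual form of the statement that crossings, together with 0 when it lies in P, generate the
    section: a bound for g on the generators extends to the section. [gen] says that 0 is the only
    vertex allowed in x^perp. *)
Lemma section_functional_le (x g : 'rV[R]_d) M y :
  (forall i, dotv x (V i) = 0 -> V i = 0) ->
  (forall l, crossed x (a l) (b l) -> dotv g (cross x (a l) (b l)) <= M) ->
  (P 0 -> 0 <= M) -> P y -> dotv x y = 0 -> dotv g y <= M.
Proof.
move=> gen gM M0 Py xy.
have zeroV i : dotv x (V i) = 0 -> dotv g (V i) <= M.
  move=> xi; have Vi := gen i xi; rewrite Vi dotv0r; apply: M0; rewrite -Vi.
  exact: conv_hull_gen.
(* if no vertex is strictly on one side, y is supported on vertices in x^perp *)
have onesided (h : 'rV[R]_d) : (h = x \/ h = - x) -> (forall i, dotv h (V i) <= 0) -> dotv g y <= M.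
  move=> hx hle; have hy : dotv h y = 0 by case: hx => ->; rewrite ?dotvNl xy ?oppr0.
  have [l [l0 [l1 yE]]] := Py.
  have /psumr_eq0P H : forall i : 'I_n, true -> 0 <= - (l i * dotv h (V i)).
    by move=> i _; rewrite oppr_ge0 mulr_ge0_le0.
  have {}H : forall i, l i * dotv h (V i) = 0.
    move=> i; apply/eqP; rewrite -oppr_eq0; apply/eqP/H => //.
    rewrite sumrN; under eq_bigr do rewrite -dotvZr.
    by rewrite -dotv_sumr -yE hy oppr0.
  rewrite yE dotv_sumr -[M]mul1r -l1 mulr_suml; apply: ler_sum => i _; rewrite dotvZr.
  have /eqP := H i; rewrite mulf_eq0 => /orP[/eqP ->|/eqP hi]; first by rewrite !mul0r.
  rewrite ler_wpM2l // zeroV //; case: hx hi => ->; rewrite ?dotvNl //.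
  by move/eqP; rewrite oppr_eq0 => /eqP.
have [[i0 xi0]|nS] := pselect (exists i, 0 < dotv x (V i)); last first.
  apply: (onesided x); first by left.
  by move=> i; rewrite leNgt; apply/negP => xi; apply: nS; exists i.
(* Adding a multiple of x does not change g on x^perp. The least ratio [la] is the largest multiple
   keeping the functional at most M at all vertices with x positive, and it gives equality at
   [i1]. *)
pose la i := (M - dotv g (V i)) / dotv x (V i).
pose i1 := [arg min_(k < i0 | 0 < dotv x (V k)) la k]%O.
have [xi1 i1min] : 0 < dotv x (V i1) /\ forall k, 0 < dotv x (V k) -> la i1 <= la k.
  by rewrite /i1; case: arg_minP => // k xk km; split.
pose G := g + la i1 *: x.
have GV k : dotv G (V k) = dotv g (V k) + la i1 * dotv x (V k) by rewrite dotvDl dotvZl.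
have Gi1 : dotv G (V i1) = M by rewrite GV /la mulfVK ?gt_eqF // addrC subrK.
suff Gle k : dotv G (V k) <= M.
  by have := conv_hull_le Py Gle; rewrite dotvDl dotvZl xy mulr0 addr0.
have Gnneg k' : 0 <= dotv x (V k') -> dotv G (V k') <= M.
  rewrite le_eqVlt => /orP[/eqP xk|xk].
    by rewrite GV -xk mulr0 addr0 zeroV.
  have := i1min _ xk; rewrite {2}/la ler_pdivlMr // GV; lra.
rewrite leNgt; apply/negP => Gk.
(* If G exceeded M at some vertex, an edge from [i1] would increase G. It must end where x is
   negative, so its crossing would have value above M. *)
have [|j Gj ej] := increasing_edge Ve (i := i1) (G := G) (j0 := k); first by rewrite Gi1.
have xj : dotv x (V j) < 0.
  by rewrite ltNge; apply/negP => /Gnneg; rewrite leNgt -Gi1 Gj.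
have [l El] := edge_cover ej.
have [] := @cross_subsegment d x (a l) (b l) (V i1) (V j) _ _ xi1 xj; rewrite -?El.
- exact: segment_l.
- exact: segment_r.
move=> cl cE; have := gM l cl.
have D0 : dotv x (V j) - dotv x (V i1) != 0 by rewrite lt_eqF //; lra.
have -> : dotv g (cross x (a l) (b l)) = dotv G (cross x (V i1) (V j)).
  by rewrite cE dotvDl dotvZl dotv_cross mulr0 addr0.
rewrite crossE // dotv_segment Gi1; apply/negP; rewrite -ltNge ltrDl mulr_gt0 //; last first.
  by rewrite subr_gt0 -Gi1.
by rewrite ltr_ndivlMr ?mul0r; lra.
Qed.

End Polytope.
End Crossings.

(** * Regular triangulations *)

Section Triangulation.
Variable R : realType.
Variables (k m : nat).
Local Notation K := k.+1.
Local Notation I := 'I_m.+1.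
Implicit Types (w : I -> 'rV[R]_k) (s t : {set I}) (om l : I -> R) (u : 'rV[R]_k).

Definition hom u : 'rV[R]_K := rcons0 1 u.

Definition elt s (i : 'I_K) : I := nth ord0 (enum s) i.

Lemma elt_in s i : #|s| = K -> elt s i \in s.
Proof. by move=> sK; rewrite -mem_enum mem_nth // -cardE sK. Qed.

Lemma elt_inj s : #|s| = K -> injective (elt s).
Proof.
move=> sK i j /eqP; rewrite nth_uniq ?enum_uniq -?cardE ?sK // => /eqP E.
exact: val_inj.
Qed.

Lemma elt_surj s i : #|s| = K -> i \in s -> exists j, i = elt s j.
Proof.
move=> sK si; have := si; rewrite -mem_enum -index_mem -cardE sK => Hi.
by exists (Ordinal Hi); rewrite /elt /= nth_index // mem_enum.
Qed.

Lemma big_elt (T : Type) (idx : T) (op : Monoid.com_law idx) s (F : I -> T) : #|s| = K ->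
  \big[op/idx]_(i in s) F i = \big[op/idx]_i F (elt s i).
Proof.
move=> sK; rewrite -big_enum /= (big_nth ord0) -cardE sK big_mkord.
by [].
Qed.

Definition simplex_mx w s : 'M[R]_K := \matrix_i hom (w (elt s i)).

Lemma mul_simplex_mx w s (c : 'rV[R]_K) :
  c *m simplex_mx w s = \sum_i c 0 i *: hom (w (elt s i)).
Proof.
rewrite mulmx_sum_row; apply: eq_bigr => i _; congr (_ *: _).
by rewrite rowK.
Qed.

Definition simplex (M : 'M[R]_K) := [set u | forall i, 0 <= (hom u *m invmx M) 0 i].

Definition rep w u l := (forall i, 0 <= l i) /\ \sum_i l i *: hom (w i) = hom u.
Definition supp l : {set I} := [set i | 0 < l i]%SET.

Lemma rep_conv_hull w u : conv_hull w u <-> exists l, rep w u l.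
Proof.
have E l : \sum_i l i *: hom (w i) = rcons0 (\sum_i l i) (\sum_i l i *: w i).
  by rewrite -rcons0_sum; apply: eq_bigr => i _; rewrite rcons0Z mulr1.
split=> [[l [l0 [l1 uE]]]|[l [l0]]].
  by exists l; split; rewrite // E l1 -uE.
by rewrite E => /rcons0_inj [l1 uE]; exists l.
Qed.

Lemma rep0 w u l i : rep w u l -> i \notin supp l -> l i = 0.
Proof. by move=> [l0 _]; rewrite inE lt0r l0 andbT negbK => /eqP. Qed.

Lemma rep_sum w u l (W : lmodType R) (F : I -> W) s : rep w u l -> supp l \subset s ->
  \sum_i l i *: F i = \sum_(i in s) l i *: F i.
Proof.
move=> lr ls; rewrite [RHS]big_mkcond; apply: eq_bigr => i _; case: ifPn => // si.
rewrite (rep0 lr) ?scale0r //; apply: contra si; exact: (fintype.subsetP ls).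
Qed.

Lemma simplexP w s u : #|s| = K -> simplex_mx w s \in unitmx ->
  simplex (simplex_mx w s) u <-> exists2 l, rep w u l & supp l \subset s.
Proof.
move=> sK uM; split=> [H|[l lr ls] i]; last first.
  have [l0 lu] := lr.
  have : (\row_j l (elt s j)) *m simplex_mx w s = hom u.
    rewrite mul_simplex_mx -lu (rep_sum (fun i => hom (w i)) lr ls) big_elt //.
    by apply: eq_bigr => j _; rewrite mxE.
  by move=> <-; rewrite mulmxK // mxE.
pose c := hom u *m invmx (simplex_mx w s).
exists (fun i => \sum_(j | elt s j == i) c 0 j); first split.
- by move=> i; apply: sumr_ge0 => j _; apply: H.
- rewrite -[RHS](mulmxKV uM) mul_simplex_mx.
  under eq_bigr do rewrite scaler_suml.
  rewrite (exchange_big_dep xpredT) //=; apply: eq_bigr => j _.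
  by rewrite (big_pred1 (elt s j)) // => i; rewrite /= eq_sym.
apply/fintype.subsetP => i; rewrite inE; apply: contraTT => si.
rewrite -leNgt big1 // => j /eqP ji; case/negP: si; rewrite -ji; exact: elt_in.
Qed.

Definition heights s om : 'cV[R]_K := \col_i om (elt s i).

(* Coefficients of the affine function interpolating om on the vertices in s. *)
Definition interp w s om : 'cV[R]_K :=
  (\det (simplex_mx w s))^-1 *: \adj (simplex_mx w s) *m heights s om.

Definition interp_at w s om j : R := (hom (w j) *m interp w s om) 0 0.

Lemma interpE w s om : simplex_mx w s \in unitmx ->
  interp w s om = invmx (simplex_mx w s) *m heights s om.
Proof. by move=> uM; rewrite /interp /invmx uM. Qed.

Lemma interp_vertex w s om i : #|s| = K -> simplex_mx w s \in unitmx -> i \in s ->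
  interp_at w s om i = om i.
Proof.
move=> sK uM si; have [j ->] := elt_surj sK si.
have := mulKVmx uM (heights s om); rewrite -interpE // => /matrixP /(_ j 0).
rewrite [RHS]mxE => <-; rewrite /interp_at.
have -> : hom (w (elt s j)) = row j (simplex_mx w s) by rewrite rowK.
by rewrite -row_mul mxE.
Qed.

Lemma rep_interp w s om u l : rep w u l ->
  (hom u *m interp w s om) 0 0 = \sum_i l i * interp_at w s om i.
Proof.
move=> [_ <-]; rewrite mulmx_suml summxE; apply: eq_bigr => i _.
by rewrite -scalemxAl mxE.
Qed.

(** The lifted points (w j, om j) with j in s span a lower facet of their hull: the affine
    interpolant on s passes strictly below every other lifted point. These s form a regular
    triangulation. *)
Definition lower w om s : bool :=
  [&& #|s| == K, simplex_mx w s \in unitmx &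
      [forall j, (j \notin s) ==> (interp_at w s om j < om j)]].

Definition generic_heights w om := forall s, #|s| = K -> simplex_mx w s \in unitmx ->
  forall j, j \notin s -> interp_at w s om j != om j.

(** That is, u lies in no hull of fewer than k + 1 of the points. *)
Definition generic_point w u := forall l, rep w u l -> (K <= #|supp l|)%N.

(** At a point u of the simplex s the interpolant of s averages the heights of s, and the
    interpolant of t lies below them, strictly at a vertex outside t. Exchanging s and t gives two
    contradictory inequalities. *)
Lemma lower_unique w om u s t : generic_point w u -> lower w om s -> lower w om t ->
  simplex (simplex_mx w s) u -> simplex (simplex_mx w t) u -> s = t.
Proof.
move=> gu.
have key s' t' : lower w om s' -> lower w om t' -> simplex (simplex_mx w s') u -> ~~ (s' \subset t') ->
    (hom u *m interp w t' om) 0 0 < (hom u *m interp w s' om) 0 0.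
  move=> /and3P[/eqP sK us _] /and3P[/eqP tK ut /forallP tlow].
  move=> /(simplexP _ sK us) [l lr ls] /subsetPn [i si ti].
  have lsupp : supp l = s'.
    by apply/eqP; rewrite eqEcard ls sK gu.
  rewrite !(rep_interp _ _ lr) (bigD1 i) //= [ltRHS](bigD1 i) //=; apply: ltr_leD.
    have li : 0 < l i by move: si; rewrite -lsupp inE.
    rewrite ltr_pM2l // (interp_vertex _ sK us si).
    by have := tlow i; rewrite ti.
  apply: ler_sum => j _; have [sj|sj] := boolP (j \in s'); last first.
    by rewrite (rep0 lr) ?mul0r // lsupp.
  rewrite ler_wpM2l ?(lr.1) // (interp_vertex _ sK us sj).
  have [tj|tj] := boolP (j \in t'); first by rewrite (interp_vertex _ tK ut tj).
  by have := tlow j; rewrite tj => /ltW.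
move=> ls lt us ut; have [st|st] := boolP (s \subset t).
  apply/eqP; rewrite eqEcard st; move: ls lt => /and3P[/eqP -> _ _] /and3P[/eqP -> _ _].
  by rewrite /= leqnn.
have [ts|ts] := boolP (t \subset s).
  apply/esym/eqP; rewrite eqEcard ts; move: ls lt => /and3P[/eqP -> _ _] /and3P[/eqP -> _ _].
  by rewrite /= leqnn.
by have := lt_trans (key _ _ ls lt us st) (key _ _ lt ls ut ts); rewrite ltxx.
Qed.

Lemma hom_sum0 w (nu : I -> R) : \sum_i nu i *: hom (w i) = 0 -> \sum_i nu i = 0.
Proof.
move=> H; have := congr1 (fun v : 'rV_K => v 0 ord0) H; rewrite mxE summxE => E.
by rewrite -[RHS]E; apply: eq_bigr => i _; rewrite mxE rcons0E unlift_none mulr1.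
Qed.

Lemma sum0_pos (nu : I -> R) i : \sum_i nu i = 0 -> nu i != 0 -> exists j, 0 < nu j.
Proof.
move=> s0 ni; apply: contrapT => nP.
have le0 j : nu j <= 0 by rewrite leNgt; apply/negP => H; apply: nP; exists j.
have /psumr_eq0P H : forall j : I, true -> 0 <= - nu j by move=> j _; rewrite oppr_ge0.
by move: ni; rewrite -oppr_eq0 H ?eqxx // sumrN s0 oppr0.
Qed.

(* The ratio test of the simplex method. *)
Lemma rep_shift w u l (nu : I -> R) : rep w u l -> \sum_i nu i *: hom (w i) = 0 ->
  (forall i, 0 < nu i -> 0 < l i) -> (exists i, 0 < nu i) ->
  exists e i, [/\ 0 < e, 0 < nu i, l i - e * nu i = 0 & rep w u (fun j => l j - e * nu j)].
Proof.
move=> [l0 lu] nu0 nul [i0 ni0].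
pose i := [arg min_(j < i0 | 0 < nu j) (l j / nu j)]%O.
have [ni imin] : 0 < nu i /\ forall j, 0 < nu j -> l i / nu i <= l j / nu j.
  by rewrite /i; case: arg_minP => // j nj jm; split.
exists (l i / nu i), i; split=> //; first by rewrite divr_gt0 // nul.
  by rewrite divfK ?subrr // gt_eqF.
split=> [j|]; last first.
  under eq_bigr do rewrite scalerBl -scalerA.
  by rewrite sumrB -scaler_sumr nu0 scaler0 subr0.
have e0 : 0 <= l i / nu i by rewrite divr_ge0 // ltW.
rewrite subr_ge0; have [nj|nj] := ltP 0 (nu j); first by rewrite -ler_pdivlMr // imin.
by apply: le_trans (l0 j); rewrite mulr_ge0_le0.
Qed.

Lemma linear_dependence N (f : 'I_N -> I) (H : I -> 'rV[R]_K) : injective f ->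
  ~~ row_free (\matrix_i H (f i)) ->
  exists nu : I -> R, [/\ \sum_i nu i *: H i = 0, exists i, nu i != 0 &
    forall i, nu i != 0 -> exists j, i = f j].
Proof.
move=> fI; rewrite -kermx_eq0 => /rowV0Pn [v /sub_kermxP vA v0].
exists (fun i => \sum_(j | f j == i) v 0 j); split.
- under eq_bigr do rewrite scaler_suml.
  rewrite (exchange_big_dep xpredT) //= -[RHS]vA mulmx_sum_row; apply: eq_bigr => j _.
  by rewrite (big_pred1 (f j)) ?rowK // => i; rewrite /= eq_sym.
- have [j vj] : exists j, v 0 j != 0.
    apply: contrapT => nv; case/eqP: v0; apply/rowP => j; rewrite mxE; apply/eqP.
    by apply: contrapT => /negP vj; apply: nv; exists j.
  by exists (f j); rewrite (big_pred1 j) // => j'; rewrite /= (inj_eq fI).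
move=> i; apply: contra_neqP => nf; apply: big1 => j /eqP ji.
by case: nf; exists j.
Qed.

(** The step behind Caratheodory's theorem: an affine dependence has coefficient sum 0, hence a
    positive entry, and subtracting it until the first coefficient dies shrinks the support. *)
Lemma rep_support_dec w u l N (f : 'I_N -> I) : rep w u l -> injective f ->
  (forall i, i \in supp l <-> exists j, i = f j) -> ~~ row_free (\matrix_i hom (w (f i))) ->
  exists2 l', rep w u l' & (#|supp l'| < #|supp l|)%N.
Proof.
move=> lr fI fs nf.
have [nu [nu0 [i0 ni0] nuf]] := linear_dependence (H := fun i => hom (w i)) fI nf.
have ex := sum0_pos (hom_sum0 nu0) ni0.
have nul i : 0 < nu i -> 0 < l i.
  by move=> ni; have /fs := nuf i (lt0r_neq0 ni); rewrite inE.
have [e [i [e0 ni li0 lr']]] := rep_shift lr nu0 nul ex.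
eexists; first exact: lr'.
apply: proper_card; apply/properP; split; last first.
  by exists i; rewrite inE ?li0 ?ltxx // nul.
apply/fintype.subsetP => j; rewrite inE; apply: contraLR => lj.
have := rep0 lr lj; rewrite -leNgt => ->; rewrite sub0r oppr_le0 mulr_ge0 ?(ltW e0) //.
have [->//|nj] := eqVneq (nu j) 0.
by case/negP: lj; apply/fs/nuf.
Qed.

Lemma rep_min_support w u l : rep w u l ->
  exists2 l', rep w u l' & forall l'', rep w u l'' -> (#|supp l'| <= #|supp l''|)%N.
Proof.
move=> lr.
have ex : exists n, `[< exists2 l', rep w u l' & #|supp l'| = n >].
  by exists #|supp l|; apply/asboolP; exists l.
have := ex_minnP ex => -[n /asboolP [l' lr' <-] nmin].
by exists l' => // l'' lr''; apply: nmin; apply/asboolP; exists l''.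
Qed.

Definition support_mx w s : 'M[R]_(#|s|, K) := \matrix_i hom (w (enum_val i)).

Lemma enum_valE s i : i \in s <-> exists j : 'I_#|s|, i = enum_val j.
Proof.
split=> [si|[j ->]]; last exact: enum_valP.
by exists (enum_rank_in si i); rewrite enum_rankK_in.
Qed.

Lemma caratheodory w u l : rep w u l ->
  exists2 l', rep w u l' & row_free (support_mx w (supp l')).
Proof.
move=> /rep_min_support [l' lr' lmin]; exists l' => //.
apply: contrapT => /negP nf.
have [l'' lr''] := rep_support_dec lr' (@enum_val_inj _ _) (@enum_valE (supp l')) nf.
by rewrite ltnNge lmin.
Qed.

(** Linear programming: among the supports of size k + 1 representing u, one of least interpolated
    height is lower, since a lifted point below its interpolant would allow an improving pivot. *)
Lemma lower_exists w om u : generic_heights w om -> generic_point w u -> conv_hull w u ->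
  exists2 s, lower w om s & simplex (simplex_mx w s) u.
Proof.
move=> gom gu /rep_conv_hull [l0 lr0].
have elt_supp s : #|s| = K -> forall i, i \in s <-> exists j, i = elt s j.
  by move=> sK i; split=> [/(elt_surj sK)//|[j ->]]; apply: elt_in.
have unit_supp l : rep w u l -> #|supp l| = K -> simplex_mx w (supp l) \in unitmx.
  move=> lr lK; rewrite -row_free_unit; apply: contrapT => /negP nf.
  have [l' lr'] := rep_support_dec lr (elt_inj lK) (elt_supp _ lK) nf.
  by rewrite lK ltnNge gu.
have [l1 lr1 lK1] : exists2 l, rep w u l & #|supp l| = K.
  have [l lr /eqP lf] := caratheodory lr0; exists l => //.
  by apply/eqP; rewrite eqn_leq gu // andbT -lf rank_leq_col.
pose basic s := `[< exists2 l, rep w u l & (supp l = s) /\ #|s| = K >].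
pose cost s := (hom u *m interp w s om) 0 0.
have b1 : basic (supp l1) by apply/asboolP; exists l1.
pose s := [arg min_(t < supp l1 | basic t) cost t]%O.
have [/asboolP [l lr [ls sK]] smin] : basic s /\ forall t, basic t -> cost s <= cost t.
  by rewrite /s; case: arg_minP => // t bt tm; split.
have uM : simplex_mx w s \in unitmx by rewrite -ls unit_supp // ls.
exists s; last by apply/simplexP => //; exists l; rewrite ?ls.
apply/and3P; split=> //; first by rewrite sK.
apply/forallP => j; apply/implyP => sj; rewrite ltNge le_eqVlt eq_sym (negbTE (gom s sK uM j sj)) /=.
apply/negP => bad.
(* [mu] gives the affine coordinates of w j in the simplex s. Moving along minus [nu], that is mu
   minus the unit at j, brings j into the support. *)
pose c := hom (w j) *m invmx (simplex_mx w s).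
pose mu i := \sum_(p | elt s p == i) c 0 p.
have mu0 i : i \notin s -> mu i = 0.
  by move=> si; apply: big1 => p /eqP pi; case/negP: si; rewrite -pi; apply: elt_in.
have muE : \sum_i mu i *: hom (w i) = hom (w j).
  rewrite -[RHS](mulmxKV uM) mul_simplex_mx; under eq_bigr do rewrite scaler_suml.
  rewrite (exchange_big_dep xpredT) //=; apply: eq_bigr => p _.
  by rewrite (big_pred1 (elt s p)) // => i; rewrite /= eq_sym.
pose nu i := mu i - (i == j)%:R.
have sum_nu (W : lmodType R) (F : I -> W) : \sum_i nu i *: F i = \sum_i mu i *: F i - F j.
  under eq_bigr do rewrite scalerBl.
  rewrite sumrB; congr (_ - _); rewrite (bigD1 j) //= eqxx scale1r big1 ?addr0 // => i /negbTE ->.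
  by rewrite scale0r.
have nu0 : \sum_i nu i *: hom (w i) = 0 by rewrite sum_nu muE subrr.
have nuj : nu j = -1 by rewrite /nu mu0 // eqxx sub0r.
have ex : exists i, 0 < nu i by apply: (sum0_pos (i := j)); [exact: hom_sum0 nu0|rewrite nuj oppr_eq0 oner_eq0].
have nus i : 0 < nu i -> i \in s.
  move=> ni; apply: contrapT => /negP si; move: ni; rewrite /nu mu0 // sub0r.
  by rewrite ltNge oppr_le0 ler0n.
have nul i : 0 < nu i -> 0 < l i by move=> /nus; rewrite -ls inE.
have [e [i [e0 ni li0 lr']]] := rep_shift lr nu0 nul ex.
set l' := fun _ => _ in lr' li0.
have lcost lx : rep w u lx -> #|supp lx| = K -> cost (supp lx) = \sum_i lx i * om i.
  move=> lxr lxK; rewrite /cost (rep_interp _ _ lxr); apply: eq_bigr => p _.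
  have [ps|ps] := boolP (p \in supp lx); last by rewrite (rep0 lxr ps) !mul0r.
  by rewrite interp_vertex // unit_supp.
(* The pivot exchanges i for j, so at most k + 1 indices remain; genericity of u excludes fewer. *)
have l'K : #|supp l'| = K.
  apply/eqP; rewrite eqn_leq gu // andbT.
  have sub : supp l' \subset (j |: (s :\ i)).
    apply/fintype.subsetP => p; rewrite !inE; apply: contraLR; rewrite negb_or negb_and negbK -ls.
    move=> /andP[pj /orP[/eqP ->|pl]]; first by rewrite -leNgt (_ : l' i = 0).
    by rewrite -leNgt /l' (rep0 lr pl) /nu mu0 -?ls // (negbTE pj) subr0 mulr0 subr0.
  apply: leq_trans (subset_leq_card sub) _.
  rewrite cardsU1 !inE (negbTE sj) andbF /= (cardsD1 i s) (nus i ni) in sK *.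
  by rewrite sK.
have := smin (supp l'); rewrite leNgt => /(_ _)/negP; apply.
  by apply/asboolP; exists l'.
rewrite -ls !lcost ?ls //.
have -> : \sum_p l' p * om p = \sum_p l p * om p - e * (\sum_p nu p * om p).
  by rewrite mulr_sumr -sumrB; apply: eq_bigr => p _; rewrite /l'; ring.
rewrite gtrBl mulr_gt0 //.
have := sum_nu R^o om; rewrite /GRing.scale /= => ->.
rewrite subr_gt0; move: bad; congr (_ < _).
rewrite /interp_at -muE mulmx_suml summxE; apply: eq_bigr => p _.
rewrite -scalemxAl mxE; have [ps|ps] := boolP (p \in s); last by rewrite mu0 // !mul0r.
by congr (_ * _); apply: interp_vertex.
Qed.

End Triangulation.

(** * Volume of convex hulls *)

Section SimplexVolume.
Variable R : realType.
Variable k : nat.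
Local Notation K := k.+1.
Implicit Types u : 'rV[R]_k.

Lemma hom_mul_col u (c : 'cV[R]_K) :
  (hom u *m c) 0 0 = c 0 0 + (u *m (\col_i c (lift ord0 i) 0)) 0 0.
Proof.
rewrite !mxE big_ord_recl; congr (_ + _).
  by rewrite rcons0E unlift_none mul1r.
by apply: eq_bigr => i _; rewrite rcons0E liftK mxE.
Qed.

Lemma hom_mul_mx u n (B : 'M[R]_(K, n)) i : (hom u *m B) 0 i = (hom u *m col i B) 0 0.
Proof. by rewrite colE mulmxA -colE [RHS]mxE. Qed.

Lemma semilin_hom_ge0 (c : 'cV[R]_K) : semilin [set u | 0 <= (hom u *m c) 0 0].
Proof.
under eq_set do rewrite hom_mul_col.
exact: semilin_half.
Qed.

Lemma semilin_hom_eq0 (c : 'cV[R]_K) : semilin [set u | (hom u *m c) 0 0 = 0].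
Proof.
rewrite (_ : mkset _ = [set u | 0 <= (hom u *m c) 0 0] `&` [set u | 0 <= (hom u *m - c) 0 0]).
  by apply: semilinI; apply: semilin_hom_ge0.
have E u : (hom u *m - c) 0 0 = - (hom u *m c) 0 0 by rewrite mulmxN mxE.
apply/seteqP; split=> u /=; rewrite E oppr_ge0.
  by move=> ->; split.
by move=> [h1 h2]; apply/eqP; rewrite eq_le h1 h2.
Qed.

Lemma semilin_simplex (M : 'M[R]_K) : semilin (simplex M).
Proof.
rewrite (_ : simplex M = [set u | forall i, xpredT i ->
    [set u | 0 <= (hom u *m col i (invmx M)) 0 0] u]).
  by apply: semilin_bigcap => i _; apply: semilin_hom_ge0.
by apply/seteqP; split=> u /= H i => [_|]; have := H i; rewrite -hom_mul_mx //; apply.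
Qed.

Lemma hom_row u : hom u = row_mx (1%:M : 'M[R]_1) u :> 'rV[R]_(1 + k).
Proof.
rewrite /hom /rcons0; congr (@row_mx _ 1 1 k _ _).
by apply/matrixP => i j; rewrite !mxE !ord1.
Qed.

Definition ref_mx : 'M[R]_K := block_mx 1%:M 0 (const_mx 1) 1%:M : 'M[R]_(1 + k).

Lemma det_ref_mx : \det ref_mx = 1.
Proof. by rewrite /ref_mx (@det_lblock _ 1 k) !det1 mulr1. Qed.

Lemma ref_mx_unit : ref_mx \in unitmx.
Proof. by rewrite unitmxE det_ref_mx unitr1. Qed.

(** The volume 1/k! of the standard simplex, carried as a symbolic constant. *)
Definition simplex_const : R := fine (lebn (simplex ref_mx)).

Lemma simplex_const_fin : lebn (simplex ref_mx) = simplex_const%:E.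
Proof.
rewrite /simplex_const fineK // ge0_fin_numE ?lebn_ge0 //.
apply: (@le_lt_trans _ _ 1%E); last by rewrite ltry.
rewrite -(lebn_unit_cube R k); apply: lebn_le.
- exact: semilin_simplex.
- exact: semilin_unit_cube.
move=> u su; pose c : 'rV[R]_(1 + k) := hom u *m invmx ref_mx.
have : c *m ref_mx = hom u by rewrite mulmxKV // ref_mx_unit.
rewrite hom_row -[c]hsubmxK (@mul_row_block _ 1 1 k 1 k) !mulmx0 !mulmx1 add0r.
move=> /(@eq_row_mx _ 1 1 k) [c1 c2].
have c0 i : 0 <= rsubmx c 0 i by rewrite mxE; apply: su.
have c10 : 0 <= c 0 (lshift k 0) by apply: su.
have cs : c 0 (lshift k 0) + \sum_j rsubmx c 0 j = 1.
  have := congr1 (fun M : 'M[R]_1 => M 0 0) c1; rewrite !mxE eqxx mulr1n => <-.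
  by congr (_ + _); apply: eq_bigr => j _; rewrite [X in _ = _ * X]mxE mulr1.
move=> i /=; rewrite -c2 c0 /=; move: cs; rewrite (bigD1 i) //=.
have : 0 <= \sum_(j | j != i) rsubmx c 0 j by apply: sumr_ge0 => j _; apply: c0.
by move: c10; lra.
Qed.

Lemma lebn_simplex (M : 'M[R]_K) : M \in unitmx -> (forall i, M i 0 = 1) ->
  lebn (simplex M) = (simplex_const * `|\det M|)%:E.
Proof.
(* Both [ref_mx] and M have first column 1, so X has first column (1, 0) and encodes the affine map
   u |-> u D + b carrying the reference simplex onto that of M. *)
move=> uM M1; pose X : 'M[R]_(1 + k) := invmx ref_mx *m M.
have MX : M = ref_mx *m X by rewrite mulKVmx // ref_mx_unit.
have X0 : lsubmx X = col_mx 1%:M 0.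
  have -> : lsubmx X = invmx ref_mx *m lsubmx (M : 'M[R]_(1 + k)) by rewrite mulmx_lsub.
  have -> : lsubmx (M : 'M[R]_(1 + k)) = ref_mx *m (col_mx 1%:M 0 : 'M[R]_(1 + k, 1)).
    rewrite /ref_mx (@mul_block_col _ 1 k 1 k) !mulmx0 !mulmx1 !addr0.
    apply/matrixP => i j; rewrite !mxE !ord1 (_ : lshift k 0 = 0); last exact: val_inj.
    rewrite M1; case: splitP => [i' _|i' _]; rewrite !mxE // ord1 //.
  by rewrite mulKmx // ref_mx_unit.
pose b : 'rV[R]_k := ursubmx X; pose D : 'M[R]_k := drsubmx X.
have XE : X = block_mx 1%:M b 0 D.
  rewrite -[X]hsubmxK X0 -[rsubmx X]vsubmxK /block_mx.
  have -> : row_mx (col_mx 1%:M 0) (col_mx (usubmx (rsubmx X)) (dsubmx (rsubmx X))) =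
    col_mx (row_mx 1%:M (usubmx (rsubmx X))) (row_mx 0 (dsubmx (rsubmx X))).
    by rewrite -[RHS]/(block_mx _ _ _ _) block_mxEh.
  by congr col_mx; congr row_mx; apply/matrixP => i j; rewrite !mxE.
have dX : \det D = \det M.
  by rewrite MX det_mulmx det_ref_mx mul1r XE (@det_ublock _ 1 k) det1 mul1r.
have uD : D \in unitmx by rewrite unitmxE dX -unitmxE.
have uX : X \in unitmx by rewrite unitmx_mul unitmx_inv ref_mx_unit.
have hE u' : hom (u' *m D + b) *m invmx M = hom u' *m invmx ref_mx.
  have -> : hom (u' *m D + b) = hom u' *m X.
    rewrite hom_row [in RHS]hom_row XE (@mul_row_block _ 1 1 k 1 k) !mul1mx mulmx0 addr0.
    by rewrite addrC.
  have -> : invmx M = invmx X *m invmx ref_mx.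
    apply: (can_inj (mulKmx uM)); rewrite mulmxV // MX mulmxA -(mulmxA ref_mx X) mulmxV //.
    by rewrite mulmx1 mulmxV // ref_mx_unit.
  by rewrite mulmxA mulmxK.
have sE : [set u' | simplex M (u' *m D + b)] = simplex ref_mx.
  by apply/seteqP; split=> u' /= H i; have := H i; rewrite hE.
have sS : semilin [set v : 'rV[R]_k | simplex M (v + b)].
  have := semilin_affine 1%:M b (semilin_simplex M); congr semilin.
  by apply/funext => u /=; rewrite mulmx1.
rewrite -(lebn_translate b (semilin_simplex M)) -(lebn_scales_unitmx uD sS) sE.
by rewrite simplex_const_fin dX -EFinM mulrC.
Qed.

End SimplexVolume.

(** * Null sets of non-generic points and the triangulation formula *)

Section ConvexHullVolume.
Variable R : realType.
Variables (k m : nat).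
Local Notation K := k.+1.
Local Notation I := 'I_m.+1.
Implicit Types (w : I -> 'rV[R]_k) (s t : {set I}) (om l : I -> R) (u : 'rV[R]_k).

(** By Caratheodory the hull is a finite union of simplices on affinely independent points; the
    cokernel gives the equations of the affine span and the pseudo-inverse the barycentric
    inequalities. *)
Lemma semilin_conv_hull w : semilin (conv_hull w).
Proof.
pose F s : set 'rV[R]_k :=
  [set u | forall i, xpredT i -> [set u | (hom u *m col i (cokermx (support_mx w s))) 0 0 = 0] u] `&`
  [set u | forall i, xpredT i -> [set u | 0 <= (hom u *m col i (pinvmx (support_mx w s))) 0 0] u].
rewrite (_ : conv_hull w = [set u | exists2 s, row_free (support_mx w s) & F s u]).
  apply: semilin_bigcup => s _; apply: semilinI; apply: semilin_bigcap => i _.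
    exact: semilin_hom_eq0.
  exact: semilin_hom_ge0.
apply/seteqP; split=> u.
  move=> /rep_conv_hull [l /caratheodory [l' lr' lf]]; exists (supp l') => //.
  pose A := support_mx w (supp l'); pose c : 'rV[R]_(#|supp l'|) := \row_j l' (enum_val j).
  have cA : c *m A = hom u.
    rewrite -(lr'.2) (rep_sum (fun i => hom (w i)) lr' (subxx _)) big_enum_val mulmx_sum_row.
    by apply: eq_bigr => j _; rewrite mxE rowK.
  split=> i _ /=; rewrite -hom_mul_mx -cA.
    by rewrite -mulmxA mulmx_coker mulmx0 mxE.
  by rewrite mulmxKp // mxE; apply: (lr'.1).
move=> [s sf [/= H1 H2]]; apply/rep_conv_hull.
pose A := support_mx w s; pose c := hom u *m pinvmx A.
have cA : c *m A = hom u.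
  by rewrite mulmxKpV // submxE; apply/eqP/rowP => i; rewrite hom_mul_mx H1 // mxE.
exists (fun i => \sum_(j | enum_val j == i) c 0 j); split.
  by move=> i; apply: sumr_ge0 => j _; rewrite hom_mul_mx; apply: H2.
rewrite -cA mulmx_sum_row; under eq_bigr do rewrite scaler_suml.
rewrite (exchange_big_dep xpredT) //=; apply: eq_bigr => j _.
by rewrite (big_pred1 (enum_val j)) ?rowK // => i; rewrite /= eq_sym.
Qed.

(** Fewer than k + 1 points lie on a common hyperplane, and only finitely many such subsets
    exist. *)
Lemma nongeneric_null w : exists N : set 'rV[R]_k,
  [/\ semilin N, lebn N = 0%E & forall u, ~ N u -> generic_point w u].
Proof.
have ex s : exists c : 'cV[R]_K, (#|s| < K)%N ->
    c != 0 /\ forall i, i \in s -> (hom (w i) *m c) 0 0 = 0.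
  have [sK|] := boolP (#|s| < K)%N; last by exists 0.
  have : kermx (support_mx w s)^T != 0.
    rewrite kermx_eq0 -row_leq_rank -ltnNge.
    by apply: leq_ltn_trans sK; rewrite mxrank_tr rank_leq_row.
  move=> /rowV0Pn [v /sub_kermxP vA v0]; exists v^T => _; split.
    by rewrite -trmx0 (inj_eq trmx_inj).
  move=> i /enum_valE [j ->]; have := congr1 (fun M : 'rV[R]_ _ => M 0 j) vA.
  rewrite !mxE => E; rewrite -[RHS]E; apply: eq_bigr => p _.
  by rewrite !mxE mulrC.
pose c s := projT1 (cid (ex s)).
have cP s : (#|s| < K)%N -> c s != 0 /\ forall i, i \in s -> (hom (w i) *m c s) 0 0 = 0.
  exact: projT2 (cid (ex s)).
pose F s : set 'rV[R]_k := [set u | (hom u *m c s) 0 0 = 0].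
exists (\big[setU/set0]_(s : {set I} | (#|s| < K)%N) F s).
suff [N1 N2] : semilin (\big[setU/set0]_(s : {set I} | (#|s| < K)%N) F s) /\
    lebn (\big[setU/set0]_(s : {set I} | (#|s| < K)%N) F s) = 0%E.
  split=> // u nNu l lr; rewrite leqNgt; apply/negP => lK; apply: nNu.
  rewrite (bigD1 (supp l)) //; left; rewrite /F /=; have [_ cl] := cP _ lK.
  rewrite -(lr.2) mulmx_suml summxE big1 // => i _; rewrite -scalemxAl mxE.
  have [il|il] := boolP (i \in supp l); first by rewrite cl // mulr0.
  by rewrite (rep0 lr il) mul0r.
elim/big_ind: _ => [|A B [sA A0] [sB B0]|s sK].
- by split; [exact: semilin0|exact: lebn0].
- split; first exact: semilinU.
  (* Off the null set [B] the union is covered by the single piece [A]. *)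
  rewrite (lebn_partition (J := unit) (p := xpredT) (B := fun=> A) (semilinU sA sB) sB) //.
  + by rewrite big_const card_unit /= adde0.
  + by move=> u [Au|Bu] nB //; exists tt.
  + by move=> u [] [].
have [c0 _] := cP _ sK; split; first exact: semilin_hom_eq0.
rewrite /F; under eq_set do rewrite hom_mul_col.
apply: lebn_hyperplane0; apply/orP.
have [c00|c00] := eqVneq (c s 0 0) 0; [right|by left].
apply: contra c0 => /eqP cc; apply/eqP/colP => i; rewrite mxE.
case: (unliftP ord0 i) => [j ->|->//].
by have := congr1 (fun M : 'cV[R]_ _ => M j 0) cc; rewrite !mxE.
Qed.

Lemma lebn_conv_hull w om : generic_heights w om ->
  lebn (conv_hull w) =
  (simplex_const R k * \sum_(s | lower w om s) `|\det (simplex_mx w s)|)%:E.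
Proof.
move=> gom; have [N [sN N0 Ng]] := nongeneric_null w.
rewrite (lebn_partition (p := lower w om) (B := fun s => simplex (simplex_mx w s))
  (semilin_conv_hull w) sN) //.
- rewrite mulr_sumr -sumEFin; apply: eq_bigr => s /and3P[/eqP sK uM _].
  apply: lebn_simplex => // i; rewrite mxE.
  by rewrite (_ : 0 = ord0) // /hom rcons0E unlift_none.
- by move=> s _; apply: semilin_simplex.
- move=> s /and3P[/eqP sK uM _] u /(simplexP _ sK uM) [l lr _].
  by apply/rep_conv_hull; exists l.
- by move=> u wu /Ng gu; apply: lower_exists.
- move=> u s t /Ng gu; exact: lower_unique.
Qed.

End ConvexHullVolume.

(** * Continuity of the volume *)

Section Limits.
Variables (R : realType) (T : Type) (F : set_system T).
Context {FF : Filter F}.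

Lemma cvg_sumr (I : finType) (p : pred I) (f : I -> T -> R) (a : I -> R) :
  (forall i, p i -> f i x @[x --> F] --> a i) ->
  \sum_(i | p i) f i x @[x --> F] --> \sum_(i | p i) a i.
Proof.
move=> fa; elim: (index_enum I) => [|i s IH].
  by rewrite big_nil; under eq_fun do rewrite big_nil; exact: cvg_cst.
rewrite big_cons; under eq_fun do rewrite big_cons.
by case: ifP => // pi; apply: cvgD => //; apply: fa.
Qed.

Lemma cvg_prodr (I : finType) (p : pred I) (f : I -> T -> R) (a : I -> R) :
  (forall i, p i -> f i x @[x --> F] --> a i) ->
  \prod_(i | p i) f i x @[x --> F] --> \prod_(i | p i) a i.
Proof.
move=> fa; elim: (index_enum I) => [|i s IH].
  by rewrite big_nil; under eq_fun do rewrite big_nil; exact: cvg_cst.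
rewrite big_cons; under eq_fun do rewrite big_cons.
by case: ifP => // pi; apply: cvgM => //; apply: fa.
Qed.

Definition cvg_mx m n (M : T -> 'M[R]_(m, n)) (A : 'M[R]_(m, n)) :=
  forall i j, M x i j @[x --> F] --> A i j.

Lemma cvg_mxM m n p (M : T -> 'M[R]_(m, n)) (N : T -> 'M[R]_(n, p)) A B :
  cvg_mx M A -> cvg_mx N B -> cvg_mx (fun x => M x *m N x) (A *m B).
Proof.
move=> MA NB i j; rewrite mxE; under eq_fun do rewrite mxE.
by apply: cvg_sumr => l _; apply: cvgM; [exact: MA|exact: NB].
Qed.

Lemma cvg_det n (M : T -> 'M[R]_n) A : cvg_mx M A -> \det (M x) @[x --> F] --> \det A.
Proof.
move=> MA; apply: cvg_sumr => s _; apply: cvgM; first exact: cvg_cst.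
by apply: cvg_prodr => i _; apply: MA.
Qed.

Lemma cvg_adj n (M : T -> 'M[R]_n) A : cvg_mx M A -> cvg_mx (fun x => \adj (M x)) (\adj A).
Proof.
move=> MA i j; rewrite mxE; under eq_fun do rewrite mxE.
apply: cvgM; first exact: cvg_cst.
apply: cvg_det => p q; rewrite !mxE; under eq_fun do rewrite !mxE.
exact: MA.
Qed.

End Limits.

(** * Generic heights and dependence of the hull volume on its points *)

Section Continuity.
Variable R : realType.
Variables (k m : nat).
Local Notation K := k.+1.
Local Notation I := 'I_m.+1.
Implicit Types (w : I -> 'rV[R]_k) (s : {set I}) (om : 'rV[R]_m.+1).

Lemma interp_at_line w s om j (e : R) i :
  interp_at w s (fun p => (om + e *: delta_mx 0 i) 0 p) j =
  interp_at w s (om 0) j + e * interp_at w s (fun p => (p == i)%:R) j.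
Proof.
rewrite /interp_at /interp.
have -> : heights k s (fun p => (om + e *: delta_mx 0 i) 0 p) =
   heights k s (om 0) + e *: heights k s (fun p => (p == i)%:R).
  by apply/matrixP => p q; rewrite !mxE eqxx /=.
by rewrite mulmxDr mulmxDr -!scalemxAr mxE [X in _ + X]mxE.
Qed.

(** Coincidences are removed one pair (s, j) at a time. Since j is not in s, raising the height of j
    alone moves the gap of that pair at slope -1, and a small enough raise keeps the gaps already
    made nonzero. *)
Lemma generic_heights_dense w om (d : R) : 0 < d ->
  exists2 om' : 'rV[R]_m.+1, (forall i, `|om' 0 i - om 0 i| < d) & generic_heights w (om' 0).
Proof.
pose gap (v : 'rV[R]_m.+1) (q : {set I} * I) : R := interp_at w q.1 (v 0) q.2 - v 0 q.2.
pose p (q : {set I} * I) := (#|q.1| == K) && (q.2 \notin q.1).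
suff H : forall (L : seq ({set I} * I)) (d : R), 0 < d ->
    exists2 om' : 'rV[R]_m.+1, (forall i, `|om' 0 i - om 0 i| < d) & forall q, q \in L -> p q -> gap om' q != 0.
  move=> d0; have [om' close g] := H (index_enum _) d d0; exists om' => // s sK _ j sj.
  by rewrite -subr_eq0; apply: (g (s, j)); rewrite ?mem_index_enum // /p sK eqxx.
elim=> [|[s j] L IH] {d} d d0.
  by exists om => // i; rewrite subrr normr0.
have d20 : 0 < d / 2 by lra.
have [om1 close1 g1] := IH (d / 2) d20.
have d2 : d / 2 < d by lra.
have [[/andP[/= /eqP sK sj] g0]|nsj] := pselect (p (s, j) /\ gap om1 (s, j) = 0); last first.
  exists om1 => [i|q]; first exact: lt_trans (close1 i) d2.
  rewrite inE => /orP[/eqP ->|]; last exact: g1.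
  by move=> psj; apply/eqP => g0; apply: nsj.
pose dir (q : {set I} * I) : R := interp_at w q.1 (fun i => (i == j)%:R) q.2 - (q.2 == j)%:R.
have gapD e q : gap (om1 + e *: delta_mx 0 j) q = gap om1 q + e * dir q.
  by rewrite /gap interp_at_line !mxE eqxx /= /dir; ring.
have [|e e0 eP] := @small_eps R (option ({set I} * I))
  (fun o => if o is Some q then (q \in L) && p q else true)
  (fun o => if o is Some q then `|gap om1 q| else d / 2)
  (fun o => if o is Some q then - `|dir q| else -1).
  by case=> [q /andP[qL pq]|//]; rewrite normr_gt0 g1.
exists (om1 + e *: delta_mx 0 j) => [i|q].
  have := eP None isT; rewrite mulrN1 => ed.
  have := close1 i; rewrite !mxE eqxx /= => c1.
  have eb : `|e * (i == j)%:R| <= e.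
    by case: (i == j); rewrite ?mulr1 ?mulr0 ?normr0 ?gtr0_norm // ltW.
   have := ler_normD (om1 0 i - om 0 i) (e * (i == j)%:R); rewrite addrAC; lra.
rewrite gapD inE => /orP[/eqP -> _|qL pq].
  rewrite g0 add0r /dir /= eqxx /interp_at /interp (_ : heights k s _ = 0).
    by rewrite mulmx0 mulmx0 mxE sub0r mulrN1 oppr_eq0 gt_eqF.
  apply/matrixP => a b; rewrite !mxE; case: eqP => // E.
  by move: sj; rewrite -E elt_in.
have := eP (Some q); rewrite /= qL pq => /(_ isT); rewrite mulrN => H.
apply/eqP => /eqP; rewrite addr_eq0 => /eqP gE; move: H.
by rewrite gE normrN normrM (gtr0_norm e0) subrr ltxx.
Qed.

Definition hull_vol w : R := fine (lebn (conv_hull w)).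

Lemma hull_volE w (om : I -> R) : generic_heights w om ->
  hull_vol w = simplex_const R k * \sum_(s | lower w om s) `|\det (simplex_mx w s)|.
Proof. by move=> gom; rewrite /hull_vol (lebn_conv_hull gom). Qed.

Variables (X : topologicalType) (W : X -> I -> 'rV[R]_k) (x0 : X).
Hypothesis Wc : forall i j, W x i 0 j @[x --> x0] --> W x0 i 0 j.

Lemma cvg_simplex_mx (T : Type) (F : set_system T) (f : T -> X) s : Filter F -> f @ F --> x0 ->
  cvg_mx F (fun t => simplex_mx (W (f t)) s) (simplex_mx (W x0) s).
Proof.
move=> FF fx i j; have E w : simplex_mx w s i j = rcons0 1 (w (elt s i)) 0 j by rewrite mxE.
rewrite E rcons0E; under eq_fun do rewrite E rcons0E.
case: (unlift ord0 j) => [l|]; last exact: cvg_cst.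
exact: (cvg_comp f (fun x => W x (elt s i) 0 l) fx (@Wc _ _)).
Qed.

(* Near x0 the lower faces among the nondegenerate simplices do not change; the degenerate
   ones may enter or leave, but their volumes tend to 0. *)
Lemma lower_near om0 s : generic_heights (W x0) (om0 0) ->
  #|s| = K -> simplex_mx (W x0) s \in unitmx ->
  \forall p \near (x0, om0), lower (W p.1) ((p.2 : 'rV[R]_m.+1) 0) s = lower (W x0) (om0 0) s.
Proof.
move=> gom sK uM; have Mc : cvg_mx (nbhs (x0, om0)) (fun p => simplex_mx (W p.1) s) (simplex_mx (W x0) s).
  by apply: cvg_simplex_mx; exact: cvg_fst.
have dc : \det (simplex_mx (W p.1) s) @[p --> (x0, om0)] --> \det (simplex_mx (W x0) s).
  exact: cvg_det.
have d0 : \det (simplex_mx (W x0) s) != 0 by rewrite -unitfE -unitmxE.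
have ic j : interp_at (W p.1) s ((p.2 : 'rV[R]_m.+1) 0) j @[p --> (x0, om0)] --> interp_at (W x0) s (om0 0) j.
  have hc : cvg_mx (nbhs (x0, om0)) (fun p => hom (W p.1 j)) (hom (W x0 j)).
    move=> a b; rewrite ord1 /hom rcons0E; under eq_fun do rewrite rcons0E.
    case: (unlift ord0 b) => [l|]; last exact: cvg_cst.
    exact: (cvg_comp fst (fun x => W x j 0 l) cvg_fst (@Wc _ _)).
  have vc : cvg_mx (nbhs (x0, om0)) (fun p => heights k s ((p.2 : 'rV[R]_m.+1) 0)) (heights k s (om0 0)).
    move=> a b; rewrite mxE; under eq_fun do rewrite mxE.
    exact: (cvg_comp snd (fun v : 'rV[R]_m.+1 => v 0 (elt s a)) cvg_snd (@coord_continuous _ _ _ _ _ _)).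
  apply: cvg_mxM => //; apply: cvg_mxM => // a b; rewrite mxE.
  under eq_fun do rewrite mxE.
  by apply: cvgM; [exact: cvgV|exact: cvg_adj].
have near_sign j : \forall p \near (x0, om0),
    (j \notin s) ==> (interp_at (W p.1) s ((p.2 : 'rV[R]_m.+1) 0) j < (p.2 : 'rV[R]_m.+1) 0 j) =
    ((j \notin s) ==> (interp_at (W x0) s (om0 0) j < om0 0 j)).
  have [sj|sj] := boolP (j \in s); first by near=> p.
  have oc : (p.2 : 'rV[R]_m.+1) 0 j @[p --> (x0, om0)] --> om0 0 j.
    exact: (cvg_comp snd (fun v : 'rV[R]_m.+1 => v 0 j) cvg_snd (@coord_continuous _ _ _ _ _ _)).
  have dcv : interp_at (W p.1) s ((p.2 : 'rV[R]_m.+1) 0) j - (p.2 : 'rV[R]_m.+1) 0 j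
      @[p --> (x0, om0)] --> interp_at (W x0) s (om0 0) j - om0 0 j.
    exact: cvgB.
  have [lt|gt|eq] := ltgtP (interp_at (W x0) s (om0 0) j) (om0 0 j).
  - rewrite -subr_lt0 in lt; have nl : \forall p \near (x0, om0),
      interp_at (W p.1) s ((p.2 : 'rV[R]_m.+1) 0) j - (p.2 : 'rV[R]_m.+1) 0 j < 0.
      by apply: (cvgr_lt _ dcv).
    apply: filterS nl => p /=; by rewrite subr_lt0 => ->.
  - rewrite -subr_gt0 in gt; have nl : \forall p \near (x0, om0),
      interp_at (W p.1) s ((p.2 : 'rV[R]_m.+1) 0) j - (p.2 : 'rV[R]_m.+1) 0 j > 0.
      by apply: (cvgr_gt _ dcv).
    apply: filterS nl => p /=; by rewrite subr_gt0 => /ltW; rewrite leNgt => /negbTE ->.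
  - by have := gom s sK uM j sj; rewrite eq eqxx.
have ns := filter_forall _ near_sign.
near=> p; rewrite /lower sK eqxx /= uM /= (_ : simplex_mx (W p.1) s \in unitmx); last first.
  by rewrite unitmxE unitfE; near: p; apply: cvgr_neq0 dc d0.
by apply: eq_forallb; near: p; exact: ns.
Unshelve. all: end_near. Qed.

(** Heights generic at x0 may fail to be generic at x, so each x receives its own generic heights
    close to [om0]; the volume formula holds for either choice, and [lower_near] compares them
    because it is joint in x and the heights. *)
Lemma hull_vol_cvg : hull_vol (W x) @[x --> x0] --> hull_vol (W x0).
Proof.
have [om0 _ gom0] := generic_heights_dense (W x0) 0 ltr01.
pose D s x := `|\det (simplex_mx (W x) s)|.
have Dc s : D s x @[x --> x0] --> D s x0.
  by apply: cvg_norm; apply: cvg_det; apply: cvg_simplex_mx.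
pose c := simplex_const R k.
have ec : `|c| * \sum_s `|D s x - D s x0| @[x --> x0] --> (0 : R).
  rewrite [X in _ --> X](_ : 0 = `|c| * \sum_(s : {set I}) `|D s x0 - D s x0|); last first.
    by rewrite big1 ?mulr0 // => s _; rewrite subrr normr0.
  apply: cvgM; first exact: cvg_cst.
  apply: cvg_sumr => s _; apply: cvg_norm; apply: cvgB => //; exact: cvg_cst.
apply/cvgrPdist_lt => e e0.
have good0 s : \forall p \near (x0, om0),
    (#|s| == K) && (simplex_mx (W x0) s \in unitmx) ->
    lower (W p.1) ((p.2 : 'rV[R]_m.+1) 0) s = lower (W x0) (om0 0) s.
  have [/andP[/eqP sK uM]|_] := boolP (_ && _); last by near=> p.
  by near=> p => _; near: p; apply: lower_near.
have good := filter_forall _ good0.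
have [[A B] /= [xA omB] AB] := good.
have [d /= d0 dB] := (nbhs_ballP _ _).1 omB.
near=> x; have Ax : A x by near: x.
have [om' close gom'] := generic_heights_dense (W x) om0 d0.
have Bom' : B om'.
  apply: dB; split=> // i j; rewrite ord1 /ball /= distrC; exact: close.
have := AB (x, om') (conj Ax Bom') => /= low.
rewrite (hull_volE gom0) (hull_volE gom') -mulrBr.
apply: (@le_lt_trans _ _ (`|c| * \sum_s `|D s x - D s x0|)); last first.
  by near: x; apply: cvgr_lt ec _ e0.
rewrite normrM ler_wpM2l // big_mkcond [X in _ - X]big_mkcond -sumrB.
apply: le_trans (ler_norm_sum _ _ _) _; apply: ler_sum => s _.
have [sM|nsM] := boolP ((#|s| == K) && (simplex_mx (W x0) s \in unitmx)).
  by rewrite low //; case: ifP => _; rewrite ?subrr ?normr0 // distrC.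
have -> : lower (W x0) (om0 0) s = false by rewrite /lower andbA (negbTE nsM).
rewrite sub0r normrN.
have [/eqP sK|sK] := boolP (#|s| == K); last by rewrite /lower (negbTE sK) normr0.
have -> : D s x0 = 0.
  move: nsM; rewrite sK eqxx /= unitmxE unitfE negbK => /eqP dM.
  by rewrite /D dM normr0.
by rewrite subr0 /D normr_id; case: ifP; rewrite ?normr_id ?normr0.
Unshelve. all: end_near. Qed.

End Continuity.

(** * Sections and projections *)

Section SectionVolume.
Variables (R : realType) (k : nat).
Local Notation d := k.+1.
Implicit Types x y z : 'rV[R]_d.

Lemma dotv_gt0 x : x != 0 -> 0 < dotv x x.
Proof.
move=> x0; rewrite lt0r sumr_ge0 ?andbT => [|i _]; last by rewrite -expr2 sqr_ge0.
apply: contra x0 => /eqP xx0; apply/eqP/rowP => i; rewrite mxE.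
have /psumr_eq0P : forall j, true -> 0 <= x ord0 j * x ord0 j by move=> j _; rewrite -expr2 sqr_ge0.
by move=> /(_ xx0 i isT) /eqP; rewrite mulf_eq0 orbb => /eqP.
Qed.

Lemma enorm_gt0 x : x != 0 -> 0 < enorm x.
Proof. by move=> /dotv_gt0; rewrite /enorm sqrtr_gt0. Qed.

Lemma enorm_sqr x : enorm x * enorm x = dotv x x.
Proof. by rewrite -expr2 sqr_sqrtr // sumr_ge0 // => i _; rewrite -expr2 sqr_ge0. Qed.

Lemma mulmx_trE x y : x *m y^T = (dotv x y)%:M.
Proof. by apply/matrixP => i j; rewrite !ord1 -dotvE mxE eqxx. Qed.

(* The Householder reflection exchanging the first basis vector and the unit vector y. *)
Lemma orthogonal_with_row y : dotv y y = 1 ->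
  exists O : 'M[R]_d, O *m O^T = 1%:M /\ row 0 O = y.
Proof.
move=> yy; pose e : 'rV[R]_d := delta_mx 0 0.
have ee : dotv e e = 1.
  by rewrite dotvE trmx_delta mul_delta_mx mxE !eqxx.
have [->|ye] := eqVneq y e.
  by exists 1%:M; rewrite trmx1 mulmx1; split=> //; rewrite rowE mulmx1.
pose v := y - e; have vv : 0 < dotv v v by apply: dotv_gt0; rewrite subr_eq0.
pose c := 2 / dotv v v.
have sq : (v^T *m v) *m (v^T *m v) = dotv v v *: (v^T *m v).
  by rewrite mulmxA -(mulmxA v^T) mulmx_trE -mulmxA mul_scalar_mx -scalemxAr.
pose O : 'M[R]_d := 1%:M - c *: (v^T *m v).
have OT : O^T = O by rewrite /O linearB /= trmx1 linearZ /= trmx_mul trmxK.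
exists O; split.
  have refl (S : 'M[R]_d) (q r : R) : S *m S = q *: S -> r * r * q = 2 * r ->
      (1%:M - r *: S) *m (1%:M - r *: S) = 1%:M.
    move=> SS rq; rewrite mulmxBl mul1mx mulmxBr mulmx1 -scalemxAl -scalemxAr SS !scalerA rq.
    have -> : (2 * r) *: S = r *: S + r *: S by rewrite -scalerDl; congr (_ *: _); ring.
    by rewrite (_ : r *: S - (r *: S + r *: S) = - (r *: S)) ?opprK ?subrK // opprD addrA subrr sub0r.
  by rewrite OT; apply: (refl _ _ _ sq); rewrite /c; field; rewrite gt_eqF.
rewrite rowE /O mulmxDr mulmx1 mulmxN -scalemxAr mulmxA mulmx_trE mul_scalar_mx scalerA.
have -> : c * dotv e v = -1.
  have vvE : dotv v v = - 2 * dotv e v by rewrite /v !dotvr !dotvl yy ee (dotvC y e); ring.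
  have ev0 : dotv e v != 0 by apply: contraTneq vv => ev; rewrite vvE ev mulr0 ltxx.
  by rewrite /c vvE; field.
by rewrite scaleN1r opprK addrC subrK.
Qed.

Lemma isometry_completion x (A : 'M[R]_(k, d)) : x != 0 ->
  A *m A^T = 1%:M -> A *m x^T = 0 ->
  exists O : 'M[R]_(1 + k, d), [/\ O = col_mx ((enorm x)^-1 *: x) A, O *m O^T = 1%:M & O^T *m O = 1%:M].
Proof.
move=> x0 AA Ax; exists (col_mx ((enorm x)^-1 *: x) A).
have n0 := enorm_gt0 x0.
have OO : (col_mx ((enorm x)^-1 *: x) A : 'M[R]_(1 + k, d)) *m (col_mx ((enorm x)^-1 *: x) A)^T = 1%:M.
  rewrite tr_col_mx mul_col_row AA linearZ /= -!scalemxAl -!scalemxAr Ax scaler0.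
  have -> : x *m A^T = 0 by rewrite -[LHS]trmxK trmx_mul trmxK Ax trmx0.
  rewrite scaler0 mulmx_trE -enorm_sqr !scale_scalar_mx.
  rewrite (_ : _ * (_ * _) = 1); last by field; rewrite gt_eqF.
  by rewrite -scalar_mx_block.
by split=> //; apply: mulmx1C.
Qed.

Lemma hyperplane_isometry_ex x : x != 0 -> hyperplane_isometries x !=set0.
Proof.
move=> x0; have n0 := enorm_gt0 x0.
have [|O [OO Oy]] := @orthogonal_with_row ((enorm x)^-1 *: x).
  by rewrite dotvZl dotvZr -enorm_sqr; field; rewrite gt_eqF.
pose A : 'M[R]_(k, d) := dsubmx (O : 'M[R]_(1 + k, d)).
have OE : O = col_mx ((enorm x)^-1 *: x) A :> 'M[R]_(1 + k, d).
  rewrite -Oy -[LHS](@vsubmxK _ 1 k); congr (@col_mx _ 1 k _ _ _); apply/matrixP => i j; rewrite !mxE !ord1.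
  by congr (O _ _); apply: val_inj.
have OO' : col_mx ((enorm x)^-1 *: x) A *m (col_mx ((enorm x)^-1 *: x) A)^T = 1%:M.
  by rewrite -OE; exact: OO.
exists A; move: OO'; rewrite tr_col_mx mul_col_row [RHS](@scalar_mx_block _ 1 k) => /(@eq_block_mx _ 1 k 1 k) [_ _ A1 A2]; split=> //.
move: A1; rewrite linearZ /= -scalemxAr => /eqP; rewrite scaler_eq0 invr_eq0 gt_eqF //=.
by move/eqP.
Qed.

Definition proj_form (Pi : 'M[R]_(d, k)) x : R := \det (row_mx x^T Pi : 'M[R]_(1 + k)).

(** Multiplying (x^T | Pi) by the orthogonal matrix with rows x/|x| and A gives a block triangular
    matrix with diagonal blocks |x| and A Pi. *)
Lemma proj_form_isometry (Pi : 'M[R]_(d, k)) x (A : 'M[R]_(k, d)) : x != 0 ->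
  A *m A^T = 1%:M -> A *m x^T = 0 -> `|proj_form Pi x| = enorm x * `|\det (A *m Pi)|.
Proof.
move=> x0 AA Ax; have n0 := enorm_gt0 x0.
have [ Q [OE OO _]] := isometry_completion x0 AA Ax.
have detO : `|\det Q| = 1.
  have := congr1 determinant OO; rewrite det_mulmx det_tr det1 => /(congr1 Num.norm).
  rewrite normrM normr1 -expr2 => /eqP; rewrite sqrp_eq1 // => /eqP.
  by [].
have := congr1 (fun M => \det (M *m (row_mx x^T Pi : 'M[R]_(1 + k)))) OE.
rewrite det_mulmx mul_col_row Ax -scalemxAl mulmx_trE det_ublock -enorm_sqr.
move=> /(congr1 Num.norm); rewrite normrM detO mul1r => ->.
rewrite normrM -scale_scalar_mx scalerA mulVf ?gt_eqF // ?scale1r.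
by rewrite det_scalar1 gtr0_norm.
Qed.

Lemma isometry_retract x (A : 'M[R]_(k, d)) z : x != 0 -> A *m A^T = 1%:M -> A *m x^T = 0 ->
  dotv x z = 0 -> z *m A^T *m A = z.
Proof.
move=> x0 AA Ax xz; have [ Q [OE _]] := isometry_completion x0 AA Ax.
rewrite OE tr_col_mx mul_row_col => /(congr1 (mulmx z)).
have zx : z *m ((enorm x)^-1 *: x)^T = 0.
  by rewrite mulmx_trE dotvZr dotvC xz mulr0 raddf0.
by rewrite mulmx1 mulmxDr mulmxA zx mul0mx add0r mulmxA.
Qed.

(** The isometry chosen by [xget] enters only through |det (A Pi)|, and the norm in
    [proj_form_isometry] cancels the one dividing the section volume. *)
Lemma rho_hull_vol n (W : 'I_n.+1 -> 'rV[R]_d) (P : set 'rV[R]_d) (Pi : 'M[R]_(d, k)) x :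
  x != 0 -> (forall z, conv_hull W z <-> P z /\ dotv x z = 0) -> proj_form Pi x != 0 ->
  rho_I P x = hull_vol (fun i => W i *m Pi) / `|proj_form Pi x|.
Proof.
move=> x0 WP L0; rewrite /rho_I /section_vol.
set A := xget _ _; have [AA Ax] : hyperplane_isometries x A.
  exact: (xgetPex 0 (hyperplane_isometry_ex x0)).
have LE := proj_form_isometry Pi x0 AA Ax; have n0 := enorm_gt0 x0.
have dA : `|\det (A *m Pi)| != 0.
  by apply: contra_neq L0 => dA; apply/normr0_eq0; rewrite LE dA mulr0.
have uA : A *m Pi \in unitmx by rewrite unitmxE unitfE -normr_eq0.
pose w i := W i *m Pi.
have WA i : W i *m A^T *m A = W i.
  by apply: (isometry_retract x0 AA Ax); have [] := (WP (W i)).1 (conv_hull_gen W i).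
have setE : [set u : 'rV[R]_k | P (u *m A)] = [set u | conv_hull w (u *m (A *m Pi))].
  apply/seteqP; split=> u /=.
    move=> Pu; have [|l [l0 [l1 uE]]] := (WP (u *m A)).2.
      by split=> //; rewrite dotvC dotvE -mulmxA Ax mulmx0 mxE.
    exists l; split=> //; split=> //; rewrite mulmxA uE mulmx_suml.
    by apply: eq_bigr => i _; rewrite -scalemxAl.
  move=> [l [l0 [l1 uE]]]; apply: (proj1 ((WP (u *m A)).1 _)); exists l; split=> //; split=> //.
  have : u *m (A *m Pi) = (\sum_i l i *: (W i *m A^T)) *m (A *m Pi).
    rewrite uE mulmx_suml; apply: eq_bigr => i _.
    by rewrite -scalemxAl mulmxA WA.
  move=> /(can_inj (mulmxK uA)) ->; rewrite mulmx_suml; apply: eq_bigr => i _.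
  by rewrite -scalemxAl WA.
have [om _ gom] := generic_heights_dense w 0 (ltr01 : 0 < (1 : R)).
have := lebn_scales_unitmx uA (semilin_conv_hull w).
rewrite -setE /hull_vol -/w (lebn_conv_hull gom) /=; set v := (_ * _ : R) => E.
have -> : lebn [set u : 'rV[R]_k | P (u *m A)] = (v / `|\det (A *m Pi)|)%:E.
  by rewrite mulrC EFinM -E muleA -EFinM mulVf // mul1e.
by rewrite /= LE; field; rewrite dA gt_eqF.
Qed.

Lemma rho_empty (P : set 'rV[R]_d) x : x != 0 -> (forall z, P z -> dotv x z != 0) ->
  rho_I P x = 0.
Proof.
move=> x0 nP; rewrite /rho_I /section_vol; set A := xget _ _.
have [AA Ax] : hyperplane_isometries x A by exact: (xgetPex 0 (hyperplane_isometry_ex x0)).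
rewrite (_ : [set u : 'rV[R]_k | P (u *m A)] = set0) ?lebn0 ?mul0r //.
apply/seteqP; split=> u //= /nP; rewrite dotvC dotvE -mulmxA Ax mulmx0 mxE.
by rewrite eqxx.
Qed.

(** Pi consists of the last k columns of an invertible G with c G the first basis vector. Expanding
    x^T in the columns of G leaves only its first coordinate in the determinant, and that is <c,
    x>. *)
Lemma projection_along (c : 'rV[R]_d) : c != 0 ->
  exists (Pi : 'M[R]_(d, k)) (kappa : R), [/\ kappa != 0, c *m Pi = 0 &
    forall x, proj_form Pi x = kappa * dotv c x].
Proof.
move=> c0; have [|N uN Nc] := @exists_unitmx_col R k c^T.
  by rewrite -trmx0 (inj_eq trmx_inj).
pose G : 'M[R]_(d, 1 + k) := N^T; exists (rsubmx G), (\det N).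
have cG : c *m G = delta_mx 0 0 by rewrite -[LHS]trmxK trmx_mul trmxK Nc trmx_delta.
split=> [||x].
- by rewrite -unitfE -unitmxE.
- rewrite mulmx_rsub cG; apply/matrixP => i j; rewrite !mxE.
  by rewrite -val_eqE /= andbF.
pose y : 'cV[R]_(1 + k) := invmx G *m x^T.
have Gy : G *m y = x^T by rewrite mulKVmx // unitmx_tr.
have cx : dotv c x = y 0 0.
  by rewrite dotvE -Gy mulmxA cG -rowE mxE.
rewrite /proj_form; have -> : row_mx x^T (rsubmx G) = G *m block_mx (usubmx y) 0 (dsubmx y) 1%:M.
  rewrite -{2}[G]hsubmxK mul_row_block mulmx0 mulmx1 add0r; congr row_mx.
  by rewrite -mul_row_col hsubmxK vsubmxK.
rewrite det_mulmx det_tr det_lblock det1 mulr1 cx det_mx11 mxE.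
by congr (_ * y _ _); apply: val_inj.
Qed.

End SectionVolume.

(** * Polynomial functions and irreducible components *)

Section PolynomialFunctions.
Variables (R : realType) (d : nat).
Implicit Types (x v : 'rV[R]_d) (f g : 'rV[R]_d -> R) (p q : mpoly.mpoly d R).

Lemma pdeg_le p n : (pdeg p <= n)%N <-> forall m : mpoly.multinom d, m \in mpoly.msupp p -> (mpoly.mdeg m <= n)%N.
Proof.
split=> [pn m mp|H]; last by apply/bigmax_leqP_seq => m mp _; apply: H.
by apply: leq_trans pn; rewrite /pdeg (big_rem _ mp) /= leq_max leqnn.
Qed.

Definition polyfun n f := exists p, (pdeg p <= n)%N /\ forall x, peval p x = f x.

Lemma polyfunW n n' f : (n <= n')%N -> polyfun n f -> polyfun n' f.
Proof. by move=> nn' [p [pn pf]]; exists p; split=> //; apply: leq_trans nn'. Qed.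

Lemma polyfun_cst c : polyfun 0 (fun=> c).
Proof.
exists (mpoly.mpolyC d c); split=> [|x]; last by rewrite /peval mpoly.mevalC.
apply/pdeg_le => m; rewrite mpoly.msuppC; case: ifP => // _.
by rewrite inE => /eqP ->; rewrite mpoly.mdeg0.
Qed.

Lemma polyfun_coord i : polyfun 1 (fun x => x ord0 i).
Proof.
exists (mpoly.mpolyX R (mpoly.mnm1 i)); split=> [|x]; last by rewrite /peval mpoly.mevalXU.
apply/pdeg_le => m; rewrite mpoly.msuppX inE => /eqP ->.
by rewrite mpoly.mdeg1.
Qed.

Lemma polyfunD n f g : polyfun n f -> polyfun n g -> polyfun n (fun x => f x + g x).
Proof.
move=> [p [pn pf]] [q [qn qg]]; exists (p + q); split=> [|x]; last first.
  by rewrite /peval mpoly.mevalD; congr (_ + _); [exact: pf|exact: qg].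
apply/pdeg_le => m /mpoly.msuppD_le; rewrite mem_cat => /orP[].
  exact: (pdeg_le p n).1 m.
exact: (pdeg_le q n).1 m.
Qed.

Lemma polyfunM n n' f g : polyfun n f -> polyfun n' g -> polyfun (n + n') (fun x => f x * g x).
Proof.
move=> [p [pn pf]] [q [qn qg]]; exists (p * q); split=> [|x]; last first.
  by rewrite /peval mpoly.mevalM; congr (_ * _); [exact: pf|exact: qg].
apply/pdeg_le => m /mpoly.msuppM_le /allpairsP [[m1 m2] [/= m1p m2q ->]].
rewrite mpoly.mdegD leq_add //.
  exact: (pdeg_le p n).1 pn m1 m1p.
exact: (pdeg_le q n').1 qn m2 m2q.
Qed.

Lemma polyfunZ n c f : polyfun n f -> polyfun n (fun x => c * f x).
Proof. by move=> fn; rewrite -[n]add0n; apply: polyfunM => //; apply: polyfun_cst. Qed.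

Lemma polyfun_sum (I : finType) (P : pred I) n (F : I -> 'rV[R]_d -> R) :
  (forall i, P i -> polyfun n (F i)) -> polyfun n (fun x => \sum_(i | P i) F i x).
Proof.
move=> FP; elim: (index_enum I) => [|i s IH].
  under eq_fun do rewrite big_nil.
  by apply: (@polyfunW 0) => //; apply: polyfun_cst.
have [Pi|/negbTE Pi] := boolP (P i); under eq_fun do rewrite big_cons Pi; last exact: IH.
by apply: polyfunD => //; apply: FP.
Qed.

Lemma polyfun_prod (I : finType) (P : pred I) (n : I -> nat) (F : I -> 'rV[R]_d -> R) :
  (forall i, P i -> polyfun (n i) (F i)) ->
  polyfun (\sum_(i | P i) n i) (fun x => \prod_(i | P i) F i x).
Proof.
move=> FP; elim: (index_enum I) => [|i s [p [pn pf]]].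
  rewrite big_nil (_ : (fun x => _) = fun=> 1); first exact: polyfun_cst.
  by apply/funext => x; rewrite big_nil.
rewrite big_cons; have [Pi|/negbTE Pi] := boolP (P i); last first.
  by exists p; split=> // x; rewrite big_cons Pi.
rewrite (_ : (fun x => _) = fun x => F i x * \prod_(j <- s | P j) F j x).
  by apply: polyfunM; [exact: FP|exists p].
by apply/funext => x; rewrite big_cons Pi.
Qed.

Lemma polyfun_det k (n : 'I_k -> nat) (M : 'rV[R]_d -> 'M[R]_k) :
  (forall i j, polyfun (n i) (fun x => M x i j)) -> polyfun (\sum_i n i) (fun x => \det (M x)).
Proof.
move=> Mn; apply: polyfun_sum => s _; apply: polyfunZ.
by apply: polyfun_prod => i _; apply: Mn.
Qed.

Lemma polyfun_dotv v : polyfun 1 (fun x => dotv x v).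
Proof.
apply: polyfun_sum => i _; apply: (@polyfunM 1 0); first exact: polyfun_coord.
exact: polyfun_cst.
Qed.

(** A list rather than one product, so that finite unions do not raise the degree bound. *)
Definition poly_cover n (S : set 'rV[R]_d) := exists ps : seq (mpoly.mpoly d R),
  (forall p, p \in ps -> p != 0 /\ (pdeg p <= n)%N) /\
  forall x, S x -> exists2 p, p \in ps & peval p x = 0.

Lemma poly_cover1 n f y : polyfun n f -> f y != 0 -> poly_cover n [set x | f x = 0].
Proof.
move=> [p [pn pf]] fy; exists [:: p]; split=> [q|x fx].
  rewrite inE => /eqP ->; split=> //; apply: contraNneq fy => p0.
  by rewrite -pf p0 /peval mpoly.meval0.
by exists p; rewrite ?inE // pf.
Qed.

Lemma poly_coverS n S T : S `<=` T -> poly_cover n T -> poly_cover n S.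
Proof. by move=> ST [ps [H1 H2]]; exists ps; split=> // x /ST /H2. Qed.

Lemma poly_cover0 n : poly_cover n set0.
Proof. by exists [::]; split. Qed.

Lemma poly_coverU n S T : poly_cover n S -> poly_cover n T -> poly_cover n (S `|` T).
Proof.
move=> [ps [ps0 psS]] [qs [qs0 qsT]]; exists (ps ++ qs); split=> [p|x [/psS|/qsT] [p pp px]].
- by rewrite mem_cat => /orP[/ps0|/qs0].
- by exists p; rewrite // mem_cat pp.
- by exists p; rewrite // mem_cat pp orbT.
Qed.

Lemma poly_cover_bigcup n (I : finType) (S : I -> set 'rV[R]_d) :
  (forall i, poly_cover n (S i)) -> poly_cover n [set x | exists i, S i x].
Proof.
move=> Sn; suff [ps [H1 H2]] : poly_cover n [set x | exists2 i, i \in index_enum I & S i x].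
  by exists ps; split=> // x [i Si]; apply: H2; exists i; rewrite ?mem_index_enum.
elim: (index_enum I) => [|i s IH].
  by apply: poly_coverS (poly_cover0 n) => x [].
apply: poly_coverS (poly_coverU (Sn i) IH) => x [j].
by rewrite inE => /orP[/eqP ->|js] Sj; [left|right; exists j].
Qed.

Lemma irreducible_sub_cover (Z : set 'rV[R]_d) (ps : seq (mpoly.mpoly d R)) :
  zariski_irreducible Z -> (forall x, Z x -> exists2 p, p \in ps & peval p x = 0) ->
  exists2 p, p \in ps & forall x, Z x -> peval p x = 0.
Proof.
move=> [[Fs ZE] [[z Zz] Zirr]]; elim: ps => [|p ps IH] H.
  by have [] := H z Zz.
pose q := \prod_(p' <- ps) p'.
have qE x : peval q x = 0 <-> exists2 p', p' \in ps & peval p' x = 0.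
  rewrite /q; elim: (ps) => [|p' ps' IH'].
    rewrite big_nil /peval mpoly.meval1; split=> [/eqP|[]//].
    by rewrite oner_eq0.
  rewrite big_cons /peval mpoly.mevalM; split.
    move=> /eqP; rewrite mulf_eq0 => /orP[/eqP p0|/eqP /IH' [r rs r0]].
      by exists p'; rewrite ?mem_head.
    by exists r; rewrite // inE rs orbT.
  move=> [r]; rewrite inE => /orP[/eqP ->|rs] r0; first by rewrite [X in X * _]r0 mul0r.
  by rewrite [X in _ * X](IH'.2 _) ?mulr0 //; exists r.
have closed r : zariski_closed (Z `&` [set x | peval r x = 0]).
  exists (Fs `|` [set r]); apply/seteqP; split=> x /=.
    by rewrite {1}ZE => -[/= Zx rx] s [/Zx|->].
  move=> Hx; split; last by apply: Hx; right.
  by rewrite ZE => s Fss; apply: Hx; left.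
have [|E|E] := Zirr _ _ (closed p) (closed q).
- apply/seteqP; split=> x; last by move=> [[]|[]].
  move=> Zx; have [r] := H x Zx; rewrite inE => /orP[/eqP ->|rs] r0; first by left.
  by right; split=> //=; apply/qE; exists r.
- by exists p; rewrite ?mem_head // => x; rewrite E => -[].
- have [x|r rs rZ] := IH; first by rewrite {1}E => -[_ /= /qE].
  by exists r; rewrite // inE rs orbT.
Qed.

(** The product of the list vanishes on the boundary, hence on its Zariski closure. So the list
    covers Z as well, and irreducibility picks one factor. *)
Lemma component_degree_le n (K Z : set 'rV[R]_d) : poly_cover n (eboundary K) ->
  irreducible_component (algebraic_boundary K) Z -> degree_le Z n.
Proof.
move=> [ps [ps0 psK]] [Zirr [ZK _]].
have [|p pps pZ] := irreducible_sub_cover (ps := ps) Zirr; last first.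
  exists p; have [p0 pn] := ps0 p pps; split=> //.
  by apply/eqP; rewrite mpoly.msupp_eq0.
move=> x /ZK; move=> /(_ (\prod_(p <- ps) p)) H.
have prodE y : peval (\prod_(p <- ps) p) y = \prod_(p <- ps) peval p y.
  by rewrite /peval; elim/big_rec2: _ => [|p a b _ <-]; rewrite ?mpoly.meval1 ?mpoly.mevalM.
have := H _; rewrite prodE => H'.
have /eqP : \prod_(p <- ps) peval p x = 0.
  apply: H' => y /psK [p pp py]; rewrite prodE (big_rem _ pp) /= py mul0r //.
by rewrite prodf_seq_eq0 => /hasP [p pp /andP[_ /eqP px]]; exists p.
Qed.

End PolynomialFunctions.

(** * The boundary of the intersection body *)

Section IntersectionBodyBoundary.
Variables (R : realType) (k : nat).
Local Notation d := k.+1.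

(** At most d points satisfy a common affine equation, which cannot hold on a ball. *)
Lemma full_dim_card n (V : 'I_n -> 'rV[R]_d) : interior (conv_hull V) !=set0 -> (d < n)%N.
Proof.
move=> [x0 /nbhs_ballP [e /= e0 ball_e]]; rewrite ltnNge; apply/negP => nd.
pose A : 'M[R]_(n, d.+1) := \matrix_i hom (V i).
have : kermx A^T != 0.
  rewrite kermx_eq0 -row_leq_rank -ltnNge ltnS.
  by apply: leq_trans nd; rewrite mxrank_tr rank_leq_row.
move=> /rowV0Pn [v /sub_kermxP vA v0].
have [s [c vE]] := rcons0_ex v.
have Vc i : dotv c (V i) = - s.
  have : dotv v (hom (V i)) = 0.
    have := congr1 (fun M : 'rV[R]_n => M 0 i) vA; rewrite [in RHS]mxE mxE => <-.
    by apply: eq_bigr => j _; rewrite [A^T _ _]mxE [A _ _]mxE.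
  by rewrite vE dotv_rcons0 mulr1 => /eqP; rewrite addrC addr_eq0 => /eqP.
have Pc y : conv_hull V y -> dotv c y = - s.
  move=> Py; apply/eqP; rewrite eq_le (conv_hull_le Py) => [|i]; last by rewrite Vc.
  rewrite -[leRHS]opprK -dotvNl lerNr opprK (conv_hull_le Py) // => i.
  by rewrite dotvNl Vc opprK.
have c0 : c = 0.
  apply/rowP => j; rewrite mxE; pose y := x0 + (e / 2) *: delta_mx 0 j.
  have Py : conv_hull V y.
    apply: ball_e; split=> // i1 j1; rewrite /ball /= !mxE !ord1 opprD addrA subrr sub0r normrN eqxx /=.
    case: (j1 == j); rewrite ?mulr1 ?mulr0 ?normr0 // ger0_norm; lra.
  have Px0 : conv_hull V x0 by apply: ball_e; apply: ballxx.
  have := Pc _ Py; rewrite dotvDr (Pc _ Px0) dotvZr => /eqP.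
  rewrite -[X in _ == X]addr0 (inj_eq (addrI _)) mulf_eq0 => /orP[|/eqP <-].
    by rewrite mulf_eq0 invr_eq0 (gt_eqF e0) pnatr_eq0.
  by rewrite dotvE trmx_delta -colE mxE.
have n0 : (0 < n)%N.
  have : conv_hull V x0 by apply: ball_e; apply: ballxx.
  case: n V {nd A vA ball_e Vc Pc} => // V [l [_ [/eqP]]].
  by rewrite big_ord0 eq_sym oner_eq0.
have /eqP := Vc (Ordinal n0); rewrite c0 dotv0l eq_sym oppr_eq0 => /eqP s0.
case/eqP: v0; rewrite vE c0 s0; apply/rowP => j; rewrite rcons0E mxE.
by case: unlift => [i|]; rewrite ?mxE.
Qed.

Lemma edge_enumeration (P : set 'rV[R]_d) f1 : num_edges P f1 ->
  exists a b : 'I_f1 -> 'rV[R]_d, [/\ forall l, a l != b l,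
    forall l, is_edge P (segment (a l) (b l)) &
    forall F, is_edge P F -> exists l, F = segment (a l) (b l)].
Proof.
move=> /card_set_bijP [f [ffun finj fsurj]].
have ex (l : 'I_f1) : exists ab : 'rV[R]_d * 'rV[R]_d,
    [/\ ab.1 != ab.2, is_edge P (segment ab.1 ab.2) & f (segment ab.1 ab.2) = l].
  have [F eF fF] := fsurj l (ltn_ord l).
  by have [_ [v [w [vw FE]]]] := eF; exists (v, w); rewrite /= -FE.
pose ab l := projT1 (cid (ex l)).
have abP l : [/\ (ab l).1 != (ab l).2, is_edge P (segment (ab l).1 (ab l).2) &
    f (segment (ab l).1 (ab l).2) = l] := projT2 (cid (ex l)).
exists (fun l => (ab l).1), (fun l => (ab l).2); split=> [l|l|F eF].
- by have [] := abP l.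
- by have [] := abP l.
have fF : (f F < f1)%N by apply: ffun.
exists (Ordinal fF); have [_ e fE] := abP (Ordinal fF).
by apply: finj; rewrite ?inE // fE.
Qed.

Lemma cvg_dotv (v x : 'rV[R]_d) : dotv y v @[y --> x] --> dotv x v.
Proof.
apply: (@cvg_sumr R _ (nbhs x) (nbhs_filter x)) => i _; apply: cvgM; last exact: cvg_cst.
exact: coord_continuous.
Qed.

Lemma eboundary_intersection_body (P : set 'rV[R]_d) (x : 'rV[R]_d) : x != 0 ->
  rho_I P y @[y --> x] --> rho_I P x -> eboundary (intersection_body P) x -> rho_I P x = 1.
Proof.
move=> x0 cx [clx nix].
have near0 : \forall y \near x, (y : 'rV[R]_d) != 0.
  have H : \forall y \near x, dotv y x > 0 by apply: (cvgr_gt _ (@cvg_dotv x x)); apply: dotv_gt0.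
  by apply: filterS H => y; apply: contraTneq => ->; rewrite dotv0l ltxx.
have [lt|gt|//] := ltgtP (rho_I P x) 1; exfalso.
  have near1 : \forall y \near x, rho_I P y < 1 by apply: (cvgr_lt _ cx).
  have [y [[[_ +]|y0] [ylt y0']]] := clx _ (filterI near1 near0).
    by rewrite leNgt ylt.
  by rewrite y0 eqxx in y0'.
apply: nix; have near1 : \forall y \near x, 1 < rho_I P y by apply: (cvgr_gt _ cx).
by apply: filterS2 near1 near0 => y y1 y0; left; split; rewrite // ltW.
Qed.

Lemma cvg_cross (a b x : 'rV[R]_d) i : crossed x a b ->
  cross y a b 0 i @[y --> x] --> cross x a b 0 i.
Proof.
move=> /crossed_neq D0; have ca := @cvg_dotv a x; have cb := @cvg_dotv b x.
have cD : dotv y b - dotv y a @[y --> x] --> dotv x b - dotv x a by exact: (cvgB cb ca).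
have cN : dotv y b * a 0 i - dotv y a * b 0 i @[y --> x] --> dotv x b * a 0 i - dotv x a * b 0 i.
  exact: (cvgB (cvgM cb (cvg_cst (a 0 i))) (cvgM ca (cvg_cst (b 0 i)))).
have cV : (dotv y b - dotv y a)^-1 @[y --> x] --> (dotv x b - dotv x a)^-1 by exact: (cvgV D0 cD).
have E y : cross y a b 0 i =
    (dotv y b - dotv y a)^-1 * (dotv y b * a 0 i - dotv y a * b 0 i) by rewrite !mxE.
rewrite E; under eq_fun do rewrite E.
exact: (cvgM cV cN).
Qed.

(** * Sections of a fixed polytope, their projections and the cleared equation *)

Section Data.
Variables (n : nat) (V : 'I_n -> 'rV[R]_d).
Hypothesis Ve : forall i, exists g, exposes V g i.
Let P := conv_hull V.
Hypothesis dn : (d < n)%N.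
Variables (f1 : nat) (a b : 'I_f1 -> 'rV[R]_d).
Hypothesis ab_neq : forall l, a l != b l.
Hypothesis edge_ab : forall l, is_edge P (segment (a l) (b l)).
Hypothesis edge_cover : forall F, is_edge P F -> exists l, F = segment (a l) (b l).
Local Notation lab := 'I_f1.
Implicit Types (x y : 'rV[R]_d) (C : {set lab}) (e : option lab).

(** The direction of projection: a crossed edge, or the first basis vector when there is none. *)
Definition dir e : 'rV[R]_d := if e is Some l then b l - a l else delta_mx 0 0.

(* The normals whose hyperplane section may be degenerate; a finite union of hyperplanes. *)
Definition exceptional x := (exists l, a l != 0 /\ dotv x (a l) = 0) \/
  (exists l, b l != 0 /\ dotv x (b l) = 0) \/
  (exists i, V i != 0 /\ dotv x (V i) = 0) \/ dotv x (dir None) = 0.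

Lemma dir_neq0 e : dir e != 0.
Proof.
case: e => [l|] /=; first by rewrite subr_eq0 eq_sym.
apply/eqP => /matrixP /(_ 0 0); rewrite !mxE eqxx => /eqP.
by rewrite oner_eq0.
Qed.

Lemma bound_gt0 : (0 < f1 - k)%N.
Proof. by have := edge_count Ve edge_cover; move: dn; lia. Qed.

Lemma exceptional_cover : poly_cover (f1 - k) exceptional.
Proof.
have lin (v : 'rV[R]_d) : poly_cover (f1 - k) [set x | v != 0 /\ dotv x v = 0].
  have [->|v0] := eqVneq v 0; first by apply: poly_coverS (poly_cover0 _ _ _) => x [].
  have vv : dotv v v != 0 by apply/lt0r_neq0/dotv_gt0.
  apply: poly_coverS (poly_cover1 (polyfunW bound_gt0 (polyfun_dotv v)) vv) => x [].
  by [].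
apply: poly_coverU; first by apply: poly_cover_bigcup => l; apply: lin.
apply: poly_coverU; first by apply: poly_cover_bigcup => l; apply: lin.
apply: poly_coverU; first by apply: poly_cover_bigcup => l; apply: lin.
by apply: poly_coverS (lin (dir None)) => x xd; split=> //; apply: dir_neq0.
Qed.

Lemma generic_neq0 x : ~ exceptional x -> x != 0.
Proof. by apply: contra_notN => /eqP ->; right; right; right; rewrite dotv0l. Qed.

Definition crossed_set x : {set lab} := [set l | crossed x (a l) (b l)]%SET.

(** Nonzero endpoints stay off x^perp near a generic x, so their signs are locally constant; an edge
    with endpoint 0 is never crossed. *)
Lemma crossed_set_near x : ~ exceptional x -> \forall y \near x, ~ exceptional y /\ crossed_set y = crossed_set x.
Proof.
move=> nbx.
have signs (v : 'rV[R]_d) : \forall y \near x, v != 0 -> dotv x v != 0 ->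
    dotv y v != 0 /\ (dotv y v < 0) = (dotv x v < 0).
  have cv := @cvg_dotv v x.
  have [lt|gt|eq] := ltgtP (dotv x v) 0.
  - have H : \forall y \near x, dotv y v < 0 by apply: (cvgr_lt _ cv).
    by apply: filterS H => y yv _ _; rewrite yv lt_eqF.
  - have H : \forall y \near x, dotv y v > 0 by apply: (cvgr_gt _ cv).
    by apply: filterS H => y yv _ _; rewrite gt_eqF // ltNge ltW.
  - by near=> y => _; rewrite ?eq ?eqxx.
have na l : a l != 0 -> dotv x (a l) != 0.
  by move=> a0; apply/eqP => xa; apply: nbx; left; exists l.
have nb l : b l != 0 -> dotv x (b l) != 0.
  by move=> b0; apply/eqP => xb; apply: nbx; right; left; exists l.
have nV i : V i != 0 -> dotv x (V i) != 0.
  by move=> V0; apply/eqP => xV; apply: nbx; right; right; left; exists i.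
have nd : dotv x (dir None) != 0 by apply/eqP => xd; apply: nbx; right; right; right.
have Ha := filter_forall _ (fun l => signs (a l)).
have Hb := filter_forall _ (fun l => signs (b l)).
have HV := filter_forall _ (fun i => signs (V i)).
have Hd := signs (dir None).
near=> y.
have ya : forall l, a l != 0 -> dotv y (a l) != 0 /\ (dotv y (a l) < 0) = (dotv x (a l) < 0).
  have H : forall l, a l != 0 -> dotv x (a l) != 0 -> dotv y (a l) != 0 /\ (dotv y (a l) < 0) = (dotv x (a l) < 0).
    by near: y; exact: Ha.
  by move=> l al; apply: H => //; apply: na.
have yb : forall l, b l != 0 -> dotv y (b l) != 0 /\ (dotv y (b l) < 0) = (dotv x (b l) < 0).
  have H : forall l, b l != 0 -> dotv x (b l) != 0 -> dotv y (b l) != 0 /\ (dotv y (b l) < 0) = (dotv x (b l) < 0).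
    by near: y; exact: Hb.
  by move=> l al; apply: H => //; apply: nb.
have yV : forall i, V i != 0 -> dotv y (V i) != 0.
  have H : forall i, V i != 0 -> dotv x (V i) != 0 -> dotv y (V i) != 0 /\ (dotv y (V i) < 0) = (dotv x (V i) < 0).
    by near: y; exact: HV.
  by move=> i Vi; have [] := H i Vi (nV i Vi).
have yd : dotv y (dir None) != 0.
  have H : dir None != 0 -> dotv x (dir None) != 0 -> dotv y (dir None) != 0 /\ (dotv y (dir None) < 0) = (dotv x (dir None) < 0).
    by near: y; exact: Hd.
  by have [] := H (dir_neq0 None) nd.
split.
  move=> [[l [l0 H]]|[[l [l0 H]]|[[i [i0 H]]|/eqP H]]].
  - by have [] := ya l l0; rewrite H eqxx.
  - by have [] := yb l l0; rewrite H eqxx.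
  - by have := yV i i0; rewrite H eqxx.
  - by rewrite (negbTE yd) in H.
apply/setP => l; rewrite !inE /crossed.
have [->|al] := eqVneq (a l) 0; first by rewrite !dotv0r !mul0r.
have [->|bl] := eqVneq (b l) 0; first by rewrite !dotv0r !mulr0.
have sgn (u v : R) : u != 0 -> v != 0 -> (u * v < 0) = (u < 0) (+) (v < 0).
  move=> u0 v0; case: (ltgtP u 0) u0 => // u0 _; case: (ltgtP v 0) v0 => // v0 _ /=.
  - by apply/negbTE; rewrite -leNgt ltW // nmulr_lgt0.
  - by rewrite nmulr_rlt0.
  - by rewrite pmulr_rlt0.
  - by apply/negbTE; rewrite -leNgt ltW // mulr_gt0.
have [ya0 yas] := ya l al; have [yb0 ybs] := yb l bl.
by rewrite !sgn ?na ?nb // yas ybs.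
Unshelve. all: end_near. Qed.

Definition base e x : 'rV[R]_d := if e is Some l then cross x (a l) (b l) else 0.

(** Ensures that [base] is a point of the section. The case [None] is that of a section reduced to
    the origin. *)
Definition admissible C e : Prop := if e is Some l then l \in C else C = finset.set0 /\ P 0.

(* Generators of the section by x^perp: the crossings, and 0 if it lies in P; idle labels
   repeat the base point. *)
Definition pts C e x (j : 'I_f1.+1) : 'rV[R]_d :=
  if unlift ord0 j is Some l then (if l \in C then cross x (a l) (b l) else base e x)
  else if `[< P 0 >] then 0 else base e x.

Lemma edge_sub l y : segment (a l) (b l) y -> P y.
Proof. by have [[c ->] _] := edge_ab l => -[]. Qed.

Lemma pts_hull x C e : ~ exceptional x -> C = crossed_set x -> admissible C e ->
  forall y, conv_hull (pts C e x) y <-> P y /\ dotv x y = 0.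
Proof.
move=> nbx CE adm.
have crossP l : l \in C -> P (cross x (a l) (b l)).
  by rewrite CE inE => cl; apply: (@edge_sub l); apply: cross_segment.
have baseP : P (base e x) /\ dotv x (base e x) = 0.
  case: e adm => [l /crossP Pc|[_ P0]] /=; first by split=> //; apply: dotv_cross.
  by rewrite dotv0r.
have ptsP j : P (pts C e x j) /\ dotv x (pts C e x j) = 0.
  rewrite /pts; case: (unlift ord0 j) => [l|].
    by case: ifP => // /crossP Pc; split=> //; apply: dotv_cross.
  by case: ifP => // /asboolP P0; rewrite dotv0r.
move=> y; split=> [yc|[Py xy]].
  split; first by apply: conv_hull_sub yc => j; have [] := ptsP j.
  apply/eqP; rewrite eq_le (conv_hull_le yc) => [|j]; last by have [_ ->] := ptsP j.
  rewrite -oppr_le0 -dotvNl (conv_hull_le yc) // => j.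
  by rewrite dotvNl; have [_ ->] := ptsP j; rewrite oppr0.
apply: contrapT => /conv_hull_separation [g gpts].
pose M := \big[Num.max/dotv g y - 1]_j dotv g (pts C e x j).
have My : M < dotv g y.
  rewrite /M; elim/big_ind: _ => //; first by rewrite ltrBlDr ltrDl.
  by move=> u v; rewrite gt_max => -> ->.
have gM j : dotv g (pts C e x j) <= M by rewrite /M (bigD1 j) //= le_max lexx.
suff : dotv g y <= M by rewrite leNgt My.
apply: (section_functional_le Ve edge_cover _ _ _ Py xy) => [i xi|l cl|P0].
- by apply/eqP; apply: contrapT => /negP Vi; apply: nbx; right; right; left; exists i.
- have := gM (lift ord0 l); rewrite /pts liftK (_ : l \in C) //.
  by rewrite CE inE.
- have := gM ord0; rewrite /pts unlift_none; case: ifP => [_|/asboolP //].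
  by rewrite dotv0r.
Qed.

Lemma section_empty x : ~ exceptional x -> crossed_set x = finset.set0 -> ~ P 0 ->
  forall y, P y -> dotv x y != 0.
Proof.
move=> nbx C0 nP0 y Py; apply/eqP => xy.
(* With no generators every bound holds vacuously, even -1 for the zero functional. *)
suff : dotv 0 y <= -1 :> R by rewrite dotv0l; lra.
apply: (section_functional_le Ve edge_cover _ _ _ Py xy) => [i xi|l cl|//].
  by apply/eqP; apply: contrapT => /negP Vi; apply: nbx; right; right; left; exists i.
by have : l \in crossed_set x by [rewrite inE]; rewrite C0 finset.in_set0.
Qed.

Lemma dir_form x C e : ~ exceptional x -> C = crossed_set x -> admissible C e -> dotv (dir e) x != 0.
Proof.
move=> nbx CE; case: e => [l /=|_].
  rewrite CE inE dotvC => /crossed_neq; rewrite dotvBr; exact.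
by rewrite dotvC; apply/eqP => xd; apply: nbx; right; right; right.
Qed.

Lemma proj_ex e : exists Pk : 'M[R]_(d, k) * R, [/\ Pk.2 != 0, dir e *m Pk.1 = 0 &
  forall x, proj_form Pk.1 x = Pk.2 * dotv (dir e) x].
Proof. by have [Pi [kappa H]] := projection_along (dir_neq0 e); exists (Pi, kappa). Qed.

Definition proj e := (projT1 (cid (proj_ex e))).1.
Definition scale e := (projT1 (cid (proj_ex e))).2.

Lemma projP e : [/\ scale e != 0, dir e *m proj e = 0 &
  forall x, proj_form (proj e) x = scale e * dotv (dir e) x].
Proof. exact: projT2 (cid (proj_ex e)). Qed.

Lemma rho_generic x C e : ~ exceptional x -> C = crossed_set x -> admissible C e ->
  rho_I P x = hull_vol (fun j => pts C e x j *m proj e) / `|scale e * dotv (dir e) x|.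
Proof.
move=> nbx CE adm; have [s0 _ L] := projP e; rewrite -L.
apply: rho_hull_vol; first exact: generic_neq0.
  exact: pts_hull.
by rewrite L mulf_neq0 // (dir_form nbx CE adm).
Qed.

Lemma pts_cvg x C e i j : C = crossed_set x -> admissible C e ->
  pts C e y i 0 j @[y --> x] --> pts C e x i 0 j.
Proof.
move=> CE adm; have cc l : l \in C -> cross y (a l) (b l) 0 j @[y --> x] --> cross x (a l) (b l) 0 j.
  by rewrite CE inE; apply: cvg_cross.
have cb : base e y 0 j @[y --> x] --> base e x 0 j.
  case: e adm => [l lC|_]; [exact: (@cc l lC)|by apply: (@cvg_near_cst _ _ _ _ _ (nbhs_filter x)); apply: nearW].
rewrite /pts; case: (unlift ord0 i) => [l|].
  by have [lC|lC] := boolP (l \in C); [exact: cc|exact: cb].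
by case: ifP => _; [by apply: (@cvg_near_cst _ _ _ _ _ (nbhs_filter x)); apply: nearW|exact: cb].
Qed.

Lemma rho_cvg x C e : ~ exceptional x -> C = crossed_set x -> admissible C e ->
  rho_I P y @[y --> x] --> rho_I P x.
Proof.
move=> nbx CE adm; rewrite (rho_generic nbx CE adm).
have near_eq : \forall y \near x, rho_I P y =
    hull_vol (fun j => pts C e y j *m proj e) / `|scale e * dotv (dir e) y|.
  apply: filterS (crossed_set_near nbx) => y [nby Cy].
  by apply: rho_generic => //; rewrite Cy.
have cW : hull_vol (fun j => pts C e y j *m proj e) @[y --> x] -->
    hull_vol (fun j => pts C e x j *m proj e).
  apply: (hull_vol_cvg (W := fun y j => pts C e y j *m proj e)) => i j.
  have : cvg_mx (nbhs x) (fun y => pts C e y i) (pts C e x i).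
    by move=> i' j'; rewrite ord1; apply: pts_cvg.
  move=> /(@cvg_mxM R _ (nbhs x) (nbhs_filter x) 1 d k _ (fun=> proj e) _ (proj e)) H.
  by apply: H => i' j'; exact: cvg_cst.
have cL : `|scale e * dotv (dir e) y| @[y --> x] --> `|scale e * dotv (dir e) x|.
  have cd : dotv (dir e) y @[y --> x] --> dotv (dir e) x.
    by under eq_fun do rewrite dotvC; rewrite dotvC; exact: cvg_dotv.
  exact: (cvg_norm (cvgM (cvg_cst (scale e)) cd)).
have L0 : `|scale e * dotv (dir e) x| != 0.
  by have [s0 _ _] := projP e; rewrite normr_eq0 mulf_neq0 // (dir_form nbx CE adm).
refine (cvg_trans (@near_eq_cvg _ _ (nbhs x) (nbhs_filter x) _ _ _) (cvgM cW (cvgV L0 cL))).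
by apply: filterS near_eq => y ->.
Qed.

(** The rows of degree one in x: crossed edges other than the one projected along. *)
Definition proper C e (j : 'I_f1.+1) : bool :=
  if unlift ord0 j is Some l then (l \in C) && (Some l != e) else false.

Definition anchor e : 'rV[R]_d := if e is Some l then a l else 0.

Definition den C e (j : 'I_f1.+1) x : R :=
  if unlift ord0 j is Some l then
    if (l \in C) && (Some l != e) then dotv x (b l) - dotv x (a l) else 1
  else 1.

Definition num C e (j : 'I_f1.+1) x : 'rV[R]_d :=
  if unlift ord0 j is Some l then
    if (l \in C) && (Some l != e) then dotv x (b l) *: a l - dotv x (a l) *: b l else anchor e
  else if `[< P 0 >] then 0 else anchor e.

(** The crossing of edge e differs from the endpoint [a l] by a multiple of the direction killed by
    the projection. *)
Lemma base_proj x C e : C = crossed_set x -> admissible C e ->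
  base e x *m proj e = anchor e *m proj e.
Proof.
move=> CE; have [_ dP _] := projP e; case: e dP => [l|] //= dP lC.
have /crossed_neq D0 : crossed x (a l) (b l) by move: lC; rewrite CE inE.
rewrite crossE //; set t := - _ / _.
have -> : (1 - t) *: a l + t *: b l = a l + t *: (b l - a l).
  by apply/rowP => i; rewrite !mxE; ring.
by rewrite mulmxDl -scalemxAl dP scaler0 addr0.
Qed.

(* Homogeneous coordinates of the projected generators: projecting along the edge e makes its
   crossing independent of x, which saves one factor in the common denominator. *)
Lemma row_pts x C e j : C = crossed_set x -> admissible C e ->
  den C e j x != 0 /\
  rcons0 (den C e j x) (num C e j x *m proj e) = den C e j x *: hom (pts C e x j *m proj e).
Proof.
move=> CE adm; have bp := base_proj CE adm.
rewrite rcons0Z mulr1 /den /num /pts; case: (unlift ord0 j) => [l|]; last first.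
  by rewrite oner_neq0 scale1r; split=> //; case: ifP; rewrite ?bp.
case: ifPn => [/andP[lC le]|nle].
  have D0 : dotv x (b l) - dotv x (a l) != 0.
    by apply: crossed_neq; move: lC; rewrite CE inE.
  by rewrite lC; split=> //; rewrite /cross -scalemxAl scalerA mulfV // scale1r.
rewrite oner_neq0 scale1r; split=> //.
case: ifPn => [lC|_]; last by rewrite bp.
by move: nle; rewrite lC negbK => /eqP eE; rewrite -bp -eE.
Qed.

(* Clearing denominators in rho = 1: T lists the simplices of a triangulation of the projected
   section, sg and s0 the signs needed to drop the absolute values. *)
Definition boundary_fun C e (T : {set {set 'I_f1.+1}}) (sg : {ffun {set 'I_f1.+1} -> bool}) (s0 : bool) x : R :=
  (-1) ^+ s0 * (scale e * dotv x (dir e)) * \prod_j den C e j x +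
  - simplex_const R k * \sum_(s : {set 'I_f1.+1} | (s \in T) && (#|s| == d))
    (-1) ^+ sg s * (\det (\matrix_i rcons0 (den C e (elt s i) x) (num C e (elt s i) x *m proj e)) *
      \prod_(j in ~: s) den C e j x).

(** In the product of all denominators, those indexed by s are absorbed by the rows of its
    determinant and the others stay as factors. *)
Lemma boundary_funE x C e T sg s0 : C = crossed_set x -> admissible C e ->
  boundary_fun C e T sg s0 x = \prod_j den C e j x * ((-1) ^+ s0 * (scale e * dotv x (dir e)) -
    simplex_const R k * \sum_(s : {set 'I_f1.+1} | (s \in T) && (#|s| == d))
      (-1) ^+ sg s * \det (simplex_mx (fun j => pts C e x j *m proj e) s)).
Proof.
move=> CE adm; rewrite /boundary_fun mulrBr mulrC; congr (_ + _).
rewrite mulNr mulrCA; congr (- (_ * _)); rewrite mulr_sumr; apply: eq_bigr => s /andP[_ /eqP sd].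
rewrite [RHS]mulrCA; congr (_ * _).
pose D : 'rV[R]_d := \row_i den C e (elt s i) x.
have -> : (\matrix_i rcons0 (den C e (elt s i) x) (num C e (elt s i) x *m proj e)) =
    diag_mx D *m simplex_mx (fun j => pts C e x j *m proj e) s.
  apply/matrixP => i j; rewrite mul_diag_mx [LHS]mxE [RHS]mxE [D _ _]mxE [simplex_mx _ _ _ _]mxE.
  by have [_ ->] := row_pts (elt s i) CE adm; rewrite mxE.
have -> : \det (diag_mx D *m simplex_mx (fun j => pts C e x j *m proj e) s) =
    \prod_(j in s) den C e j x * \det (simplex_mx (fun j => pts C e x j *m proj e) s).
  rewrite det_mulmx det_diag (big_elt _ _ sd); congr (_ * _).
  by apply: eq_bigr => i _; rewrite mxE.
rewrite mulrAC; congr (_ * _); rewrite [RHS](bigID (mem s)) /=; congr (_ * _).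
by apply: eq_bigl => j; rewrite inE.
Qed.

(** The leading 1 is the degree of the linear form in [dir e]; omitting the projected edge
    compensates it. With no crossed edge only that form remains, hence the maximum with 1. *)
Lemma sum_proper C e l0 : (l0 \in C) && (e == Some l0) || (C == finset.set0) && (e == None) ->
  (1 + \sum_j proper C e j <= maxn 1 #|C|)%N.
Proof.
move=> H; rewrite big_ord_recl {1}/proper unlift_none add0n.
have -> : (\sum_(j < f1) proper C e (lift ord0 j) = #|[set l in C | Some l != e]%SET|)%N.
  rewrite -sum1_card [RHS]big_mkcond /=; apply: eq_bigr => l _.
  by rewrite /proper liftK inE; case: ifP.
case/orP: H => /andP[H /eqP ->]; last first.
  rewrite (eqP H) (_ : [set l in _ | _]%SET = finset.set0) ?cards0 //.
  by apply/setP => l; rewrite !inE.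
have -> : [set l in C | Some l != Some l0]%SET = C :\ l0.
  by apply/setP => l; rewrite !inE andbC; congr (_ && _).
by rewrite (cardsD1 l0 C) H leq_max leqnn orbT.
Qed.

Lemma polyfun_den C e j : polyfun (proper C e j) (den C e j).
Proof.
rewrite /proper /den; case: (unlift ord0 j) => [l|]; last exact: polyfun_cst.
case: ((l \in C) && (Some l != e)); last exact: polyfun_cst.
apply: polyfunD; first exact: polyfun_dotv.
under eq_fun do rewrite -mulN1r; apply: polyfunZ; exact: polyfun_dotv.
Qed.

Lemma polyfun_num C e j i : polyfun (proper C e j) (fun x => num C e j x 0 i).
Proof.
rewrite /proper /num; case: (unlift ord0 j) => [l|]; last first.
  by case: `[< P 0 >]; exact: polyfun_cst.
case: ((l \in C) && (Some l != e)); last exact: polyfun_cst.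
under eq_fun do rewrite !mxE [_ * a l 0 i]mulrC [_ * b l 0 i]mulrC -mulNr.
by apply: polyfunD; apply: polyfunZ; exact: polyfun_dotv.
Qed.

Lemma polyfun_boundary C e T sg s0 :
  polyfun (1 + \sum_j proper C e j) (boundary_fun C e T sg s0).
Proof.
apply: polyfunD.
  apply: polyfunM; last by apply: polyfun_prod => j _; apply: polyfun_den.
  apply: polyfunZ; apply: polyfunZ; exact: polyfun_dotv.
apply: (@polyfunW _ _ (\sum_j proper C e j)); first by rewrite leq_addl.
apply: polyfunZ; apply: polyfun_sum => s /andP[_ /eqP sd]; apply: polyfunZ.
have -> : (\sum_j proper C e j = \sum_(i < d) proper C e (elt s i) + \sum_(j in ~: s) proper C e j)%N.
  rewrite (bigID (mem s)) /= -(big_elt _ (fun j => proper C e j : nat) sd); congr (_ + _)%N.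
  by apply: eq_bigl => j; rewrite inE.
apply: polyfunM; last by apply: polyfun_prod => j _; apply: polyfun_den.
apply: polyfun_det => i j; under eq_fun do rewrite mxE rcons0E.
case: (unlift ord0 j) => [l|]; last exact: polyfun_den.
under eq_fun do rewrite mxE; apply: polyfun_sum => p _.
under eq_fun do rewrite mulrC; apply: polyfunZ; exact: polyfun_num.
Qed.

(** The condition at 2x certifies that the polynomial is nonzero. *)
Definition cell C e T sg s0 := [set x | [/\ ~ exceptional x, C = crossed_set x, admissible C e,
  boundary_fun C e T sg s0 x = 0 & boundary_fun C e T sg s0 (2 *: x) != 0]].

Lemma cell_cover C e T sg s0 : poly_cover (f1 - k) (cell C e T sg s0).
Proof.
have [[x [nbx CE adm _ F2]]|nE] := pselect (cell C e T sg s0 !=set0); last first.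
  by apply: poly_coverS (poly_cover0 _ _ _) => x cx; apply: nE; exists x.
apply: (@poly_coverS _ _ _ _ [set x | boundary_fun C e T sg s0 x = 0]); first by move=> y [].
apply: poly_cover1 F2; apply: polyfunW (polyfun_boundary C e T sg s0).
have [l0 H] : exists l0, (l0 \in C) && (e == Some l0) || (C == finset.set0) && (e == None).
  case: e adm => [l lC|[-> _]]; first by exists l; rewrite lC eqxx.
  by exists (Ordinal (leq_trans bound_gt0 (leq_subr k f1))); rewrite !eqxx orbT.
apply: leq_trans (sum_proper H) _; rewrite geq_max bound_gt0 /=.
have [->|[l lC]] := set_0Vmem C; first by rewrite cards0.
have cl : crossed x (a l) (b l) by move: lC; rewrite CE inE.
(* At most f1 + 2 - n edges are crossed, and n is at least k + 2. *)
have := crossed_count Ve edge_ab edge_cover cl; rewrite -/(crossed_set x) -CE.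
by move: dn; move: #|C| => N; lia.
Qed.

Lemma boundary_cell x : ~ exceptional x -> eboundary (intersection_body P) x ->
  exists C e T sg s0, cell C e T sg s0 x.
Proof.
move=> nbx bdx; have x0 := generic_neq0 nbx.
have [e adm] : exists e, admissible (crossed_set x) e.
  have [C0|[l lC]] := set_0Vmem (crossed_set x); last by exists (Some l).
  have [P0|nP0] := pselect (P 0); first by exists None.
  (* The section is empty around x, so rho vanishes there and x cannot be a boundary point. *)
  have near_rho : \forall y \near x, rho_I P y = 0.
    apply: filterS (crossed_set_near nbx) => y [nby Cy].
    apply: rho_empty; first exact: generic_neq0.
    by apply: section_empty; rewrite ?Cy.
  have rho0 : rho_I P x = 0 by exact: nbhs_singleton near_rho.
  have cv : rho_I P y @[y --> x] --> rho_I P x.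
    by rewrite rho0; exact: (@cvg_near_cst _ _ _ _ _ (nbhs_filter x) near_rho).
  have /eqP := eboundary_intersection_body x0 cv bdx.
  by rewrite rho0 eq_sym oner_eq0.
pose C := crossed_set x; have CE : C = crossed_set x by [].
have rho1 := eboundary_intersection_body x0 (rho_cvg nbx CE adm) bdx.
pose W y j := pts C e y j *m proj e.
pose L := scale e * dotv (dir e) x.
have L0 : L != 0 by have [s0 _ _] := projP e; rewrite mulf_neq0 // (dir_form nbx CE adm).
have vol : hull_vol (W x) = `|L|.
  have := rho1; rewrite (rho_generic nbx CE adm) -/L => /(congr1 ( *%R^~ `|L|)).
  by rewrite divfK ?normr_eq0 // mul1r.
have [om _ gom] := generic_heights_dense (W x) 0 ltr01.
pose T := [set s | lower (W x) (om 0) s]%SET.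
pose sg : {ffun {set 'I_f1.+1} -> bool} := [ffun s => \det (simplex_mx (W x) s) < 0].
have sumE : simplex_const R k * (\sum_(s | (s \in T) && (#|s| == d))
    (-1) ^+ sg s * \det (simplex_mx (W x) s)) = `|L|.
  rewrite -vol (hull_volE gom); congr (_ * _); apply: eq_big => [s|s _].
    by rewrite inE /lower; case: (#|s| == d); rewrite ?andbT.
  by rewrite ffunE [RHS]normrEsign.
(* Doubling x keeps the crossed edges and their crossing points but doubles the linear form, so the
   bracket in [boundary_funE] goes from 0 to [|L|]. *)
have two (u v : 'rV[R]_d) : dotv (2 *: u) v = 2 * dotv u v := dotvZl u v 2.
have C2 : C = crossed_set (2 *: x).
  apply/setP => l; rewrite !inE /crossed !two mulrACA.
  by rewrite [RHS]pmulr_rlt0 // mulr_gt0.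
have W2 : pts C e (2 *: x) =1 pts C e x.
  have cr (u v : 'rV[R]_d) : cross (2 *: x) u v = cross x u v.
    apply/rowP => i; rewrite !mxE !two -mulrBr invfM -!(mulrA 2) -mulrBr mulrACA.
    by rewrite mulVf ?mul1r // pnatr_eq0.
  have b2 : base e (2 *: x) = base e x by rewrite /base; case: (e) => // l; apply: cr.
  by move=> j; rewrite /pts b2; case: (unlift ord0 j) => // l; rewrite cr.
have [s0 LE] : exists s0 : bool, (-1) ^+ s0 * L = `|L|.
  by exists (L < 0); rewrite [RHS]normrEsign.
exists C, e, T, sg, s0; split=> //.
  rewrite (boundary_funE _ _ _ CE adm) (dotvC x) -/L sumE.
  by rewrite [X in _ * (X - _)](_ : _ = `|L|) ?subrr ?mulr0.
rewrite (boundary_funE _ _ _ C2 adm) two.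
have -> : (-1) ^+ s0 * (scale e * (2 * dotv x (dir e))) = 2 * `|L| by rewrite -LE /L (dotvC x); ring.
have -> : (fun j => pts C e (2 *: x) j *m proj e) = W x.
  by apply/funext => j; rewrite W2.
rewrite sumE (_ : 2 * `|L| - `|L| = `|L|); last by ring.
rewrite mulf_neq0 ?normr_eq0 // prodf_seq_neq0; apply/allP => j _.
by have [-> _] := row_pts j C2 adm.
Qed.

Lemma boundary_cover : poly_cover (f1 - k) (eboundary (intersection_body P)).
Proof.
apply: (@poly_coverS _ _ _ _ (exceptional `|` [set x | exists C, [set x | exists e, [set x | exists T,
    [set x | exists sg, [set x | exists s0, cell C e T sg s0 x] x] x] x] x])).
  move=> x bdx; have [bx|nbx] := pselect (exceptional x); [by left|right].
  exact: boundary_cell.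
apply: poly_coverU; first exact: exceptional_cover.
do 5!apply: poly_cover_bigcup => ?.
exact: cell_cover.
Qed.

End Data.
End IntersectionBodyBoundary.

Theorem theorem5p6 (R : realType) (d : nat) (P : set 'rV[R]_d) (f1 : nat) :
  (0 < d)%N ->
  full_dim_polytope P ->
  num_edges P f1 ->
  forall Z : set 'rV[R]_d,
    irreducible_component (algebraic_boundary (intersection_body P)) Z ->
    degree_le Z (f1 - d.-1)%N.
Proof.
case: d P => // k P _ [[n0 [V0 PE]] intP] nE Z.
(* Edge counting needs every generator to be an exposed vertex. *)
have [n [V [VE Ve]]] := conv_hull_irredundant V0; rewrite {}VE in PE; subst P.
have dn := full_dim_card intP.
have [a [b [ab_neq edge_ab edge_cover]]] := edge_enumeration nE.
exact: component_degree_le (boundary_cover Ve dn ab_neq edge_ab edge_cover).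
Qed.
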